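(* Let $d\ge 1$ be an integer, $b$ a prime and $v\ge 0$ an integer. Let $1\leq p,q<\infty$ and $0\leq r<1/\max(p,q)$. There exists a constant $C_{p,q,r,d,b,v}>0$ such that for every positive integer $n$ and every order $2$ digital $(v,n,d)$-net $\mathcal{P}_n^b$ over $\mathbb{F}_b$ we have \[ \left\|D_{\mathcal{P}_n^b}\,|\,S_{p,q}^rF([0,1)^d)\right\|\leq C_{p,q,r,d,b,v}\,b^{n(r-1)}\,n^{(d-1)/q}. \]
   Context: Discrepancy function: for a finite family $\mathcal{P}$ of $N$ points in $[0,1)^d$ (points counted with multiplicity), $D_{\mathcal{P}}(x)=\frac1N\sum_{z\in\mathcal{P}}\chi_{[0,x)}(z)-x_1\cdots x_d$ for $x=(x_1,\ldots,x_d)\in[0,1)^d$, where $\chi_{[0,x)}$ is the characteristic function of $[0,x)=[0,x_1)\times\cdots\times[0,x_d)$. Digital nets: let $b$ be prime and let $\mathbb{F}_b$ be the field with $b$ elements, identified with $\{0,1,\ldots,b-1\}$ with arithmetic modulo $b$. For $s,n\in\mathbb{N}$ with $s\ge n$ let $C_1,\ldots,C_d$ be $s\times n$ matrices over $\mathbb{F}_b$. For $\nu\in\{0,\ldots,b^n-1\}$ with $b$-adic expansion $\nu=\nu_0+\nu_1b+\cdots+\nu_{n-1}b^{n-1}$ put $\bar\nu=(\nu_0,\ldots,\nu_{n-1})^\top\in\mathbb{F}_b^n$, $C_i\bar\nu=(x_{i,\nu,1},\ldots,x_{i,\nu,s})^\top\in\mathbb{F}_b^s$, $x_{i,\nu}=x_{i,\nu,1}b^{-1}+\cdots+x_{i,\nu,s}b^{-s}\in[0,1)$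 and $x_\nu=(x_{1,\nu},\ldots,x_{d,\nu})$. The family $\mathcal{P}_n^b=\{x_0,\ldots,x_{b^n-1}\}$ of $N=b^n$ points (with multiplicity) is called a digital net over $\mathbb{F}_b$. Order $\sigma$ digital $(v,n,d)$-net: let $\sigma\in\mathbb{N}$, $s\ge\sigma n$, and let $0\le v\le\sigma n$ be an integer. Let $c_{i,1},\ldots,c_{i,s}\in\mathbb{F}_b^n$ be the rows of $C_i$. If for all choices of $0\le\eta_i\le s$ and indices $1\le\lambda_{i,\eta_i}<\cdots<\lambda_{i,1}\le s$ ($1\le i\le d$) with \[\sum_{i=1}^d\left(\lambda_{i,1}+\cdots+\lambda_{i,\min(\eta_i,\sigma)}\right)\le\sigma n-v\] the vectors $c_{1,\lambda_{1,1}},\ldots,c_{1,\lambda_{1,\eta_1}},\ldots,c_{d,\lambda_{d,1}},\ldots,c_{d,\lambda_{d,\eta_d}}$ are linearly independent over $\mathbb{F}_b$, then $\mathcal{P}_n^b$ is called an order $\sigma$ digital $(v,n,d)$-net over $\mathbb{F}_b$. Triebel-Lizorkin spaces with dominating mixed smoothness: let $\mathcal{F}$ be the Fourier transform on tempered distributions $\mathcal{S}'(\mathbb{R}^d)$. Fix $\varphi_0\in\mathcal{S}(\mathbb{R})$ with $\varphi_0(x)=1$ for $|x|\le1$ and $\varphi_0(x)=0$ for $|x|>\frac32$; put $\varphi_k(x)=\varphi_0(2^{-k}x)-\varphi_0(2^{-k+1}x)$ for $k\in\mathbb{N}$ and $\varphi_{\bar k}(x)=\varphi_{k_1}(x_1)\cdots\varphi_{k_d}(x_d)$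 for $\bar k=(k_1,\ldots,k_d)\in\mathbb{N}_0^d$. For $0<p<\infty$, $0<q\le\infty$, $r\in\mathbb{R}$, $S_{p,q}^rF(\mathbb{R}^d)$ consists of all $f\in\mathcal{S}'(\mathbb{R}^d)$ with finite quasi-norm \[\|f|S_{p,q}^rF(\mathbb{R}^d)\|=\Big\|\Big(\sum_{\bar k\in\mathbb{N}_0^d}2^{r(k_1+\cdots+k_d)q}\,|\mathcal{F}^{-1}(\varphi_{\bar k}\mathcal{F}f)(\cdot)|^q\Big)^{1/q}\Big|\,L_p(\mathbb{R}^d)\Big\|\] (supremum if $q=\infty$). Let $\mathcal{D}'([0,1)^d)$ be the space of distributions dual to the smooth complex-valued functions on $\mathbb{R}^d$ with compact support in the interior of $[0,1)^d$. $S_{p,q}^rF([0,1)^d)$ consists of all $f\in\mathcal{D}'([0,1)^d)$ with finite quasi-norm $\|f|S_{p,q}^rF([0,1)^d)\|=\inf\{\|g|S_{p,q}^rF(\mathbb{R}^d)\|:\ g\in S_{p,q}^rF(\mathbb{R}^d),\ g|_{[0,1)^d}=f\}$. *)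

(* Defs.v *)
From HB Require Import structures.
From mathcomp Require Import all_boot all_order all_algebra.
From mathcomp Require Import all_classical all_reals all_analysis.
From mathcomp Require Import complex.

Set Implicit Arguments.
Unset Strict Implicit.
Unset Printing Implicit Defensive.

Import Order.TTheory GRing.Theory Num.Theory.
Import numFieldNormedType.Exports.

Local Open Scope classical_set_scope.
Local Open Scope complex_scope.
Local Open Scope ring_scope.

Section lebesgue_step.
Local Open Scope ereal_scope.
Context {R : realType} (d : nat).
Let T := measurableTypeR R.
Variable m : {sigma_finite_measure set (d.-tuple T) -> \bar R}.

Definition tuple_cons (u : T * d.-tuple T) : d.+1.-tuple T :=
  [tuple of u.1 :: u.2].

Definition lebesgue_step : set (d.+1.-tuple T) -> \bar R :=
  pushforward (@lebesgue_measure R \x m) tuple_cons.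

Let uncons (t : d.+1.-tuple T) : T * d.-tuple T := (thead t, [tuple of behead t]).

Let consK u : uncons (tuple_cons u) = u.
Proof. by case: u => x t; congr pair; apply: val_inj. Qed.

Let measurable_cons_preimage A :
  measurable A -> measurable (tuple_cons @^-1` A).
Proof.
by move=> mA; rewrite -[X in measurable X]setTI; exact: measurable_cons.
Qed.

Let measurable_uncons : measurable_fun setT uncons.
Proof.
apply: measurable_fun_pair; last exact: measurable_behead.
exact: measurable_tnth.
Qed.

Let step0 : lebesgue_step set0 = 0.
Proof. by rewrite /lebesgue_step /pushforward preimage_set0 measure0. Qed.

Let step_ge0 A : 0 <= lebesgue_step A.
Proof. by rewrite /lebesgue_step /pushforward measure_ge0. Qed.

Let step_sigma_additive : semi_sigma_additive lebesgue_step.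
Proof.
move=> F mF tF mUF; rewrite /lebesgue_step /pushforward preimage_bigcup.
apply: measure_semi_sigma_additive.
- by move=> n; exact: measurable_cons_preimage.
- apply/trivIsetP => /= i j _ _ ij; rewrite -preimage_setI.
  by move/trivIsetP : tF => /(_ _ _ _ _ ij) ->//; rewrite preimage_set0.
- by rewrite -preimage_bigcup; exact: measurable_cons_preimage.
Qed.

HB.instance Definition _ := isMeasure.Build _ _ _ lebesgue_step
  step0 step_ge0 step_sigma_additive.

Let step_sigma_finite : sigma_finite setT lebesgue_step.
Proof.
have /sigma_finiteP[F [FT ndF Foo]] := sigma_finiteT (@lebesgue_measure R).
have /sigma_finiteP[G [GT ndG Goo]] := sigma_finiteT m.
exists (fun n => uncons @^-1` (F n `*` G n)).
  rewrite -preimage_bigcup; apply/esym/seteqP; split => // t _.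
  have [i _ Fi] : (\bigcup_i F i) (thead t) by rewrite -FT.
  have [j _ Gj] : (\bigcup_i G i) [tuple of behead t] by rewrite -GT.
  exists (maxn i j) => //; split => /=.
    by move: Fi; exact/subsetPset/ndF/leq_maxl.
  by move: Gj; exact/subsetPset/ndG/leq_maxr.
move=> n; have [mF ?] := Foo n; have [mG ?] := Goo n; split.
  by rewrite -[X in measurable X]setTI; apply: measurable_uncons => //;
    exact: measurableX.
rewrite /lebesgue_step /pushforward -comp_preimage.
rewrite (_ : uncons \o tuple_cons = id); last exact/funext/consK.
by rewrite preimage_id product_measure1E// lte_mul_pinfty// ge0_fin_numE.
Qed.

HB.instance Definition _ := Measure_isSigmaFinite.Build _ _ _ lebesgue_step
  step_sigma_finite.

End lebesgue_step.

(* 'rV[R]_d carries the normed space structure but no measurable one, d.-tuple R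
   carries its product sigma-algebra; [rV_of_tuple] below goes from one to the
   other. *)
Fixpoint lebesgue_tuple {R : realType} (d : nat) :
    {sigma_finite_measure set (d.-tuple (measurableTypeR R)) -> \bar R} :=
  match d with
  | 0 => @dirac _ (0.-tuple (measurableTypeR R)) [tuple] R
  | d'.+1 => lebesgue_step (lebesgue_tuple d')
  end.

Lemma lebesgue_tuple_box (R : realType) (d : nat)
    (A : 'I_d -> set (measurableTypeR R)) : (forall i, measurable (A i)) ->
  lebesgue_tuple d [set t | forall i, A i (tnth t i)]
    = (\prod_(i < d) lebesgue_measure (A i))%E.
Proof.
elim: d A => [|d IHd] A mA.
  rewrite big_ord0 /= diracE mem_set//=.
  by move=> [].
rewrite big_ord_recl -IHd; last by move=> i; exact: mA.
rewrite /= /lebesgue_step /pushforward.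
have mB : measurable [set t : d.-tuple (measurableTypeR R) |
    forall i, A (lift ord0 i) (tnth t i)].
  rewrite [X in measurable X](_ : _ = \bigcap_(i in [set: 'I_d])
      ((@tnth d _ ^~ i) @^-1` A (lift ord0 i))).
    apply: fin_bigcap_measurable; first exact: finite_finset.
    move=> i _; rewrite -[X in measurable X]setTI.
    exact: measurable_tnth.
  by apply/seteqP; split=> [t tA i _|t tA i]; exact: tA.
rewrite -product_measure1E//; congr (_ _).
apply/seteqP; split=> [[x t] /= xtA|[x t] /= [xA tA] i].
  split; first exact: (xtA ord0).
  by move=> i; have := xtA (lift ord0 i); rewrite tnthS.
have [->//|[j ->]] : i = ord0 \/ exists j, i = lift ord0 j.
  by case: (unliftP ord0 i) => [j|] ->; [right; exists j|left].
by rewrite tnthS; exact: tA.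
Qed.

Section euclidean.
Context {R : realType} {d : nat}.
Local Notation Rd := 'rV[R]_d.
Local Notation C := R[i].
Local Notation mu := (@lebesgue_tuple R d).

Definition rV_of_tuple (t : d.-tuple (measurableTypeR R)) : Rd :=
  \row_i tnth t i.

Definition integral_rV (D : set Rd) (f : Rd -> R) : R :=
  \int[mu]_(t in rV_of_tuple @^-1` D) f (rV_of_tuple t).

Definition integrable_rV (D : set Rd) (f : Rd -> R) : Prop :=
  mu.-integrable (rV_of_tuple @^-1` D) (EFin \o (f \o rV_of_tuple)).

Definition cintegral (D : set Rd) (f : Rd -> C) : C :=
  integral_rV D (fun x => complex.Re (f x)) +i* integral_rV D (fun x => complex.Im (f x)).

Definition cintegrable (D : set Rd) (f : Rd -> C) : Prop :=
  integrable_rV D (fun x => complex.Re (f x)) /\ integrable_rV D (fun x => complex.Im (f x)).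

Definition ccontinuous (f : Rd -> C) : Prop :=
  continuous (fun x => complex.Re (f x)) /\ continuous (fun x => complex.Im (f x)).

(* [rpderiv [:: i1; ...; im] f] is D_i1 (... (D_im f)). *)
Definition rpderiv (s : seq 'I_d) (f : Rd -> R) : Rd -> R :=
  foldr (fun i g => 'D_(delta_mx 0 i) g) f s.

Definition rsmooth (f : Rd -> R) : Prop :=
  forall s : seq 'I_d, continuous (rpderiv s f) /\
    forall (x : Rd) (i : 'I_d), derivable (rpderiv s f) x (delta_mx 0 i).

Definition smooth (f : Rd -> C) : Prop :=
  rsmooth (fun x => complex.Re (f x)) /\ rsmooth (fun x => complex.Im (f x)).

Definition pderiv (s : seq 'I_d) (f : Rd -> C) (x : Rd) : C :=
  rpderiv s (fun y => complex.Re (f y)) x +i* rpderiv s (fun y => complex.Im (f y)) x.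

Definition schwartz_norm (N : nat) (f : Rd -> C) : \bar R :=
  ereal_sup [set z | exists (s : seq 'I_d) (x : Rd),
    (size s <= N)%N /\ z = ((1 + `|x|) ^+ N * Normc.normc (pderiv s f x))%:E].

Definition schwartz (f : Rd -> C) : Prop :=
  smooth f /\ forall N, (schwartz_norm N f < +oo)%E.

(* Functionals are total on Rd -> C, but only their values on Schwartz functions
   (on test functions, for distributions on the cube) are ever relevant:
   [tempered] is membership in S'(R^d), and two functionals that agree on
   Schwartz functions stand for the same tempered distribution. *)
Definition functional := (Rd -> C) -> C.

Definition tempered (T : functional) : Prop :=
  (forall (a : C) (f g : Rd -> C), schwartz f -> schwartz g ->
     T (fun x => a * f x + g x) = a * T f + T g) /\
  exists (N : nat) (M : R), forall f, schwartz f ->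
    ((Normc.normc (T f))%:E <= M%:E * schwartz_norm N f)%E.

Definition expi (t : R) : C := cos t +i* sin t.

Definition dotr (x y : Rd) : R := \sum_i x 0 i * y 0 i.

Definition fourier (f : Rd -> C) (xi : Rd) : C :=
  ((2 * pi) `^ (- (d%:R / 2)))%:C *
    cintegral setT (fun x => f x * expi (- dotr x xi)).

Definition inv_fourier (f : Rd -> C) (x : Rd) : C :=
  ((2 * pi) `^ (- (d%:R / 2)))%:C *
    cintegral setT (fun xi => f xi * expi (dotr x xi)).

Definition distr_fourier (T : functional) : functional := fun f => T (fourier f).

Definition distr_inv_fourier (T : functional) : functional :=
  fun f => T (inv_fourier f).

Definition distr_mul (psi : Rd -> C) (T : functional) : functional :=
  fun f => T (fun x => psi x * f x).

Definition represents (h : Rd -> C) (T : functional) : Prop :=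
  ccontinuous h /\ forall f, schwartz f ->
    cintegrable setT (fun x => h x * f x) /\
    T f = cintegral setT (fun x => h x * f x).

Definition dyadic_piece (phi0 : R -> C) (k : nat) (x : R) : C :=
  if k is k'.+1 then phi0 (2 ^- k * x) - phi0 (2 ^- k' * x) else phi0 x.

Definition dyadic_prod (phi0 : R -> C) (k : {ffun 'I_d -> nat}) (x : Rd) : C :=
  \prod_i dyadic_piece phi0 (k i) (x 0 i).

Definition dyadic_block (phi0 : R -> C) (k : {ffun 'I_d -> nat})
    (f : functional) : functional :=
  distr_inv_fourier (distr_mul (dyadic_prod phi0 k) (distr_fourier f)).

Definition TL_sequence_norm (p q r : R)
    (h : {ffun 'I_d -> nat} -> Rd -> C) : \bar R :=
  Lnorm mu p%:E (fun t =>
    (\esum_(k in [set: {ffun 'I_d -> nat}])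
       (2 `^ (r * (\sum_i k i)%:R * q) * Normc.normc (h k (rV_of_tuple t)) `^ q)%:E)
    `^ q^-1)%E.

(* By the Paley-Wiener-Schwartz theorem the blocks of a tempered distribution
   are (smooth) functions, and a continuous function representing a distribution
   is unique.  So for tempered f the infimum ranges over exactly one family h:
   the functions F^-1(phi_k F f). *)
Definition TL_norm (phi0 : R -> C) (p q r : R) (f : functional) : \bar R :=
  ereal_inf [set TL_sequence_norm p q r h | h in
    [set h | forall k, represents (h k) (dyadic_block phi0 k f)]].

Definition TL_space (phi0 : R -> C) (p q r : R) : set functional :=
  [set f | tempered f /\ (TL_norm phi0 p q r f < +oo)%E].

Definition cube : set Rd := [set x | forall i, 0 <= x 0 i < 1].

Definition open_cube : set Rd := [set x | forall i, 0 < x 0 i < 1].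

Definition cube_test (f : Rd -> C) : Prop :=
  smooth f /\ exists K : set Rd,
    [/\ compact K, K `<=` open_cube & forall x, ~ K x -> f x = 0].

(* The infimum is +oo when u is not the restriction of an element of TL_space,
   in particular when u is not a distribution on the cube. *)
Definition TL_cube_norm (phi0 : R -> C) (p q r : R) (u : functional) : \bar R :=
  ereal_inf [set TL_norm phi0 p q r g | g in
    [set g | TL_space phi0 p q r g /\ forall f, cube_test f -> g f = u f]].

Definition cube_distr (D : Rd -> R) : functional :=
  fun f => cintegral cube (fun x => (D x)%:C * f x).

Definition box0 (x : Rd) : set Rd := [set z | forall i, 0 <= z 0 i < x 0 i].

Definition discrepancy (N : nat) (P : 'I_N -> Rd) (x : Rd) : R :=
  N%:R^-1 * (\sum_(j < N) \1_(box0 x) (P j)) - \prod_i x 0 i.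

End euclidean.

(* The Schwartz condition identifies R with 'rV[R]_1. *)
Definition lp_cutoff (R : realType) (phi0 : R -> R[i]) : Prop :=
  [/\ schwartz (fun x : 'rV[R]_1 => phi0 (x 0 0)),
      forall x, `|x| <= 1 -> phi0 x = 1
    & forall x, 3 / 2 < `|x| -> phi0 x = 0].

Section digital_nets.
Context {b d s n : nat}.

Definition digits (nu : nat) : 'cV['F_b]_n :=
  \col_(j < n) ((nu %/ b ^ j) %% b)%N%:R.

(* For b prime, the elements of 'F_b are the integers 0, ..., b - 1. *)
Definition digital_net {R : realType} (C : 'I_d -> 'M['F_b]_(s, n))
    (nu : 'I_(b ^ n)) : 'rV[R]_d :=
  \row_i \sum_(k < s) (nat_of_ord ((C i *m digits nu) k 0))%:R * b%:R ^- k.+1.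

(* [lam i] is the sequence lambda_{i,1} > ... > lambda_{i,eta_i}, with
   eta_i = size (lam i); row indices of C i are counted from 0, hence [j.+1]. *)
Definition order_digital_net (sigma v : nat) (C : 'I_d -> 'M['F_b]_(s, n)) :
    Prop :=
  [/\ (0 < sigma)%N, (sigma * n <= s)%N, (v <= sigma * n)%N &
    forall lam : 'I_d -> seq 'I_s,
      (forall i, sorted (fun j k : 'I_s => (k < j)%N) (lam i)) ->
      (\sum_(i < d) \sum_(j <- take sigma (lam i)) (j : nat).+1
         <= sigma * n - v)%N ->
      free [seq row j (C i) | i <- enum 'I_d, j <- lam i]].

End digital_nets.

(* Main.v *)
Require Import Defs.
From HB Require Import structures.
From mathcomp Require Import all_boot all_order all_algebra.
From mathcomp Require Import all_classical all_reals all_analysis.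
From mathcomp Require Import measurable_realfun complex zify ring lra.

Set Implicit Arguments.
Unset Strict Implicit.
Unset Printing Implicit Defensive.

Import Order.TTheory GRing.Theory Num.Theory.
Import numFieldNormedType.Exports.

Local Open Scope classical_set_scope.
Local Open Scope complex_scope.
Local Open Scope ring_scope.

(** The extension by zero of the discrepancy function D to R^d has the required
    norm, so no extension has to be constructed.  Its block h_k is the error of
    the net in integrating z |-> prod_i jump (k_i) (x_i) (z_i).  In terms of an
    antiderivative Th of a multiple ker0 of F^-1 phi0 each factor is the sum of a profile at
    scale 2^-k_i around z_i and of a term around x_i = 1 that does not involve z.
    Expand a function of the digits of the net points into martingale differences
    refined by their second leading digit.  The net integrates exactly the blocks
    whose leading digits (lam_i, mu_i) satisfy sum_i (lam_i + mu_i) <= 2 n - v,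
    and the first and second differences of Th make the other blocks decay
    geometrically.  This settles the terms for which the scales add up to at most
    n digits; in the remaining ones the supremum times the L_1 norm is enough.
    With N = b^n, P = max(p, q), Y = 2^(sum k) / N and
    omega x = prod_i 1 / (1 + x_i^2) the result is, for some del > 0,
      int omega (|h_k| / omega)^P <= C 2^(-r P sum k) N^((r-1) P) min(Y, 1/Y)^(del P).
    Up to a geometric factor only n^(d-1) indices k have Y close to 1, so Jensen's
    inequality for the sum over k, combined with t^p <= T^p + T^(p-P) t^P at
    T = N^(r-1) n^((d-1)/q) and the finiteness of int omega, gives the estimate. *)

(** * Averages over digit vectors *)

(** Order 2 is what produces the factor min(Y, 1/Y)^del below n digits. A block gains a factor 1/b
    for each unit by which lam_i or mu_i exceeds the digits resolved by the scale, and the blocks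
    that the net misses have sum (lam_i + mu_i) > 2 n - v; so with S resolved digits in total the
    error is roughly b^-S b^(-2 (n - S)). Any exponent above 1 in place of 2 leaves a positive power
    of Y. At r = 0 leading digits alone would give only b^-n at every scale, and all n^d of them
    would count. The proof keeps 3/2: with x = b^(-1/4), three of the four powers of x gained per
    digit pay for the threshold, and the fourth makes the sum over the blocks converge. The
    condition r < 1/P reflects the jumps: at x_i = 1, where the extension by zero breaks off, and at
    the net points, the block has layers of width 2^-k_i, with L_P norm 2^(-k_i / P). The estimates
    are pointwise in x, with majorants localized near the net points instead of suprema, because the
    mean of such a majorant over the net has the right size b^-S. *)

Section average.
Context {K : numFieldType}.
Implicit Types T : finType.

Definition avg T (F : T -> K) : K := #|T|%:R^-1 * \sum_x F x.

Lemma avg_cst T (c : K) : (0 < #|T|)%N -> avg (fun _ : T => c) = c.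
Proof.
by move=> T0; rewrite /avg sumr_const -[c *+ _]mulr_natl mulrA mulVf ?mul1r// pnatr_eq0 -lt0n.
Qed.

Lemma eq_avg T (F G : T -> K) : F =1 G -> avg F = avg G.
Proof. by move=> FG; rewrite /avg (eq_bigr _ (fun x _ => FG x)). Qed.

Lemma avgD T (F G : T -> K) : avg (fun x => F x + G x) = avg F + avg G.
Proof. by rewrite /avg big_split mulrDr. Qed.

Lemma avgB T (F G : T -> K) : avg (fun x => F x - G x) = avg F - avg G.
Proof. by rewrite /avg sumrB mulrBr. Qed.

Lemma avgZ T (c : K) (F : T -> K) : avg (fun x => c * F x) = c * avg F.
Proof. by rewrite /avg -mulr_sumr mulrCA. Qed.

Lemma avg_sum T (I : Type) (r : seq I) (P : pred I) (F : I -> T -> K) :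
  avg (fun x => \sum_(i <- r | P i) F i x) = \sum_(i <- r | P i) avg (F i).
Proof. by rewrite /avg exchange_big /= mulr_sumr. Qed.

Lemma avg_swap T1 T2 (F : T1 -> T2 -> K) :
  avg (fun x => avg (fun y => F x y)) = avg (fun y => avg (fun x => F x y)).
Proof.
by rewrite /avg -!mulr_sumr exchange_big /= mulrCA.
Qed.

Lemma avg_reindex T1 T2 (h : T1 -> T2) (F : T2 -> K) :
  bijective h -> avg F = avg (fun x => F (h x)).
Proof.
by move=> hb; rewrite /avg (bij_eq_card hb) (reindex h)//; exact: onW_bij.
Qed.

Lemma avg_ge0 T (F : T -> K) : (forall x, 0 <= F x) -> 0 <= avg F.
Proof. by move=> F0; rewrite mulr_ge0 ?invr_ge0 ?ler0n// sumr_ge0. Qed.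

Lemma ler_avg T (F G : T -> K) : (forall x, F x <= G x) -> avg F <= avg G.
Proof. by move=> FG; rewrite ler_wpM2l ?invr_ge0 ?ler0n// ler_sum. Qed.

Lemma norm_avg T (F : T -> K) : `|avg F| <= avg (fun x => `|F x|).
Proof. by rewrite normrM normfV normr_nat ler_wpM2l ?invr_ge0 ?ler0n// ler_norm_sum. Qed.

Lemma avg_ffun_prod (d : nat) T (F : 'I_d -> T -> K) :
  avg (fun a : {ffun 'I_d -> T} => \prod_i F i (a i)) = \prod_i avg (F i).
Proof.
rewrite /avg -bigA_distr_bigA /= big_split /= prodr_const card_ffun.
by rewrite card_ord natrX exprVn.
Qed.

End average.

(** * Exact integration by order 2 nets *)

Section free_rows.
Variables (F : fieldType) (n : nat).

(** The combination of the coordinate functionals of X with coefficients c takes the prescribed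
    values, and w is its coefficient vector. For rows of the generating matrices this prescribes
    digits of a net point. *)
Lemma free_dual (X : seq 'rV[F]_n) (c : nat -> F) : free X ->
  exists w : 'cV[F]_n, forall k, (k < size X)%N -> (X`_k *m w) 0 0 = c k.
Proof.
move=> fX; pose l (v : 'rV[F]_n) := \sum_(k < size X) c k * coord (in_tuple X) k v.
exists (\col_j l (delta_mx 0 j)) => k kX.
rewrite mxE; under eq_bigr do rewrite mxE.
transitivity (l X`_k).
  rewrite /l [in RHS](row_sum_delta X`_k).
  under [RHS]eq_bigr do rewrite linear_sum mulr_sumr.
  rewrite exchange_big /=; apply: eq_bigr => j _.
  by rewrite mulr_sumr; apply: eq_bigr => i _; rewrite linearZ /= mulrCA.
have fT : free (in_tuple X) by [].
rewrite /l (bigD1 (Ordinal kX)) //= (coord_free (Ordinal kX) (Ordinal kX) fT) eqxx mulr1.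
rewrite big1 ?addr0// => i ik.
by rewrite (coord_free (Ordinal kX) i fT) eq_sym (negbTE ik) mulr0.
Qed.

End free_rows.

Section net.
Context {K : numFieldType}.
Variables (b d s n v : nat) (A : 'I_d -> 'M['F_b]_(s, n)).
Local Notation Y := 'cV['F_b]_s.
Implicit Types (F G V : Y -> K) (y a : Y) (S T J : pred nat).

(** [A i *m w] is the digit vector of the i-th coordinate of the net point whose index has digits w,
    so this is the mean of a product function over the net. *)
Definition netavg (F : 'I_d -> Y -> K) : K :=
  avg (fun w : 'cV['F_b]_n => \prod_i F i (A i *m w)).

Definition depends_on J F := forall y y',
  (forall j : 'I_s, J j -> y j 0 = y' j 0) -> F y = F y'.

Lemma card_cV_gt0 m : (0 < #|{: 'cV['F_b]_m}|)%N.
Proof. by apply/card_gt0P; exists 0. Qed.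

(** Translating w by W a adds the digits of a at the positions J in all coordinates at once and
    leaves the average over w unchanged; averaging over a as well makes the coordinates
    independent. *)
Lemma netavg_prod (J : 'I_d -> pred nat) (F : 'I_d -> Y -> K) :
  (forall a : {ffun 'I_d -> Y}, exists w : 'cV['F_b]_n,
     forall i (j : 'I_s), J i j -> (A i *m w) j 0 = a i j 0) ->
  (forall i, depends_on (J i) (F i)) ->
  netavg F = \prod_i avg (F i).
Proof.
move=> /choice[W WE] JF.
transitivity (avg (fun w => avg (fun a : {ffun 'I_d -> Y} =>
    \prod_i F i (A i *m w + a i)))).
  rewrite avg_swap; transitivity (avg (fun _ : {ffun 'I_d -> Y} => netavg F)).
    rewrite avg_cst// card_ffun expn_gt0; apply/orP; left; exact: card_cV_gt0.
  apply: eq_avg => a; rewrite /netavg (avg_reindex (h := fun w => w + W a)).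
    apply: eq_avg => w; apply: eq_bigr => i _; apply: JF => j Jij.
    by rewrite mulmxDr !mxE -(WE a i j Jij) mxE.
  by exists (fun w => w - W a) => w; rewrite ?addrK ?subrK.
transitivity (avg (fun w : 'cV['F_b]_n => \prod_i avg (F i))); last first.
  by rewrite avg_cst// card_cV_gt0.
apply: eq_avg => w; rewrite (avg_ffun_prod (fun i y => F i (A i *m w + y))).
apply: eq_bigr => i _; rewrite [RHS](avg_reindex (h := fun y => A i *m w + y))//.
Qed.

(** With digits numbered from 1: the positions 1, ..., mu and lam, on which a block with leading
    digits (lam, mu) depends. *)
Definition blockd (lam mu : nat) : pred nat := fun j => (j < mu)%N || (j.+1 == lam).

(** Only the position lam can lie above mu. The order 2 condition charges for the two largest row
    indices alone, so all lower digits of the block come free of charge. *)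
Lemma take2_blockd lam mu (l : seq 'I_s) : (mu <= lam)%N ->
  sorted (fun j k : 'I_s => (k < j)%N) l -> all (fun j : 'I_s => blockd lam mu j) l ->
  (\sum_(j <- take 2 l) (j : nat).+1 <= lam + mu)%N.
Proof.
rewrite /blockd => ml; case: l => [|j [|k l]] /=; rewrite ?big_nil// ?big_cons ?big_nil.
  by move=> _ /andP[+ _] => /orP[|/eqP]; lia.
move=> /andP[kj _] /and3P[/orP[h1|/eqP h1] /orP[h2|/eqP h2] _]; rewrite take0 big_nil; lia.
Qed.

Hypothesis netA : order_digital_net 2 v A.

(** All rows at block positions, listed by decreasing index as the definition of the net asks, form
    a free family, so [free_dual] applies to them. *)
Lemma net_solvable (lam mu : 'I_d -> nat) : (forall i, (mu i <= lam i)%N) ->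
  (\sum_i (lam i + mu i) <= 2 * n - v)%N ->
  forall a : {ffun 'I_d -> Y}, exists w : 'cV['F_b]_n,
     forall i (j : 'I_s), blockd (lam i) (mu i) j -> (A i *m w) j 0 = a i j 0.
Proof.
case: netA => _ _ _ netA' mulam sumle a.
pose lm i := [seq j <- rev (enum 'I_s) | blockd (lam i) (mu i) (nat_of_ord j)].
have slm i : sorted (fun j k : 'I_s => (k < j)%N) (lm i).
  apply: sorted_filter; first by move=> x y z /= h1 h2; exact: ltn_trans h2 h1.
  rewrite rev_sorted.
  rewrite -(@sorted_map _ _ (fun i : 'I_s => i : nat) ltn) val_enum_ord.
  exact: iota_ltn_sorted.
have /netA' : (\sum_(i < d) \sum_(j <- take 2 (lm i)) (j : nat).+1 <= 2 * n - v)%N.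
  apply: leq_trans sumle; apply: leq_sum => i _; apply: take2_blockd => //.
  exact: filter_all.
move=> /(_ slm) fr.
pose P := [seq (i, j) | i <- enum 'I_d, j <- lm i].
have XE : [seq row j (A i) | i <- enum 'I_d, j <- lm i] = [seq row ij.2 (A ij.1) | ij <- P].
  by rewrite /P map_allpairs.
move: fr; rewrite XE => fr.
have memP i (j : 'I_s) : blockd (lam i) (mu i) j -> (i, j) \in P.
  move=> Jij; apply/allpairsPdep; exists i, j.
  by rewrite mem_enum mem_filter Jij mem_rev mem_enum.
clearbody P; case: P XE memP fr => [|p0 P] XE memP fr.
  by exists 0 => i j /memP.
have [w Hw] := free_dual (fun k => let ij := nth p0 (p0 :: P) k in a ij.1 ij.2 0) fr.
exists w => i j /memP ijP.
have := Hw (index (i, j) (p0 :: P)); rewrite size_map index_mem => /(_ ijP).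
rewrite (nth_map p0) ?index_mem// nth_index//= => <-.
by rewrite -row_mul [RHS]mxE.
Qed.

Lemma netavg_block (lam mu : 'I_d -> nat) (F : 'I_d -> Y -> K) :
  (forall i, (mu i <= lam i)%N) -> (\sum_i (lam i + mu i) <= 2 * n - v)%N ->
  (forall i, depends_on (blockd (lam i) (mu i)) (F i)) ->
  netavg F = \prod_i avg (F i).
Proof. by move=> ml sle; apply: netavg_prod; exact: net_solvable. Qed.

End net.

(** * Martingale blocks of functions of digits *)

Section digit_averages.
Context {K : numFieldType}.
Variables (b s : nat).
Local Notation Y := 'cV['F_b]_s.
Implicit Types (F G V : Y -> K) (y a : Y) (S T J : pred nat).

Definition mix S a y : Y := \col_(j < s) if S j then a j 0 else y j 0.

(* Conditional expectation of [F] given the digits outside [S]; [lvl m F] below is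
   the one given the first m digits. *)
Definition amix S F y : K := avg (fun a => F (mix S a y)).

Lemma amix_depends S F J : (forall j, ~~ S j -> J j) ->
  depends_on J (amix S F).
Proof.
move=> SJ y y' yy'; apply: eq_avg => a; congr F; apply/colP => j; rewrite !mxE.
by case: ifPn => // /SJ/yy'.
Qed.

Lemma depends_amix J S F : depends_on J F -> depends_on J (amix S F).
Proof.
move=> JF y y' yy'; apply: eq_avg => a; apply: JF => j /yy' yj.
by rewrite !mxE yj.
Qed.

Lemma eq_amix S T F y : (forall j : 'I_s, S j = T j) -> amix S F y = amix T F y.
Proof.
move=> ST; apply: eq_avg => a; congr F; apply/colP => j; by rewrite !mxE ST.
Qed.

Lemma amix_id S J F y : (forall j : 'I_s, J j -> ~~ S j) -> depends_on J F ->
  amix S F y = F y.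
Proof.
move=> SJ JF; rewrite -[RHS](@avg_cst _ Y); last exact: card_cV_gt0.
by apply: eq_avg => a; apply: JF => j /SJ/negbTE Sj; rewrite mxE Sj.
Qed.

(** Exchanging the digits outside S between two independent digit vectors is an involution of pairs,
    and [F (mix S a y)] is F at the first component of the result. *)
Lemma avg_amix S F : avg (amix S F) = avg F.
Proof.
have cY : (0 < #|Y|)%N by exact: card_cV_gt0.
have pairE (G : Y -> Y -> K) :
    avg (fun y => avg (fun a => G a y)) = avg (fun u : Y * Y => G u.1 u.2).
  rewrite avg_swap /avg -mulr_sumr mulrA card_prod natrM invfM; congr (_ * _).
  by rewrite pair_bigA.
rewrite (pairE (fun a y => F (mix S a y))).
pose h (u : Y * Y) := (mix S u.1 u.2, mix S u.2 u.1).
have hK : involutive h.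
  move=> [a y]; rewrite /h /=; congr (_, _); apply/colP => j; rewrite !mxE.
    by case: (S j).
  by case: (S j).
rewrite -[RHS](@avg_cst _ Y)// (pairE (fun a y => F a)) [RHS](avg_reindex (h := h))//.
exact: inv_bij.
Qed.

Lemma avg_digit (j : 'I_s) (g : 'F_b -> K) : avg (fun a : Y => g (a j 0)) = avg g.
Proof.
have c0 : (0 < #|{: 'F_b}|)%N by apply/card_gt0P; exists 0.
rewrite -[LHS](@avg_cst _ 'F_b)//.
transitivity (avg (fun c : 'F_b => avg (fun a : Y => g (c + a j 0)))).
  apply: eq_avg => c.
  rewrite (avg_reindex (h := fun a : Y => c *: delta_mx j 0 + a)).
    by apply: eq_avg => a; rewrite !mxE !eqxx mulr1.
  by exists (fun a => - (c *: delta_mx j 0) + a) => a; rewrite ?addKr ?addNKr.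
rewrite avg_swap -[RHS](@avg_cst _ Y); last exact: card_cV_gt0.
apply: eq_avg => a; rewrite [RHS](avg_reindex (h := fun c => c + a j 0))//.
by exists (fun c => c - a j 0) => c; rewrite ?addrK ?subrK.
Qed.

(** A value of the nonnegative V is one of the b terms of its average over the digit k, hence at
    most b times that average. *)
Lemma amix_step (b_prime : prime b) S T (k : 'I_s) V y : (forall y, 0 <= V y) ->
  (forall j, T j = S j || (j == k)) -> amix S V y <= b%:R * amix T V y.
Proof.
move=> V0 TS; have b1 : 1 <= b%:R :> K by rewrite ler1n prime_gt0.
have A0 S' : 0 <= amix S' V y by exact: avg_ge0.
have [Sk|Sk] := boolP (S k).
  rewrite (@eq_amix T S) ?ler_peMl// => j; rewrite TS; case: eqP => [->|]; rewrite ?orbF//.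
  by rewrite Sk.
pose G a := V (mix T a y).
have -> : amix T V y = avg (amix (pred1 (k : nat)) G) by rewrite avg_amix.
rewrite -avgZ; apply: ler_avg => a.
rewrite /amix (_ : avg _ = avg (fun c : 'F_b => G (\col_j if j == k then c else a j 0))).
  rewrite /avg card_Fp// mulrA divff ?pnatr_eq0 ?gtn_eqF ?prime_gt0// mul1r.
  rewrite (bigD1 (y k 0))//=; apply: ler_wpDr; first by apply: sumr_ge0 => i _; exact: V0.
  rewrite le_eqVlt; apply/orP; left; apply/eqP; congr V.
  apply/colP => j; rewrite !mxE TS; case: (eqVneq j k) => [->|jk].
    by rewrite (negbTE Sk) eqxx.
  by rewrite (_ : (nat_of_ord j == k) = false) ?orbF//; apply/negbTE.
rewrite -[RHS](avg_digit k); apply: eq_avg => a'; congr G; apply/colP => j.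
by rewrite !mxE /=; case: (eqVneq j k) => [->|jk]; rewrite ?eqxx// (negbTE (_ : (j != k :> nat))).
Qed.

Definition lvl m F := amix (fun j => m <= j)%N F.

(** Each of the k - m digits averaged out costs a factor b. This lowers V to a level that the net
    integrates exactly. *)
Lemma lvl_le (b_prime : prime b) m k V y : (m <= k)%N -> (forall y, 0 <= V y) ->
  depends_on (fun j => j < k)%N V -> V y <= b%:R ^+ (k - m) * lvl m V y.
Proof.
move=> mk V0 JV; rewrite -[leLHS](@amix_id (fun j => k <= j)%N _ V y _ JV); last first.
  by move=> j jk; rewrite -ltnNge.
rewrite -/(lvl k V y).
elim: k mk {JV} => [|k IH]; first by rewrite leqn0 => /eqP ->; rewrite subn0 expr0 mul1r.
rewrite leq_eqVlt => /predU1P[->|mk]; first by rewrite subnn expr0 mul1r.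
rewrite subSn// exprS -mulrA; apply: (@le_trans _ _ (b%:R * lvl k V y)); last first.
  by rewrite ler_wpM2l ?ler0n// IH.
have [ks|sk] := ltnP k s.
  by apply: (@amix_step b_prime _ _ (Ordinal ks)) => //= j; lia.
rewrite /lvl (@eq_amix _ (fun j => k <= j)%N).
  by rewrite ler_peMl ?avg_ge0// ler1n prime_gt0.
by move=> j; have := ltn_ord j; lia.
Qed.

Definition blockC (lam mu : nat) : pred nat := fun j => ~~ blockd lam mu j.

(** What the digit lam adds to the knowledge of the first mu digits; at mu = lam - 1 it is the
    martingale difference between the levels lam - 1 and lam. *)
Definition topdiff F lam mu y := amix (blockC lam mu) F y - lvl mu F y.

(* The martingale difference [lvl lam F - lvl lam.-1 F] is telescoped over the
   second leading digit [mu]; digits are counted from 1, and 0 stands for none. *)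
Definition block F (lam mu : nat) y : K :=
  if lam is lam'.+1 then
    if (mu <= lam')%N then
      topdiff F lam mu y - (if mu is mu'.+1 then topdiff F lam mu' y else 0)
    else 0
  else if mu == 0%N then lvl 0 F y else 0.

(** Two telescoping sums: over mu the blocks add up to [topdiff F lam.+1 lam], a difference of
    consecutive levels, and over lam these add up to level s, which is F itself. *)
Lemma block_sum F y : F y = \sum_(lam < s.+1) \sum_(mu < s.+1) block F lam mu y.
Proof.
have inner lam : (lam < s)%N ->
    \sum_(mu < s.+1) block F lam.+1 mu y = lvl lam.+1 F y - lvl lam F y.
  move=> ls; rewrite (bigID (fun mu : 'I_s.+1 => mu <= lam)%N)/= [X in _ + X]big1 ?addr0; last first.
    by move=> i /negbTE ->.
  rewrite -(big_mkord (fun mu => mu <= lam)%N (block F lam.+1 ^~ y)).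
  rewrite (big_cat_nat (leq0n lam.+1) (ltnW ls : (lam.+1 <= s.+1)%N))/=.
  rewrite [X in _ + X]big_nat_cond [X in _ + X]big1 ?addr0; last by move=> i; lia.
  rewrite big_nat_cond.
  have H m : (m <= lam)%N -> \sum_(0 <= i < m.+1 | (0 <= i < m.+1)%N && (i <= lam)%N)
      block F lam.+1 i y = topdiff F lam.+1 m y.
    elim: m => [|m IHm] ml; rewrite -big_nat_cond.
      by rewrite big_mkcond/= big_nat1 /= subr0.
    rewrite big_mkcond big_nat_recr//= -big_mkcond big_nat_cond IHm; last lia.
    by rewrite ml addrC subrK.
  rewrite H// /topdiff; congr (_ - _); apply: eq_amix => j; rewrite /blockC /blockd eqSS.
  by case: ltngtP.
rewrite big_ord_recl [X in X + _](_ : _ = lvl 0 F y); last first.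
  by rewrite big_ord_recl /= big1 ?addr0.
rewrite (eq_bigr (fun i : 'I_s => lvl i.+1 F y - lvl i F y)); last first.
  by move=> i _; exact: inner.
rewrite -(big_mkord xpredT (fun i => lvl i.+1 F y - lvl i F y)) telescope_sumr//.
rewrite addrC subrK; apply/esym; apply: (@amix_id _ predT).
  by move=> j _; rewrite -ltnNge.
by move=> z z' zz'; congr F; apply/colP => j; exact: zz'.
Qed.

Lemma block_depends F lam mu : depends_on (blockd lam mu) (block F lam mu).
Proof.
have dep S : (forall j, ~~ S j -> blockd lam mu j) -> depends_on (blockd lam mu) (amix S F).
  exact: amix_depends.
case: lam dep => [|lam] dep y y' yy' /=.
  by case: eqP => // _; apply: dep yy' => j; rewrite leq0n.
case: ifP => // mulam.
rewrite /topdiff /lvl.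
rewrite (dep (blockC lam.+1 mu) _ _ _ yy'); last by move=> j; rewrite negbK.
rewrite (dep (fun j => mu <= j)%N _ _ _ yy'); last by move=> j; rewrite -ltnNge /blockd => ->.
case: mu mulam dep yy' => // mu mulam dep yy'.
rewrite (dep (blockC lam.+1 mu) _ _ _ yy'); last first.
  by move=> j; rewrite negbK /blockd; case/orP => [|->]; rewrite ?orbT//; lia.
by rewrite (dep (fun j => mu <= j)%N _ _ _ yy')// => j; rewrite /blockd; lia.
Qed.

(** Such a block is zero or a combination of differences of conditional expectations, all of which
    have the mean of F. *)
Lemma avg_block F lam mu : (0 < lam + mu)%N -> avg (block F lam mu) = 0.
Proof.
have a0 : avg (fun _ : Y => 0) = 0 :> K by rewrite avg_cst// card_cV_gt0.
have t0 l m : avg (topdiff F l m) = 0 by rewrite avgB !avg_amix subrr.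
case: lam => [|lam] mu0; first by case: mu mu0.
have [ml|ml] := leqP mu lam; last first.
  by rewrite -[RHS]a0; apply: eq_avg => y; rewrite /block leqNgt ml.
transitivity (avg (fun y => topdiff F lam.+1 mu y -
    (if mu is mu'.+1 then topdiff F lam.+1 mu' y else 0))).
  by apply: eq_avg => y; rewrite /block ml.
by rewrite avgB t0; case: (mu) => [|m]; rewrite ?a0 ?t0 subrr.
Qed.

End digit_averages.

Lemma blockC_neq lam mu j : j.+1 != lam -> blockC lam mu j = (mu <= j)%N.
Proof. by rewrite /blockC /blockd => /negbTE ->; rewrite orbF -leqNgt. Qed.

Lemma ltn_neq mu j : j.+1 != mu.+1 -> (mu < j)%N = (mu <= j)%N.
Proof. lia. Qed.

Lemma blockC_neqS lam mu j : j.+1 != mu.+1 -> blockC lam mu.+1 j = blockC lam mu j.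
Proof. by rewrite /blockC /blockd; lia. Qed.

Lemma leq_blockC lam mu j : (mu <= lam)%N ->
  (mu <= j)%N = blockC lam.+1 mu j || (j == lam).
Proof. by rewrite /blockC /blockd; lia. Qed.

Lemma leq_blockCS lam mu j : (mu < lam)%N ->
  (mu <= j)%N = [|| blockC lam.+1 mu.+1 j, j == lam | j == mu].
Proof. by rewrite /blockC /blockd; lia. Qed.

Lemma leq_ltn_or mu j : (mu <= j)%N = (mu < j)%N || (j == mu).
Proof. lia. Qed.

(** * Decay of the blocks in their leading digits *)

Section block_bound.
Context {K : numFieldType}.
Variables (b s : nat).
Hypothesis b_prime : prime b.
Local Notation Y := 'cV['F_b]_s.
Implicit Types (y a : Y) (S T J : pred nat).
Variables (x L : K) (kap : nat).
Hypotheses (x0 : 0 < x) (x1 : x < 1) (L1 : 1 <= L).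

Definition differ_at (j : 'I_s) (y y' : Y) := forall i, i != j -> y i 0 = y' i 0.

(* Used with [x = b^(-1/4)] and [kap] the number of digits resolved by the scale
   of [F], which makes [x ^+ 4] the Lipschitz gain of one further digit. *)
Definition dominates (V F : Y -> K) := [/\ forall y, `|F y| <= V y,
  forall (j : 'I_s) y y', (kap <= j)%N -> differ_at j y y' ->
    `|F y - F y'| <= L * x ^+ (4 * (j.+1 - kap)) * V y &
  forall (j k : 'I_s) y00 y10 y01 y11, (kap <= j)%N -> (kap <= k)%N ->
    (k < j)%N -> differ_at j y00 y10 -> differ_at k y00 y01 ->
    differ_at k y10 y11 -> differ_at j y01 y11 ->
    `|(F y00 - F y10) - (F y01 - F y11)|
      <= L * x ^+ (4 * (j.+1 - kap)) * x ^+ (4 * (k.+1 - kap)) * V y00].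

Variables (F V : Y -> K).
Hypothesis FV : dominates V F.

Let V0 y : 0 <= V y.
Proof. by case: FV => + _ _ => /(_ y); apply: le_trans. Qed.

Let w m := x ^+ (4 * (m - kap)).

Let w0 m : 0 <= w m.
Proof. by rewrite exprn_ge0// ltW. Qed.

Let L0 : 0 <= L. Proof. exact: le_trans L1. Qed.

Let b1 : 1 <= b%:R :> K. Proof. by rewrite ler1n prime_gt0. Qed.

Let Lw m : (m <= kap)%N -> L * w m = L.
Proof. by rewrite -subn_eq0 /w => /eqP ->; rewrite muln0 expr0 mulr1. Qed.

(** The two mixtures differ at most in the digit lam. Beyond the resolved digits the Lipschitz gain
    applies; up to kap the weight is 1 and the triangle inequality is enough. *)
Let diff1 S T lam a y : (0 < lam <= s)%N ->
  (forall j, j.+1 != lam -> S j = T j) ->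
  `|F (mix S a y) - F (mix T a y)| <= L * w lam * (V (mix S a y) + V (mix T a y)).
Proof.
case: FV => F0 F1 _ /andP[lam0 lams] ST.
have [lk|kl] := leqP lam kap.
  rewrite Lw//; apply: le_trans (ler_normB _ _) _.
  by apply: le_trans (lerD (F0 _) (F0 _)) _; rewrite ler_peMl ?addr_ge0.
rewrite mulrDr; apply: ler_wpDr; first by rewrite !mulr_ge0.
have lams' : (lam.-1 < s)%N by rewrite prednK.
have := F1 (Ordinal lams') (mix S a y) (mix T a y); rewrite /= prednK//; apply; first by lia.
by move=> i /= ij; rewrite !mxE ST//; apply: contraNneq ij => il; apply/eqP/val_inj; rewrite /= -il.
Qed.

(** The four mixtures are the corners of a parallelogram in the digits lam and mu. If mu is resolved
    its weight is 1, and [diff1] in the digit lam is used twice. *)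
Let diff2 S1 S2 S3 S4 lam mu a y : (0 < mu)%N -> (mu < lam <= s)%N ->
  (forall j, j.+1 != lam -> S1 j = S2 j) -> (forall j, j.+1 != lam -> S3 j = S4 j) ->
  (forall j, j.+1 != mu -> S1 j = S3 j) -> (forall j, j.+1 != mu -> S2 j = S4 j) ->
  `|(F (mix S1 a y) - F (mix S2 a y)) - (F (mix S3 a y) - F (mix S4 a y))|
   <= L * w lam * w mu * (V (mix S1 a y) + V (mix S2 a y) + (V (mix S3 a y) + V (mix S4 a y))).
Proof.
move=> mu0 /andP[mulam lams] S12 S34 S13 S24.
have [mk|km] := leqP mu kap.
  have wmu : w mu = 1 by rewrite /w (eqP (_ : mu - kap == 0)%N) ?muln0 ?subn_eq0.
  rewrite wmu mulr1; apply: le_trans (ler_normB _ _) _.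
  by rewrite mulrDr lerD// diff1//; lia.
have lams' : (lam.-1 < s)%N by rewrite prednK// (ltn_trans mu0 mulam).
have mus' : (mu.-1 < s)%N by rewrite prednK// (leq_trans (ltnW mulam) lams).
case: FV => _ _ /(_ (Ordinal lams') (Ordinal mus') (mix S1 a y) (mix S2 a y) (mix S3 a y) (mix S4 a y)).
have dif (k : nat) (ks : (k.-1 < s)%N) S T : (0 < k)%N -> (forall j, j.+1 != k -> S j = T j) ->
    differ_at (Ordinal ks) (mix S a y) (mix T a y).
  move=> k0 ST i ij; rewrite !mxE ST//; apply: contraNneq ij => ik.
  by apply/eqP/val_inj; rewrite /= -ik.
have lam0 : (0 < lam)%N := ltn_trans mu0 mulam.
have kmu : (kap <= mu.-1)%N by rewrite -ltnS prednK.
have mulam' : (mu.-1 < lam.-1)%N by rewrite prednK// -ltnS !prednK.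
move=> /(_ (ltnW (leq_ltn_trans kmu mulam')) kmu mulam').
rewrite /= !prednK// => H; apply: le_trans (H _ _ _ _) _; do ?exact: dif.
by rewrite -!addrA mulrDr; apply: ler_wpDr => //; rewrite !mulr_ge0// !addr_ge0.
Qed.

Let lvl_ge0 m y : 0 <= lvl m V y. Proof. exact: avg_ge0. Qed.

Let amix_lvl1 S m (k : nat) y : (k < s)%N -> (forall j, (m <= j)%N = S j || (j == k)) ->
  amix S V y <= b%:R * lvl m V y.
Proof. by move=> ks ST; apply: (@amix_step _ _ _ _ _ _ (Ordinal ks)). Qed.

Let amix_ge0 S y : 0 <= amix S V y. Proof. exact: avg_ge0. Qed.

Let amix_lvl2 S m (k k' : nat) y : (k < s)%N -> (k' < s)%N ->
  (forall j, (m <= j)%N = [|| S j, j == k | j == k']) ->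
  amix S V y <= b%:R ^+ 2 * lvl m V y.
Proof.
move=> ks ks' ST; rewrite expr2 -mulrA.
apply: le_trans (@amix_step _ _ _ b_prime _ (fun j => S j || (j == k)) (Ordinal ks) _ _ V0 _) _ => //.
rewrite ler_wpM2l ?ler0n//; apply: (@amix_lvl1 _ _ k') => // j.
by rewrite ST orbA.
Qed.

(** A block is the mean of a second difference of F over four mixtures, whence the 4. The majorants
    at the mixtures are compared with level mu - 1, the coarsest one that occurs; at most two digits
    are missing, each costing b. *)
Lemma block_bound lam mu y : (lam <= s)%N ->
  `|block F lam mu y| <= 4 * L * b%:R ^+ 2 * (w lam * w mu) * lvl mu.-1 V y.
Proof.
move=> lams.
have B1 : 1 <= b%:R ^+ 2 :> K by rewrite exprn_ege1.
have B0 : 0 <= b%:R ^+ 2 :> K by exact: le_trans B1.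
have rhs0 l m k : 0 <= 4 * L * b%:R ^+ 2 * (w l * w m) * lvl k V y.
  apply: mulr_ge0 => //; apply: mulr_ge0; last exact: mulr_ge0.
  by apply: mulr_ge0 => //; apply: mulr_ge0.
have bb : b%:R <= b%:R ^+ 2 :> K by rewrite ler_eXnr.
have lb m : lvl m V y <= b%:R ^+ 2 * lvl m V y by rewrite ler_peMl.
have lb1 m : b%:R * lvl m V y <= b%:R ^+ 2 * lvl m V y by rewrite ler_wpM2r.
case: lam lams => [|lam] lams /=.
  case: eqP => [->|_]; last by rewrite normr0.
  rewrite (_ : w 0 = 1); last by rewrite /w sub0n muln0.
  rewrite !mulr1; apply: le_trans (norm_avg _) _.
  apply: (@le_trans _ _ (lvl 0 V y)).
    by apply: ler_avg => a; case: FV => ->.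
  rewrite ler_peMl//=; apply: mulr_ege1 => //; apply: mulr_ege1 => //.
  by rewrite ler1n.
case: ifP => [mulam|]; last by rewrite normr0.
case: mu mulam => [|mu] mulam.
  rewrite subr0 (_ : w 0 = 1); last by rewrite /w sub0n muln0.
  rewrite mulr1 /topdiff /lvl /amix -avgB; apply: le_trans (norm_avg _) _.
  apply: (@le_trans _ _ (avg (fun a => L * w lam.+1 *
      (V (mix (blockC lam.+1 0) a y) + V (mix (leq 0) a y))))).
    by apply: ler_avg => a; apply: diff1.
  rewrite avgZ avgD -!/(amix _ _ _) -!/(lvl _ _ _).
  apply: (@le_trans _ _ (L * w lam.+1 * (4 * (b%:R ^+ 2 * lvl 0 V y)))); last first.
    by rewrite le_eqVlt; apply/orP; left; apply/eqP; ring.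
  apply: ler_wpM2l; first exact: mulr_ge0.
  have h1 : amix (blockC lam.+1 0) V y <= b%:R ^+ 2 * lvl 0 V y.
    apply: le_trans (lb1 _); apply: (@amix_lvl1 _ _ lam) => // j.
    by rewrite /blockC /blockd /= eqSS; case: eqP.
  apply: le_trans (lerD h1 (lb _)) _.
  rewrite [leLHS](_ : _ = 2 * (b%:R ^+ 2 * lvl 0 V y)); last by rewrite /lvl; ring.
  by apply: ler_wpM2r; [exact: mulr_ge0|rewrite ler_nat].
rewrite /topdiff /lvl /amix -!avgB; apply: le_trans (norm_avg _) _.
set S1 := blockC lam.+1 mu.+1; set S2 := leq mu.+1; set S3 := blockC lam.+1 mu; set S4 := leq mu.
apply: (@le_trans _ _ (avg (fun a => L * w lam.+1 * w mu.+1 *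
      (V (mix S1 a y) + V (mix S2 a y) + (V (mix S3 a y) + V (mix S4 a y)))))).
  apply: ler_avg => a; apply: diff2 => //; first by rewrite ltnS mulam.
  - by move=> j; exact: blockC_neq.
  - by move=> j; exact: blockC_neq.
  - by move=> j; exact: blockC_neqS.
  - by move=> j; exact: ltn_neq.
rewrite avgZ !avgD -!/(amix _ _ _) /=.
apply: (@le_trans _ _ (L * w lam.+1 * w mu.+1 * (4 * (b%:R ^+ 2 * lvl mu V y)))); last first.
  by rewrite le_eqVlt; apply/orP; left; apply/eqP; rewrite /lvl; ring.
apply: ler_wpM2l; first by rewrite !mulr_ge0.
have h1 : amix S1 V y <= b%:R ^+ 2 * lvl mu V y.
  apply: (@amix_lvl2 _ _ lam mu) => //; first exact: leq_trans mulam (ltnW lams).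
  by move=> j; exact: leq_blockCS.
have h2 : amix S2 V y <= b%:R ^+ 2 * lvl mu V y.
  apply: le_trans (lb1 _); apply: (@amix_lvl1 _ _ mu).
    exact: leq_trans mulam (ltnW lams).
  exact: leq_ltn_or.
have h3 : amix S3 V y <= b%:R ^+ 2 * lvl mu V y.
  apply: le_trans (lb1 _); apply: (@amix_lvl1 _ _ lam) => //.
  by move=> j; apply: leq_blockC; exact: ltnW.
apply: le_trans (lerD (lerD h1 h2) (lerD h3 (lb _))) _.
by rewrite le_eqVlt; apply/orP; left; apply/eqP; ring.
Qed.

End block_bound.

(** * Integration error of the net *)

Section geometric.
Context {K : numFieldType}.

Lemma geom_dist_sum (x : K) (m k : nat) : 0 < x -> x < 1 ->
  \sum_(l < m) x ^+ ((l - k) + (k - l)) <= 2 / (1 - x).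
Proof.
move=> x0 x1; have d0 : 0 < 1 - x by rewrite subr_gt0.
rewrite ler_pdivlMr// mulrC.
(* Sharpened so that the induction closes: up to k the partial sum is one geometric tail, and past k
   the remaining right tail is subtracted from the total. *)
suff H : (1 - x) * \sum_(l < m) x ^+ ((l - k) + (k - l)) <=
    if (m <= k)%N then x ^+ (k - m) else 2 - x ^+ (m - k).
  apply: le_trans H _; case: ifP => _; last by rewrite gerBl exprn_ge0// ltW.
  apply: (@le_trans _ _ 1); first by rewrite exprn_ile1// ltW.
  by rewrite ler1n.
elim: m => [|m IHm]; first by rewrite big_ord0 mulr0 leq0n exprn_ge0// ltW.
rewrite big_ord_recr/= mulrDr; apply: le_trans (lerD IHm (lexx _)) _.
case: (ltngtP m k) => mk.
- rewrite (_ : m - k = 0)%N; last by lia.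
  rewrite add0n (_ : k - m = (k - m.+1).+1)%N; last by lia.
  rewrite exprS -subr_ge0.
  rewrite (_ : _ - _ = (1 - x) ^+ 2 * x ^+ (k - m.+1)); last by ring.
  by rewrite mulr_ge0 ?exprn_ge0// ltW.
- rewrite (_ : k - m = 0)%N; last by lia.
  rewrite addn0 subSn; last by lia.
  by rewrite exprS le_eqVlt; apply/orP; left; apply/eqP; ring.
- rewrite mk subnn subSnn expr0 expr1 mulr1.
  by rewrite le_eqVlt; apply/orP; left; apply/eqP; ring.
Qed.

End geometric.

(** Used to lower the digit counts kap to a total within reach of exact integration; one unit at a
    time is added where there is room. *)
Lemma subsum_exists d (kap : 'I_d -> nat) N : (N <= \sum_i kap i)%N ->
  exists2 m : 'I_d -> nat, (forall i, (m i <= kap i)%N) & (\sum_i m i = N)%N.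
Proof.
elim: N => [|N IH] Nk; first by exists (fun=> 0%N) => //; rewrite big1.
have [m mk mN] := IH (ltnW Nk).
have [i mi] : exists i, (m i < kap i)%N.
  apply/existsP; apply: contraLR Nk => /existsPn km; rewrite -leqNgt -mN.
  by apply: leq_sum => i _; rewrite leqNgt km.
exists (fun j => (m j + (j == i))%N).
  by move=> j; case: eqP => [->|_]; rewrite ?addn0 ?addn1.
rewrite big_split /= mN (bigD1 i)//= eqxx big1 ?addn0 ?addn1// => j /negbTE ->//.
Qed.

Section net_error.
Context {K : numFieldType}.
Variables (b d s n v : nat) (A : 'I_d -> 'M['F_b]_(s, n)).
Hypotheses (b_prime : prime b) (netA : order_digital_net 2 v A).
Local Notation Y := 'cV['F_b]_s.

Let b1 : 1 <= b%:R :> K. Proof. by rewrite ler1n prime_gt0. Qed.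

Lemma depends_on_widen (J J' : pred nat) (F : Y -> K) :
  (forall j, J j -> J' j) -> depends_on J F -> depends_on J' F.
Proof. by move=> JJ JF y y' yy'; apply: JF => j /JJ/yy'. Qed.

(** A function of the first m digits is a block function with lam = mu = m, of cost 2 m; hence the
    bound n - ceil(v / 2), which is half of 2 n - v rounded down. *)
Lemma netavg_low (m : 'I_d -> nat) (V : 'I_d -> Y -> K) :
  (\sum_i m i <= n - uphalf v)%N ->
  (forall i, depends_on (fun j => j < m i)%N (V i)) ->
  netavg A V = \prod_i avg (V i).
Proof.
move=> mn mV; apply: (@netavg_block _ _ _ _ _ v _ netA m m) => // [|i].
  under eq_bigr do rewrite addnn -mul2n.
  rewrite -big_distrr /=; apply: leq_trans (leq_mul (leqnn 2) mn) _.
  rewrite mulnBr leq_sub2l// mul2n; have := odd_double_half v; rewrite uphalf_half; lia.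
apply: depends_on_widen (mV i) => j; rewrite /blockd => ->//.
Qed.

Lemma ler_netavg (F G : 'I_d -> Y -> K) :
  (forall i y, 0 <= F i y <= G i y) -> netavg A F <= netavg A G.
Proof. by move=> FG; apply: ler_avg => w; apply: ler_prod => i _. Qed.

Lemma norm_netavg (F V : 'I_d -> Y -> K) :
  (forall i y, `|F i y| <= V i y) -> `|netavg A F| <= netavg A V.
Proof.
move=> FV; apply: le_trans (norm_avg _) _; apply: ler_avg => w.
by rewrite normr_prod; apply: ler_prod => i _; rewrite normr_ge0 FV.
Qed.

(** The digits are cut down to a total of at most n - ceil(v / 2), where the net is exact. As the
    kap add up to at most n, no more than ceil(v / 2) <= v digits are lost, each at the price b. *)
Lemma netavg_lvl_le (kap m : 'I_d -> nat) (V : 'I_d -> Y -> K) :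
  (\sum_i kap i <= n)%N -> (forall i y, 0 <= V i y) ->
  (forall i, depends_on (fun j => j < kap i)%N (V i)) ->
  netavg A (fun i => lvl (m i) (V i)) <= b%:R ^+ v * \prod_i avg (V i).
Proof.
move=> kapn V0 kV.
pose N := minn (\sum_i kap i) (n - uphalf v).
have [k kk kN] := subsum_exists (geq_minl _ _ : (N <= \sum_i kap i)%N).
have lV0 i y : 0 <= lvl (m i) (V i) y by exact: avg_ge0.
apply: (@le_trans _ _ (netavg A (fun i y => b%:R ^+ (kap i - k i) * lvl (k i) (lvl (m i) (V i)) y))).
  apply: ler_netavg => i y; rewrite lV0/=; apply: lvl_le => //.
  exact: depends_amix.
rewrite (@netavg_low k).
- under eq_bigr do rewrite avgZ /lvl !avg_amix.
  rewrite big_split /=; apply: ler_wpM2r; first by apply: prodr_ge0 => i _; exact: avg_ge0.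
  rewrite -expr_sum ler_weXn2l// sumnB// kN /N.
  have : (uphalf v <= v)%N by rewrite uphalf_half; have := odd_double_half v; lia.
  by move: kapn; set S := (\sum_i kap i)%N; lia.
- by rewrite kN geq_minr.
move=> i y y' yy'; congr (_ * _).
by apply: (@amix_depends _ _ _ _ _ (fun j => j < k i)%N) => // j; rewrite -ltnNge.
Qed.

Variables (x L : K).
Hypotheses (x0 : 0 < x) (x1 : x < 1) (L1 : 1 <= L).
Variables (kap : 'I_d -> nat) (F V : 'I_d -> Y -> K).
Hypotheses (kapn : (\sum_i kap i <= n)%N)
  (kV : forall i, depends_on (fun j => j < kap i)%N (V i))
  (FV : forall i, dominates x L (kap i) (V i) (F i)).

Let V0 i y : 0 <= V i y.
Proof. by case: (FV i) => + _ _ => /(_ y); apply: le_trans. Qed.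

Let dist l k := ((l - k) + (k - l))%N.

Let w i m := x ^+ (4 * (m - kap i)).

Let blk (p : {ffun 'I_d -> 'I_s.+1 * 'I_s.+1}) i y := block (F i) (p i).1 (p i).2 y.

(* Chernoff: on the blocks with sum (lam + mu) > 2n - v the weights are traded
   for x^{3 sum (lam + mu)}, after which the sum over all blocks factorizes. *)
Let chernoff (p : {ffun 'I_d -> 'I_s.+1 * 'I_s.+1}) :
  (2 * n - v <= \sum_i ((p i).1 + (p i).2))%N ->
  (\prod_i (w i (p i).1 * w i (p i).2)) * x ^+ (6 * \sum_i kap i) <=
  x ^+ (3 * (2 * n - v)) *
    \prod_i (x ^+ dist (p i).1 (kap i) * x ^+ dist (p i).2 (kap i)).
Proof.
move=> le_p; have xle m m' : (m' <= m)%N -> x ^+ m <= x ^+ m'.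
  by move=> mm'; rewrite ler_wiXn2l// ltW.
rewrite /w; under eq_bigr do rewrite -exprD.
under [X in _ <= _ * X]eq_bigr do rewrite -exprD.
rewrite -!expr_sum -!exprD; apply: xle.
apply: (@leq_trans (3 * (\sum_i ((p i).1 + (p i).2)) +
   \sum_i (dist (p i).1 (kap i) + dist (p i).2 (kap i)))%N).
  by rewrite leq_add2r leq_mul2l le_p orbT.
rewrite !big_distrr /= -!big_split /=; apply: leq_sum => i _.
by rewrite /dist; lia.
Qed.

(** The factors come from [block_bound] in each coordinate, from [netavg_lvl_le], and from two
    geometric sums (over lam and over mu) in each coordinate. *)
Let Cst := (4 * L * b%:R ^+ 2) ^+ d * b%:R ^+ v * (2 / (1 - x)) ^+ (2 * d).

(** Net average and exact mean are expanded over the same blocks and compared term by term. The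
    power of x on the left stands for a negative exponent on the right. *)
Lemma net_error :
  `|netavg A F - \prod_i avg (F i)| * x ^+ (6 * \sum_i kap i) <=
  Cst * x ^+ (3 * (2 * n - v)) * \prod_i avg (V i).
Proof.
pose P := {ffun 'I_d -> 'I_s.+1 * 'I_s.+1}.
have FE i y : F i y = \sum_(p : 'I_s.+1 * 'I_s.+1) block (F i) p.1 p.2 y.
  by rewrite [LHS](block_sum (F i) y) (pair_bigA _ (fun l m : 'I_s.+1 => block (F i) l m y)).
have -> : netavg A F = \sum_(p : P) netavg A (blk p).
  rewrite /netavg -avg_sum; apply: eq_avg => z.
  under eq_bigr do rewrite FE.
  by rewrite bigA_distr_bigA.
have -> : \prod_i avg (F i) = \sum_(p : P) \prod_i avg (blk p i).
  transitivity (\prod_i \sum_(p : 'I_s.+1 * 'I_s.+1) avg (block (F i) p.1 p.2)).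
    apply: eq_bigr => i _; rewrite -avg_sum; apply: eq_avg => y; exact: FE.
  by rewrite bigA_distr_bigA.
rewrite -sumrB.
have V1 : 0 <= \prod_i avg (V i) by apply: prodr_ge0 => i _; exact: avg_ge0.
have C2 : 0 <= 4 * L * b%:R ^+ 2.
  by rewrite !mulr_ge0// ?exprn_ge0// (le_trans _ L1).
have C1 : 0 <= (4 * L * b%:R ^+ 2) ^+ d by exact: exprn_ge0.
apply: (@le_trans _ _ (\sum_(p : P) (4 * L * b%:R ^+ 2) ^+ d * b%:R ^+ v *
     \prod_i avg (V i) * x ^+ (3 * (2 * n - v)) *
     \prod_i (x ^+ dist (p i).1 (kap i) * x ^+ dist (p i).2 (kap i)))).
  rewrite -ler_pdivlMr ?exprn_gt0// mulr_suml.
  apply: le_trans (ler_norm_sum _ _ _) _; apply: ler_sum => p _.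
  rewrite ler_pdivlMr ?exprn_gt0//.
  have rhs0 : 0 <= (4 * L * b%:R ^+ 2) ^+ d * b%:R ^+ v *
     (\prod_i avg (V i)) * x ^+ (3 * (2 * n - v)) *
     \prod_i (x ^+ dist (p i).1 (kap i) * x ^+ dist (p i).2 (kap i)).
    rewrite !mulr_ge0 ?exprn_ge0 ?ler0n ?(ltW x0)//.
    by apply: prodr_ge0 => i _; rewrite mulr_ge0 ?exprn_ge0 ?(ltW x0).
  (* Index pairs with lam < mu occur only because the sums run over full squares; their blocks
     vanish. *)
  have [/existsP[i Bi]|/existsPn valid] := boolP [exists i, (p i).1 < (p i).2]%N.
    have B0 y : blk p i y = 0.
      rewrite /blk; case: (p i) Bi => [[[|lam] hl] [mu hm]] //= Bi.
        by rewrite gtn_eqF.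
      by rewrite leqNgt (ltnW Bi).
    rewrite [netavg _ _](_ : _ = 0); last first.
      rewrite -[RHS](@avg_cst _ {: 'cV['F_b]_n}); last exact: card_cV_gt0.
      by apply: eq_avg => z; rewrite (bigD1 i)//= B0 mul0r.
    rewrite [\prod_i avg (blk p i)](_ : _ = 0) ?subr0 ?normr0 ?mul0r//.
    rewrite (bigD1 i)//= (eq_avg B0) avg_cst ?mul0r//; exact: card_cV_gt0.
  have [le_p|gt_p] := leqP (\sum_i ((p i).1 + (p i).2)) (2 * n - v).
    rewrite (@netavg_block _ _ _ _ _ v _ netA (fun i => (p i).1) (fun i => (p i).2))//.
    - by rewrite subrr normr0 mul0r.
    - by move=> i; rewrite leqNgt valid.
    - by move=> i; exact: block_depends.
  (* Beyond the threshold some factor is a block of mean zero, so the exact mean vanishes and only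
     the net average has to be bounded. *)
  have [i pi0] : exists i, (0 < (p i).1 + (p i).2)%N.
    apply/existsP; apply: contraLR gt_p => /existsPn p0.
    by rewrite -leqNgt big1// => i _; apply/eqP; rewrite -leqn0 leqNgt p0.
  rewrite [\prod_i avg (blk p i)](_ : _ = 0); last first.
    by rewrite (bigD1 i)//= avg_block ?mul0r.
  rewrite subr0.
  have : `|netavg A (blk p)| <= netavg A (fun i y =>
      4 * L * b%:R ^+ 2 * (w i (p i).1 * w i (p i).2) * lvl (p i).2.-1 (V i) y).
    apply: norm_netavg => j y; by apply: block_bound => //; do ?[exact: FV|rewrite -ltnS; exact: ltn_ord].
  rewrite {2}/netavg.
  under eq_avg do rewrite big_split/= big_split /= prodr_const card_ord.
  rewrite avgZ => H; apply: le_trans (ler_wpM2r (exprn_ge0 _ (ltW x0)) H) _.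
  have h1 := netavg_lvl_le (fun i => (p i).2.-1) kapn V0 kV.
  have h2 := chernoff (ltnW gt_p).
  move: h1 h2; rewrite /netavg; set c := (_ ^+ d); set W := \prod_(i < d) (w i (p i).1 * w i (p i).2); set AV := avg _.
  set X := x ^+ _; set B := b%:R ^+ v; set PV := \prod_i avg (V i); set X3 := x ^+ _.
  set PD := \prod_i (x ^+ dist (p i).1 (kap i) * _) => h1 h2.
  have -> : c * W * AV * X = c * ((W * X) * AV) by ring.
  have -> : c * B * PV * X3 * PD = c * ((X3 * PD) * (B * PV)) by ring.
  apply: ler_wpM2l => //; apply: ler_pM => //.
    rewrite mulr_ge0 ?exprn_ge0 ?(ltW x0)//.
    by apply: prodr_ge0 => j _; rewrite mulr_ge0 ?exprn_ge0 ?(ltW x0).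
  by apply: avg_ge0 => z; apply: prodr_ge0 => j _; exact: avg_ge0.
rewrite -mulr_sumr [leRHS](_ : _ = (4 * L * b%:R ^+ 2) ^+ d * b%:R ^+ v *
  \prod_i avg (V i) * x ^+ (3 * (2 * n - v)) * (2 / (1 - x)) ^+ (2 * d)); last by rewrite /Cst; ring.
apply: ler_wpM2l; first by rewrite !mulr_ge0 ?exprn_ge0 ?ler0n ?(ltW x0).
rewrite -(bigA_distr_bigA (fun i (p : 'I_s.+1 * 'I_s.+1) => x ^+ dist p.1 (kap i) * x ^+ dist p.2 (kap i))) /=.
rewrite [leRHS](_ : _ = \prod_(i < d) (2 / (1 - x)) ^+ 2); last first.
  by rewrite prodr_const card_ord -exprM.
apply: ler_prod => i _; apply/andP; split.
  by apply: sumr_ge0 => p _; rewrite mulr_ge0 ?exprn_ge0 ?(ltW x0).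
rewrite -(pair_bigA _ (fun l m : 'I_s.+1 => x ^+ dist l (kap i) * x ^+ dist m (kap i))) /=.
rewrite expr2; under eq_bigr do rewrite -mulr_sumr.
rewrite -mulr_suml; apply: ler_pM; try exact: geom_dist_sum.
all: by apply: sumr_ge0 => l _; rewrite exprn_ge0 ?(ltW x0).
Qed.

End net_error.

(** * Digits and the points of the net *)

Section digit_bijection.
Variables (b n : nat).
Hypothesis b_prime : prime b.

Lemma digit_sum_lt (c : nat -> nat) m : (forall k, (c k < b)%N) ->
  (\sum_(k < m) c k * b ^ k < b ^ m)%N.
Proof.
move=> cb; elim: m => [|m IH]; first by rewrite big_ord0 expn_gt0 prime_gt0.
rewrite big_ord_recr/= expnS; apply: leq_trans (leq_mul (cb m) (leqnn (b ^ m))).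
by rewrite mulSn ltn_add2r.
Qed.

Lemma digit_sumK (c : nat -> nat) m j : (forall k, (c k < b)%N) -> (j < m)%N ->
  ((\sum_(k < m) c k * b ^ k) %/ b ^ j %% b = c j)%N.
Proof.
have b0 : (0 < b)%N by exact: prime_gt0.
elim: m c j => [//|m IH] c j cb jm.
rewrite big_ord_recl /= muln1.
have -> : (\sum_(i < m) c (bump 0 i) * b ^ bump 0 i = (\sum_(i < m) c i.+1 * b ^ i) * b)%N.
  rewrite big_distrl /=; apply: eq_bigr => i _.
  by rewrite /bump leq0n add1n expnSr mulnA.
case: j jm => [|j] jm; first by rewrite divn1 addnC modnMDl modn_small.
rewrite expnS divnMA addnC divnMDl// [(c 0 %/ b)%N]divn_small// addn0.
by rewrite (IH (fun i => c i.+1)).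
Qed.

Definition mval (y : 'cV['F_b]_n) : nat := (\sum_(k < n) y k 0%R * b ^ k)%N.

Lemma Fp_lt (a : 'F_b) : (a < b)%N.
Proof. by have := ltn_ord a; rewrite [X in (_ < X)%N -> _]Fp_cast. Qed.

Let coef (y : 'cV['F_b]_n) (k : nat) : nat := if insub k is Some i then y i 0 else 0%N.

Let coefE y (k : 'I_n) : coef y k = y k 0.
Proof. by rewrite /coef insubT//= => H; congr (nat_of_ord (y _ 0)); exact: val_inj. Qed.

Let coef_lt y k : (coef y k < b)%N.
Proof. by rewrite /coef; case: insub => [i|]; [exact: Fp_lt|exact: prime_gt0]. Qed.

Let mvalE y : mval y = (\sum_(k < n) coef y k * b ^ k)%N.
Proof. by apply: eq_bigr => k _; rewrite coefE. Qed.

Lemma mval_lt y : (mval y < b ^ n)%N.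
Proof. by rewrite mvalE; exact: digit_sum_lt. Qed.

Lemma mvalK : cancel mval (@digits b n).
Proof.
move=> y; apply/colP => j; rewrite mxE mvalE digit_sumK// coefE.
by apply: val_inj => /=; rewrite val_Fp_nat// modn_small// Fp_lt.
Qed.

Lemma digits_bij : bijective (fun nu : 'I_(b ^ n) => @digits b n nu).
Proof.
pose h y : 'I_(b ^ n) := Ordinal (mval_lt y).
have hK : cancel h (fun nu : 'I_(b ^ n) => @digits b n nu) by exact: mvalK.
have hinj := can_inj hK.
have hbij : bijective h.
  apply: inj_card_bij => //.
  by rewrite card_ord card_mx card_Fp// muln1.
exact: (bij_can_bij hbij hK).
Qed.

Lemma digitsK (nu : 'I_(b ^ n)) : mval (@digits b n nu) = nu.
Proof.
by apply: (congr1 (@nat_of_ord _) (_ : Ordinal (mval_lt _) = nu)); apply: (bij_inj digits_bij); rewrite /= mvalK.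
Qed.

Lemma avg_digits {K : numFieldType} (F : 'cV['F_b]_n -> K) :
  avg F = (b ^ n)%:R^-1 * \sum_(nu < b ^ n) F (@digits b n nu).
Proof. by rewrite (avg_reindex _ digits_bij) /avg card_ord. Qed.

End digit_bijection.

Section grid_points.
Context {R : realType}.
Variables (b s : nat).
Hypothesis b_prime : prime b.
Local Notation Y := 'cV['F_b]_s.

Definition zpt (y : Y) : R := \sum_(k < s) (y k 0 : nat)%:R * b%:R ^- k.+1.

Let b0 : 0 < b%:R :> R. Proof. by rewrite ltr0n prime_gt0. Qed.

Let revY (y : Y) : Y := \col_j y (rev_ord j) 0.

Let revYK : involutive revY.
Proof. by move=> y; apply/colP => j; rewrite !mxE rev_ordK. Qed.

(** The first digit of y is the leading one of the point but the lowest one of [mval], hence the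
    reversal. *)
Lemma zpt_mval y : zpt y = (mval (revY y))%:R / (b ^ s)%:R.
Proof.
rewrite /zpt /mval natr_sum mulr_suml (reindex_inj rev_ord_inj)/=.
apply: eq_bigr => k _; rewrite mxE natrM -mulrA; congr (_ * _).
have ks := ltn_ord k.
rewrite !natrX -[X in _ = _ / b%:R ^+ X](_ : (k + (s - k.+1).+1)%N = s); last by lia.
by rewrite exprD invfM mulrA divff ?mul1r// expf_neq0// gt_eqF.
Qed.

Lemma avg_zpt {K : numFieldType} (G : R -> K) :
  avg (fun y => G (zpt y)) = (b ^ s)%:R^-1 * \sum_(m < b ^ s) G (m%:R / (b ^ s)%:R).
Proof.
rewrite (avg_reindex _ (inv_bij revYK)) avg_digits//; congr (_ * _).
by apply: eq_bigr => m _; rewrite zpt_mval revYK digitsK.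
Qed.

Lemma zpt_ge0_lt1 y : 0 <= zpt y < 1.
Proof.
rewrite zpt_mval divr_ge0 ?ler0n//= ltr_pdivrMr ?ltr0n ?expn_gt0 ?prime_gt0//.
by rewrite mul1r ltr_nat mval_lt.
Qed.

Lemma zpt_differ_at (j : 'I_s) y y' : differ_at j y y' -> `|zpt y - zpt y'| <= b%:R ^- j.
Proof.
move=> yy'; rewrite /zpt -sumrB (bigD1 j)//= big1 ?addr0; last first.
  by move=> k kj; rewrite yy'// subrr.
rewrite -mulrBl normrM [X in _ * X]ger0_norm ?invr_ge0 ?exprn_ge0 ?ler0n//.
rewrite ler_pdivrMr ?exprn_gt0// exprS mulrCA mulVf ?mulr1 ?expf_neq0 ?gt_eqF//.
have := Fp_lt b_prime (y j 0); have := Fp_lt b_prime (y' j 0).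
rewrite -!(ltr_nat R) ler_norml => h1 h2.
have := ler0n R (y j 0); have := ler0n R (y' j 0); lra.
Qed.

Definition ztrunc kap (y : Y) : Y := \col_j if (j < kap)%N then y j 0 else 0.

Lemma zpt_trunc kap y : `|zpt y - zpt (ztrunc kap y)| <= b%:R ^- kap.
Proof.
have [sk|ks] := leqP s kap.
  rewrite (_ : ztrunc kap y = y) ?subrr ?normr0 ?invr_ge0 ?exprn_ge0 ?(ltW b0)//.
  by apply/colP => j; rewrite mxE (leq_trans (ltn_ord j) sk).
rewrite /zpt -sumrB.
apply: le_trans (ler_norm_sum _ _ _) _.
(* A digit is at most b - 1, so each dropped term is at most b^-k - b^-(k+1) and the tail
   telescopes. *)
apply: (@le_trans _ _ (\sum_(k < s) (if (k < kap)%N then 0 else b%:R ^- k - b%:R ^- k.+1))).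
  apply: ler_sum => k _; rewrite mxE; case: ifP => kk; first by rewrite subrr normr0.
  rewrite mul0r subr0 ger0_norm; last by rewrite mulr_ge0 ?invr_ge0 ?exprn_ge0 ?ler0n.
  rewrite (_ : b%:R ^- k = b%:R * b%:R ^- k.+1 :> R); last first.
    by rewrite exprS invfM mulrA divff ?mul1r// gt_eqF.
  rewrite -[X in _ <= _ - X]mul1r -mulrBl ler_wpM2r ?invr_ge0 ?exprn_ge0 ?(ltW b0)//.
  by rewrite lerBrDr natr1 ler_nat; exact: Fp_lt.
rewrite -(big_mkord xpredT (fun k => if (k < kap)%N then 0 else b%:R ^- k - b%:R ^- k.+1)).
rewrite (big_cat_nat (leq0n kap) (ltnW ks))/= big_nat_cond big1 ?add0r; last first.
  by move=> k /andP[/andP[_ ->]].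
rewrite (eq_big_nat _ _ (F2 := fun k => - b%:R ^- k.+1 - - b%:R ^- k)); last first.
  by move=> k /andP[kk _]; rewrite ltnNge kk/= opprK addrC.
rewrite telescope_sumr; last exact: ltnW.
by rewrite opprK addrC gerBl invr_ge0 exprn_ge0 ?(ltW b0).
Qed.

Lemma digital_netE d n (A : 'I_d -> 'M['F_b]_(s, n)) (nu : 'I_(b ^ n)) i :
  digital_net A nu 0 i = zpt (A i *m @digits b n nu).
Proof. by rewrite mxE. Qed.

End grid_points.

(** * The profile of the kernel *)

Section tau.
Context {R : realType}.
Implicit Types u v h a : R.

(** The decay profile of all the estimates: integrable, changed by at most a bounded factor under
    bounded shifts, and with the explicit primitive [atan]. *)
Definition tau u : R := (1 + u ^+ 2)^-1.

Lemma tauV_gt0 u : 0 < 1 + u ^+ 2.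
Proof. by rewrite ltr_pwDl// sqr_ge0. Qed.

Lemma tau_gt0 u : 0 < tau u.
Proof. by rewrite invr_gt0 tauV_gt0. Qed.

Lemma tau_ge0 u : 0 <= tau u. Proof. exact/ltW/tau_gt0. Qed.

Lemma tau_le1 u : tau u <= 1.
Proof. by rewrite invf_le1 ?tauV_gt0// lerDl sqr_ge0. Qed.

Lemma tau_le u v : u ^+ 2 <= v ^+ 2 -> tau v <= tau u.
Proof. by move=> uv; rewrite lef_pV2 ?posrE ?tauV_gt0// lerD2l. Qed.

Lemma tau_shift u h : tau (u + h) <= 2 * (1 + h ^+ 2) * tau u.
Proof.
rewrite /tau ler_pdivlMr ?tauV_gt0// mulrC ler_pdivrMr ?tauV_gt0//.
have := sqr_ge0 (2 * h + u); have := sqr_ge0 (u * h + h ^+ 2).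
have := sqr_ge0 h; have := sqr_ge0 (u + 2 * h).
rewrite !expr2; nra.
Qed.

Lemma tau_shift_sqr u h B : `|h| <= B -> tau (u + h) <= 2 * (1 + B ^+ 2) * tau u.
Proof.
move=> hB; apply: le_trans (tau_shift u h) _; rewrite ler_wpM2r ?tau_ge0//.
by rewrite ler_wpM2l// lerD2l -real_normK ?num_real// lerXn2r ?nnegrE// (le_trans _ hB).
Qed.

Lemma mul_tau_le1 u : `|u| * tau u <= 1.
Proof.
rewrite /tau ler_pdivrMr ?tauV_gt0// mul1r.
by have := sqr_ge0 (`|u| - 1); rewrite -[u ^+ 2]real_normK ?num_real// !expr2; nra.
Qed.

Lemma continuous_tau : continuous tau.
Proof. exact: continuous_oneDsqrV. Qed.

(** Stated with a relative position t and without an order between u and v, so that increments of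
    either sign are covered. *)
Lemma mean_value (f df : R -> R) (u v : R) : (forall x : R, is_derive x 1 f (df x)) ->
  exists2 t, 0 <= t <= 1 & f v - f u = df (u + t * (v - u)) * (v - u).
Proof.
move=> fdf; have cf (A : set R) : {within A, continuous f}.
  apply: continuous_subspaceT => x; apply/differentiable_continuous/derivable1_diffP.
  exact: ex_derive.
have [->|uv] := eqVneq u v.
  by exists 0; rewrite ?lexx ?ler01// !subrr mulr0.
have duv : v - u != 0 by rewrite subr_eq0 eq_sym.
suff [c [cuv E]] : exists c, (0 <= (c - u) / (v - u) <= 1) /\ f v - f u = df c * (v - u).
  by exists ((c - u) / (v - u)) => //; rewrite divfK// [u + _]addrC subrK.
have [lt_uv|lt_vu|eq_uv] := ltgtP u v; last by rewrite eq_uv eqxx in uv.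
- have [c] := @MVT _ f df _ _ lt_uv (fun x _ => fdf x) (cf _).
  rewrite in_itv/= => /andP[uc cv] ->; exists c; split => //.
  apply/andP; split; first by apply: divr_ge0; rewrite subr_ge0 ltW.
  by rewrite ler_pdivrMr ?subr_gt0// mul1r lerD2r ltW.
- have [c] := @MVT _ f df _ _ lt_vu (fun x _ => fdf x) (cf _).
  rewrite in_itv/= => /andP[vc cu] E; exists c; split.
    rewrite -[X in X / _]opprB -[X in _ / X]opprB invrN mulrNN.
    apply/andP; split; first by apply: divr_ge0; rewrite subr_ge0 ltW.
    by rewrite ler_pdivrMr ?subr_gt0// mul1r lerD2l lerN2 ltW.
  by rewrite -opprB E -mulrN opprB.
Qed.

Lemma is_derive_compR (f g : R -> R) (x a c : R) : is_derive (g x) 1 f a ->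
  is_derive x 1 g c -> is_derive x 1 (fun y => f (g y)) (a * c).
Proof. exact: is_derive1_comp. Qed.

Lemma is_derive_cstM (g : R -> R) (x a c : R) : is_derive x 1 g a ->
  is_derive x 1 (fun y => c * g y) (c * a).
Proof. exact: is_deriveZ. Qed.

Lemma is_derive_continuous (f df : R -> R) : (forall x : R, is_derive x 1 f (df x)) ->
  continuous f.
Proof.
by move=> fdf x; apply/differentiable_continuous/derivable1_diffP; exact: ex_derive.
Qed.

End tau.

(** * Fourier transforms of bump functions *)

Section bump_fourier.
Context {R : realType}.
Local Notation mu := (@lebesgue_measure R).
Implicit Types f : nat -> R -> R.

(** A smooth function f 0 given together with all its derivatives; 3/2 is the support radius of the
    cutoff. *)
Definition bumpseq f := (forall n (x : R), is_derive x 1 (f n) (f n.+1 x)) /\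
  (forall n x, 3 / 2 < `|x| -> f n x = 0).

Lemma bumpseq_continuous f n : bumpseq f -> continuous (f n).
Proof. by move=> [fd _]; exact: is_derive_continuous. Qed.

(** Leibniz rule for x times f 0; at n = 0 the second term carries the factor 0. It is used for the
    derivative of the transform. *)
Lemma bumpseq_mulX f : bumpseq f ->
  bumpseq (fun n x => x * f n x + n%:R * f n.-1 x).
Proof.
move=> [fd f0]; split=> n x; last by move=> x2; rewrite !f0// !mulr0 addr0.
have d1 : is_derive x 1 (fun y : R => y * f n y) (x * f n.+1 x + f n x).
  apply: (is_derive_eq (is_deriveM (is_derive_id x 1) (fd n x))).
  by rewrite /GRing.scale /= mulr1.
have d2 : is_derive x 1 (fun y : R => n%:R * f n.-1 y) (n%:R * f n x).
  case: n {d1} => [|n] /=; last exact: (is_deriveZ n.+1%:R (fd n x)).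
  rewrite mul0r (_ : (fun _ => _) = cst 0); first exact: is_derive_cst.
  by apply/funext => y; rewrite mul0r.
apply: (is_derive_eq (is_deriveD d1 d2)) => /=.
by rewrite -[n.+1%:R]natr1; ring.
Qed.

(** The endpoints lie outside the support, so integration by parts leaves no boundary terms. *)
Definition fcos (f : R -> R) (u : R) : R := \int[mu]_(x in `[-2, 2]) (f x * cos (u * x)).
Definition fsin (f : R -> R) (u : R) : R := \int[mu]_(x in `[-2, 2]) (f x * sin (u * x)).

Let lt22 : -2 < 2 :> R. Proof. lra. Qed.

Lemma is_derive_mull (u x : R) : is_derive x 1 (fun y : R => u * y) u.
Proof.
apply: (is_derive_eq (is_deriveZ u (is_derive_id x 1))).
by rewrite /GRing.scale /= mulr1.
Qed.

Lemma is_derive_cosM (u x : R) : is_derive x 1 (fun x => cos (u * x)) (- u * sin (u * x)).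
Proof.
apply: (is_derive_eq (is_derive1_comp (is_derive_cos (u * x)) (is_derive_mull u x))).
by rewrite mulNr mulrC mulNr.
Qed.

Lemma is_derive_sinM (u x : R) : is_derive x 1 (fun x => sin (u * x)) (u * cos (u * x)).
Proof.
apply: (is_derive_eq (is_derive1_comp (is_derive_sin (u * x)) (is_derive_mull u x))).
by rewrite mulrC.
Qed.

Lemma continuous_cosM (u : R) : continuous (fun x => cos (u * x)).
Proof. by apply: is_derive_continuous => x; exact: is_derive_cosM. Qed.

Lemma continuous_sinM (u : R) : continuous (fun x => sin (u * x)).
Proof. by apply: is_derive_continuous => x; exact: is_derive_sinM. Qed.

Lemma continuous_itv_integrable (g : R -> R) (a b : R) : continuous g ->
  mu.-integrable `[a, b] (EFin \o g).
Proof.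
move=> cg; apply: continuous_compact_integrable; first exact: segment_compact.
exact: continuous_subspaceT.
Qed.

Lemma continuousMr (g h : R -> R) : continuous g -> continuous h ->
  continuous (fun x => g x * h x).
Proof. by move=> cg ch x; apply: continuousM; [exact: cg|exact: ch]. Qed.

Let derivable_oo (g dg : R -> R) (a b : R) : (forall x : R, is_derive x 1 g (dg x)) ->
  derivable_oo_LRcontinuous g a b.
Proof.
move=> gd; split; first by move=> x _; exact: ex_derive.
- by apply: cvg_at_right_filter; exact: (is_derive_continuous gd).
- by apply: cvg_at_left_filter; exact: (is_derive_continuous gd).
Qed.

Lemma mul_fcos f n u : bumpseq f -> u * fcos (f n) u = - fsin (f n.+1) u.
Proof.
move=> bf; have [fd f0] := bf; have cf m : continuous (f m) := bumpseq_continuous bf (n := m).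
rewrite /fcos /fsin -RintegralZl//; last first.
  by apply: continuous_itv_integrable; apply: continuousMr => //; exact: continuous_cosM.
under eq_Rintegral do rewrite mulrCA.
rewrite (@Rintegration_by_parts _ (f n) (fun x => sin (u * x)) (f n.+1))//.
- by rewrite !f0 ?mul0r ?subrr ?sub0r//; rewrite ?normrN ger0_norm//; lra.
- exact: continuous_subspaceT.
- exact: derivable_oo.
- by move=> x _; rewrite derive1E; exact: derive_val.
- apply: continuous_subspaceT; apply: continuousMr; last exact: continuous_cosM.
  by move=> x; exact: cvg_cst.
- by apply: derivable_oo => x; exact: is_derive_sinM.
- by move=> x _; rewrite derive1E; have [_ ->] := is_derive_sinM u x.
Qed.

Lemma mul_fsin f n u : bumpseq f -> u * fsin (f n) u = fcos (f n.+1) u.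
Proof.
move=> bf; have [fd f0] := bf; have cf m : continuous (f m) := bumpseq_continuous bf (n := m).
rewrite /fcos /fsin -RintegralZl//; last first.
  by apply: continuous_itv_integrable; apply: continuousMr => //; exact: continuous_sinM.
under eq_Rintegral do rewrite mulrCA -[u * sin _]opprK -mulNr.
rewrite (@Rintegration_by_parts _ (f n) (fun x => - cos (u * x)) (f n.+1))//.
- rewrite !f0 ?mul0r ?subrr ?sub0r//; try (by rewrite ?normrN ger0_norm//; lra).
  under eq_Rintegral do rewrite mulrN -mulN1r.
  rewrite RintegralZl ?mulN1r ?opprK//.
  by apply: continuous_itv_integrable; apply: continuousMr => //; exact: continuous_cosM.
- exact: continuous_subspaceT.
- exact: derivable_oo.
- by move=> x _; rewrite derive1E; exact: derive_val.
- suff : continuous (fun x : R => - (- u * sin (u * x))) by exact: continuous_subspaceT.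
  apply: (@is_derive_continuous _ _ (fun x => - (- u * (u * cos (u * x))))) => x.
  by apply: is_deriveN; apply: is_derive_cstM; exact: is_derive_sinM.
- by apply: derivable_oo => x; apply: is_deriveN; exact: is_derive_cosM.
- by move=> x _; rewrite derive1E; have [_ ->] := is_deriveN (is_derive_cosM u x).
Qed.

Lemma norm_fcos_le (g : R -> R) u : continuous g ->
  `|fcos g u| <= \int[mu]_(x in `[-2, 2]) `|g x|.
Proof.
move=> cg; have cgc : continuous (fun x => g x * cos (u * x)).
  by apply: continuousMr => //; exact: continuous_cosM.
apply: le_trans (le_normr_Rintegral _ _) _ => //; first exact: continuous_itv_integrable.
apply: le_Rintegral => //.
- by apply: continuous_itv_integrable => x; apply: cvg_norm; exact: cgc.
- by apply: continuous_itv_integrable => x; apply: cvg_norm; exact: cg.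
- by move=> x _; rewrite normrM ler_piMr// ler_norml cos_geN1 cos_le1.
Qed.

Lemma norm_fsin_le (g : R -> R) u : continuous g ->
  `|fsin g u| <= \int[mu]_(x in `[-2, 2]) `|g x|.
Proof.
move=> cg; have cgc : continuous (fun x => g x * sin (u * x)).
  by apply: continuousMr => //; exact: continuous_sinM.
apply: le_trans (le_normr_Rintegral _ _) _ => //; first exact: continuous_itv_integrable.
apply: le_Rintegral => //.
- by apply: continuous_itv_integrable => x; apply: cvg_norm; exact: cgc.
- by apply: continuous_itv_integrable => x; apply: cvg_norm; exact: cg.
- by move=> x _; rewrite normrM ler_piMr// ler_norml sin_geN1 sin_le1.
Qed.

Lemma expM_fourier_le f m n u : bumpseq f ->
  `|u ^+ m * fcos (f n) u| <= \int[mu]_(x in `[-2, 2]) `|f (n + m)%N x| /\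
  `|u ^+ m * fsin (f n) u| <= \int[mu]_(x in `[-2, 2]) `|f (n + m)%N x|.
Proof.
move=> bf; elim: m n => [|m IH] n.
  rewrite addn0 !expr0 !mul1r.
  by split; [apply: norm_fcos_le|apply: norm_fsin_le]; exact: bumpseq_continuous.
rewrite exprSr -!mulrA mul_fcos// mul_fsin// mulrN normrN addnS -addSn.
by have [h1 h2] := IH n.+1.
Qed.

(** Six integrations by parts give the decay u^-6, that is tau^3. *)
Lemma fourier_decay f : bumpseq f -> exists2 C, 0 <= C &
  forall u, `|fcos (f 0) u| <= C * tau u ^+ 3 /\ `|fsin (f 0) u| <= C * tau u ^+ 3.
Proof.
move=> bf; pose I m := \int[mu]_(x in `[-2, 2]) `|f m x|.
have I0 m : 0 <= I m by exact: Rintegral_ge0.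
exists (4 * (I 0 + I 6)); first by rewrite mulr_ge0// addr_ge0.
move=> u; suff H v : `|v| <= I 0 -> `|u ^+ 6 * v| <= I 6 -> `|v| <= 4 * (I 0 + I 6) * tau u ^+ 3.
  have [a0 b0] := expM_fourier_le 0 0 u bf; have [a6 b6] := expM_fourier_le 6 0 u bf.
  by split; apply: H => //; [move: a0|move: b0]; rewrite expr0 mul1r.
move=> v0 v6; rewrite /tau exprVn ler_pdivlMr ?exprn_gt0 ?tauV_gt0//.
(* (1 + t)^3 <= 4 (1 + t^3) for t = u^2: the difference is 3 (1 + t) (1 - t)^2. *)
apply: (@le_trans _ _ (`|v| * (4 * (1 + u ^+ 6)))).
  rewrite ler_wpM2l//.
  have -> : u ^+ 6 = (u ^+ 2) ^+ 3 by rewrite -exprM.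
  have := sqr_ge0 u; move: (u ^+ 2) => t t0.
  rewrite -subr_ge0 [X in 0 <= X](_ : _ = 3 * (1 + t) * (1 - t) ^+ 2); last by ring.
  by rewrite mulr_ge0 ?sqr_ge0// mulr_ge0// addr_ge0.
rewrite mulrCA ler_wpM2l// mulrDr mulr1 lerD//.
by rewrite mulrC; move: v6; rewrite normrM ger0_norm// (exprM u 2 3) exprn_ge0// sqr_ge0.
Qed.

End bump_fourier.

(** * The antiderivative of the kernel and its differences *)

Section profile.
Context {R : realType}.
Local Notation mu := (@lebesgue_measure R).
Implicit Types u h : R.

Lemma is_derive_mulr_cst (u x : R) : is_derive u 1 (fun y : R => y * x) x.
Proof.
rewrite (_ : (fun y => y * x) = (fun y => x * y)); first exact: is_derive_mull.
by apply/funext => y; rewrite mulrC.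
Qed.

(** Differentiation under the integral sign; |y f(y)| dominates the derivative of the integrand
    uniformly in u. *)
Lemma is_derive_fcos (f : R -> R) u : continuous f ->
  is_derive u 1 (fcos f) (- fsin (fun x => x * f x) u).
Proof.
move=> cf.
have cxf : continuous (fun x : R => x * f x) by apply: continuousMr => // x; exact: cvg_id.
have dF (x y : R) : is_derive x 1 (fun u : R => f y * cos (u * y)) (- (y * f y * sin (x * y))).
  apply: (is_derive_eq (@is_derive_cstM _ (fun u => cos (u * y)) x _ (f y) (@is_derive_compR _ _ (fun u => u * y) _ _ _ (is_derive_cos (x * y)) (is_derive_mulr_cst x y)))).
  by ring.
have uI : `]u - 1, u + 1[%classic u by rewrite /= in_itv/=; lra.
have intf (x : R) : `]u - 1, u + 1[%classic x -> mu.-integrable `[-2, 2] (EFin \o (fun y => f y * cos (x * y))).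
  by move=> _; apply: continuous_itv_integrable; apply: continuousMr => //; exact: continuous_cosM.
have derf (x y : R) : `]u - 1, u + 1[%classic x -> `[(-2 : R), 2]%classic y ->
    derivable (fun u : R => f y * cos (u * y)) x 1.
  by move=> _ _; apply: ex_derive; exact: dF.
have G0 y : 0 <= `|y * f y| by [].
have intG : mu.-integrable `[-2, 2] (EFin \o (fun y => `|y * f y|)).
  by apply: continuous_itv_integrable => x; apply: cvg_norm; exact: cxf.
have Gub (x y : R) : `]u - 1, u + 1[%classic x -> `[(-2 : R), 2]%classic y ->
    `|partial1of2 (fun u y => f y * cos (u * y)) x y| <= `|y * f y|.
  move=> _ _; rewrite partial1of2E.
  have [_ ->] := dF x y; rewrite normrN normrM ler_piMr// ler_norml sin_geN1 sin_le1//.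
have mB : measurable (`[(-2 : R), 2]%classic : set (measurableTypeR R)) by [].
apply: DeriveDef.
  exact: (derivable_under_integral (f := fun u (y : measurableTypeR R) => f y * cos (u * y)) mB uI intf derf G0 intG Gub).
rewrite -derive1E (differentiation_under_integral (f := fun u (y : measurableTypeR R) => f y * cos (u * y)) mB uI intf derf G0 intG Gub).
transitivity (-1 * fsin (fun x => x * f x) u); last by rewrite mulN1r.
rewrite /fsin -RintegralZl//; last first.
  by apply: continuous_itv_integrable; apply: continuousMr => //; exact: continuous_sinM.
by apply: eq_Rintegral => y _; rewrite partial1of2E; have [_ ->] := dF u y; rewrite mulN1r.
Qed.

Lemma is_derive_fsin (f : R -> R) u : continuous f ->
  is_derive u 1 (fsin f) (fcos (fun x => x * f x) u).
Proof.
move=> cf.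
have cxf : continuous (fun x : R => x * f x) by apply: continuousMr => // x; exact: cvg_id.
have dF (x y : R) : is_derive x 1 (fun u : R => f y * sin (u * y)) (y * f y * cos (x * y)).
  apply: (is_derive_eq (@is_derive_cstM _ (fun u => sin (u * y)) x _ (f y) (@is_derive_compR _ _ (fun u => u * y) _ _ _ (is_derive_sin (x * y)) (is_derive_mulr_cst x y)))).
  by ring.
have uI : `]u - 1, u + 1[%classic u by rewrite /= in_itv/=; lra.
have intf (x : R) : `]u - 1, u + 1[%classic x -> mu.-integrable `[-2, 2] (EFin \o (fun y => f y * sin (x * y))).
  by move=> _; apply: continuous_itv_integrable; apply: continuousMr => //; exact: continuous_sinM.
have derf (x y : R) : `]u - 1, u + 1[%classic x -> `[(-2 : R), 2]%classic y ->
    derivable (fun u : R => f y * sin (u * y)) x 1.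
  by move=> _ _; apply: ex_derive; exact: dF.
have G0 y : 0 <= `|y * f y| by [].
have intG : mu.-integrable `[-2, 2] (EFin \o (fun y => `|y * f y|)).
  by apply: continuous_itv_integrable => x; apply: cvg_norm; exact: cxf.
have Gub (x y : R) : `]u - 1, u + 1[%classic x -> `[(-2 : R), 2]%classic y ->
    `|partial1of2 (fun u y => f y * sin (u * y)) x y| <= `|y * f y|.
  move=> _ _; rewrite partial1of2E.
  have [_ ->] := dF x y; rewrite normrM ler_piMr// ler_norml cos_geN1 cos_le1//.
have mB : measurable (`[(-2 : R), 2]%classic : set (measurableTypeR R)) by [].
apply: DeriveDef.
  exact: (derivable_under_integral (f := fun u (y : measurableTypeR R) => f y * sin (u * y)) mB uI intf derf G0 intG Gub).
rewrite -derive1E (differentiation_under_integral (f := fun u (y : measurableTypeR R) => f y * sin (u * y)) mB uI intf derf G0 intG Gub).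
by apply: eq_Rintegral => y _; rewrite partial1of2E; have [_ ->] := dF u y.
Qed.

Lemma integral_tau : (\int[mu]_x (tau x)%:E = pi%:E)%E.
Proof.
rewrite (ge0_symfun_integralT (f := tau)).
- rewrite -set_itvcy integral0y_oneDsqr -EFinM; congr EFin.
  by rewrite mulrC divfK.
- exact: tau_ge0.
- exact: continuous_tau.
- by move=> x; rewrite /tau /= sqrrN.
Qed.

Lemma integrable_tau : mu.-integrable setT (EFin \o tau).
Proof.
apply/integrableP; split.
  by apply/measurable_EFinP; apply: continuous_measurable_fun; exact: continuous_tau.
under eq_integral do rewrite /= ger0_norm ?tau_ge0//.
by rewrite integral_tau ltry.
Qed.

Lemma antiderivative_exists (k : R -> R) C : continuous k ->
  (forall u, `|k u| <= C * tau u) -> exists T : R -> R, forall u, is_derive u 1 T (k u).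
Proof.
move=> ck kC.
have ik : mu.-integrable setT (EFin \o k).
  apply: (@le_integrable _ _ R mu setT measurableT (EFin \o k) (EFin \o (fun x : R => C * tau x))).
  - by apply/measurable_EFinP; exact: continuous_measurable_fun.
  - by move=> x _; rewrite /= lee_fin (le_trans (kC x))// ler_norm.
  - exact: (integrableZl measurableT C integrable_tau).
exists (fun u => \int[mu]_(t in [set` Interval -oo%O (BRight u)]) k t) => u.
have uu1 : u < u + 1 by rewrite ltrDl.
have ik1 : mu.-integrable [set` Interval -oo%O (BRight (u + 1))] (EFin \o k).
  by apply: integrableS ik.
have FTC := @continuous_FTC1 _ k -oo%O u (u + 1) uu1 ik1.
case: (FTC _ (ck u)) => [|d1 d2]; first by rewrite ltNyr.
by apply: DeriveDef; [exact: d1|rewrite -derive1E; exact: d2].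
Qed.

Variables (T k dk : R -> R) (C : R).
Hypotheses (Tk : forall u, is_derive u 1 T (k u))
  (kdk : forall u, is_derive u 1 k (dk u)) (C0 : 0 <= C)
  (kC : forall u, `|k u| <= C * tau u ^+ 3)
  (dkC : forall u, `|dk u| <= C * tau u ^+ 3).

Let tau32 u : tau u ^+ 3 <= tau u ^+ 2.
Proof. by rewrite ler_wiXn2l ?tau_ge0 ?tau_le1. Qed.

Lemma bound_shift (g : R -> R) B u h : (forall u, `|g u| <= C * tau u ^+ 3) ->
  `|h| <= B -> `|g (u + h)| <= C * (2 * (1 + B ^+ 2)) ^+ 2 * tau u ^+ 2.
Proof.
move=> gC hB; apply: le_trans (gC _) _; rewrite -mulrA ler_wpM2l//.
apply: le_trans (tau32 _) _; rewrite -exprMn lerXn2r ?nnegrE ?tau_ge0//.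
  by rewrite mulr_ge0 ?tau_ge0// mulr_ge0// addr_ge0 ?sqr_ge0.
exact: tau_shift_sqr.
Qed.

Let norm_part t h B : 0 <= t <= 1 -> `|h| <= B -> `|t * h| <= B.
Proof.
move=> /andP[t0 t1]; apply: le_trans.
by rewrite normrM (ger0_norm t0) ler_piMl.
Qed.

Lemma profile_diff1 B u h : `|h| <= B ->
  `|T (u + h) - T u| <= C * (2 * (1 + B ^+ 2)) ^+ 2 * `|h| * tau u ^+ 2.
Proof.
move=> hB; have [t t01] := mean_value u (u + h) Tk.
rewrite [u + h - u]addrAC subrr add0r => ->.
rewrite normrM mulrAC ler_wpM2r//; apply: bound_shift => //; exact: norm_part.
Qed.

(** The mean value theorem is applied first to T(. + h') - T and then to its derivative's increment
    of k; the resulting point is within 2 B of u. *)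
Lemma antiderivative_diff2 B u h h' : `|h| <= B -> `|h'| <= B ->
  `|(T (u + h + h') - T (u + h)) - (T (u + h') - T u)| <=
  C * (2 * (1 + (2 * B) ^+ 2)) ^+ 2 * (`|h| * `|h'|) * tau u ^+ 2.
Proof.
move=> hB h'B; have B0 : 0 <= B := le_trans (normr_ge0 _) hB.
have dsh (x a : R) : is_derive x 1 (fun y : R => T (y + a)) (k (x + a)).
  have dx : is_derive x 1 (fun y : R => y + a) 1.
    by apply: (is_derive_eq (is_deriveD (is_derive_id x 1) (is_derive_cst a x 1))); rewrite addr0.
  by apply: (is_derive_eq (@is_derive_compR _ T (fun y => y + a) _ _ _ (Tk (x + a)) dx)); rewrite mulr1.
have dg (x : R) : is_derive x 1 (fun y : R => T (y + h') - T y) (k (x + h') - k x).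
  exact: (is_deriveB (dsh x h') (Tk x)).
have [t t01] := mean_value u (u + h) dg.
rewrite [u + h - u]addrAC subrr add0r opprB addrA => E.
rewrite E; set x := u + t * h; have [t' t'01] := mean_value x (x + h') kdk.
rewrite [x + h' - x]addrAC subrr add0r => ->.
rewrite -mulrA normrM [h' * h]mulrC normrM [leRHS]mulrAC ler_wpM2r ?mulr_ge0//.
rewrite /x -addrA; apply: bound_shift => //.
apply: le_trans (ler_normD _ _) _; rewrite mulr_natl mulr2n.
by apply: lerD; exact: norm_part.
Qed.

(** The increment from u to 2 u has the unbounded length |u|, which is paid for by one power of tau;
    this is why the kernel is estimated with tau^3. *)
Lemma profile_double u : `|T (2 * u) - T u| <= C * tau u ^+ 2.
Proof.
have [t /andP[t0 t1]] := mean_value u (2 * u) Tk.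
have -> : 2 * u - u = u by ring.
move=> ->; rewrite normrM.
apply: (@le_trans _ _ (C * tau u ^+ 3 * `|u|)).
  rewrite ler_wpM2r//; apply: le_trans (kC _) _; rewrite ler_wpM2l//.
  rewrite lerXn2r ?nnegrE ?tau_ge0//; apply: tau_le.
  have := sqr_ge0 u; rewrite !expr2; nra.
rewrite -mulrA ler_wpM2l// exprSr -mulrA -[leRHS]mulr1 ler_wpM2l ?sqr_ge0//.
by rewrite mulrC mul_tau_le1.
Qed.

End profile.

Local Notation normc := Normc.normc.

Section complex_norm.
Context {R : realType}.
Implicit Types z w : R[i].

Lemma normc_le_ReIm z : normc z <= `|complex.Re z| + `|complex.Im z|.
Proof.
case: z => a c /=; rewrite -[leRHS]ger0_norm ?addr_ge0// -sqrtr_sqr ler_sqrt ?sqr_ge0//.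
rewrite sqrrD -[a ^+ 2]real_normK ?num_real// -[c ^+ 2]real_normK ?num_real//.
by rewrite addrAC lerDl mulrn_wge0// mulr_ge0.
Qed.

Lemma normr_Re_le z : `|complex.Re z| <= normc z.
Proof. by case: z => a c /=; rewrite -sqrtr_sqr ler_sqrt ?addr_ge0 ?sqr_ge0// lerDl sqr_ge0. Qed.

Lemma normr_Im_le z : `|complex.Im z| <= normc z.
Proof. by case: z => a c /=; rewrite -sqrtr_sqr ler_sqrt ?addr_ge0 ?sqr_ge0// lerDr sqr_ge0. Qed.

Lemma normc_ge0 z : 0 <= normc z.
Proof. exact: le_trans (normr_Re_le z). Qed.

Lemma normc_real (x : R) : normc x%:C = `|x|.
Proof. by rewrite /= expr0n addr0 sqrtr_sqr. Qed.

Lemma normcB z w : normc (z - w) <= normc z + normc w.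
Proof. by rewrite (le_trans (le_normcD _ _))// normcN. Qed.

Lemma normc_sum (I : Type) (r : seq I) (P : pred I) (F : I -> R[i]) :
  normc (\sum_(i <- r | P i) F i) <= \sum_(i <- r | P i) normc (F i).
Proof.
elim/big_ind2 : _ => [|x1 x2 y1 y2 h1 h2|//]; first by rewrite Normc.normc0.
by rewrite (le_trans (le_normcD _ _))// lerD.
Qed.

Lemma normc_prod (I : Type) (r : seq I) (P : pred I) (F : I -> R[i]) :
  normc (\prod_(i <- r | P i) F i) = \prod_(i <- r | P i) normc (F i).
Proof.
elim/big_ind2 : _ => [|x1 x2 y1 y2 <- <-|//]; first by rewrite Normc.normc1.
by rewrite Normc.normcM.
Qed.

Lemma normC_normc z : `|z| = (normc z)%:C.
Proof. by []. Qed.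

Lemma normc_expi (t : R) : normc (expi t) = 1.
Proof. by rewrite /= cos2Dsin2 sqrtr1. Qed.

Lemma complex_ReM z w : complex.Re (z * w) = complex.Re z * complex.Re w - complex.Im z * complex.Im w.
Proof. by case: z; case: w. Qed.

Lemma complex_ImM z w : complex.Im (z * w) = complex.Re z * complex.Im w + complex.Im z * complex.Re w.
Proof. by case: z => a c; case: w => a' c' /=; rewrite [c * _]mulrC addrC [a * _]mulrC [a' * c]mulrC addrC. Qed.

Lemma complex_ReD z w : complex.Re (z + w) = complex.Re z + complex.Re w.
Proof. by case: z; case: w. Qed.

Lemma complex_ImD z w : complex.Im (z + w) = complex.Im z + complex.Im w.
Proof. by case: z; case: w. Qed.

Lemma complex_ReN z : complex.Re (- z) = - complex.Re z. Proof. by case: z. Qed.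

Lemma complex_ImN z : complex.Im (- z) = - complex.Im z. Proof. by case: z. Qed.

End complex_norm.

(** * The kernel of the cutoff function *)

Section bump_of_smooth.
Context {R : realType}.

Lemma bumpseq_rpderiv (g : 'rV[R]_1 -> R) : rsmooth g ->
  (forall x : 'rV[R]_1, 3 / 2 < `|x 0 0| -> g x = 0) ->
  bumpseq (fun n x => rpderiv (nseq n 0) g (const_mx x)).
Proof.
move=> sg g0.
have d n (x : R) : is_derive x 1 (fun x : R => rpderiv (nseq n 0) g (const_mx x))
    (rpderiv (nseq n.+1 0) g (const_mx x)).
  have [_ /(_ (const_mx x) 0) dg] := sg (nseq n 0).
  have E : (fun h : R => h^-1 *: (((fun x : R => rpderiv (nseq n 0) g (const_mx x)) \o shift x) (h *: (1 : R))
        - rpderiv (nseq n 0) g (const_mx x))) =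
      (fun h => h^-1 *: ((rpderiv (nseq n 0) g \o shift (const_mx x)) (h *: delta_mx 0 0)
        - rpderiv (nseq n 0) g (const_mx x))).
    apply/funext => h /=; congr (_ *: (rpderiv _ _ _ - _)).
    by apply/matrixP => i j; rewrite !mxE !ord1 eqxx.
  apply: DeriveDef; first by rewrite /derivable E.
  by rewrite /= /derive E.
split => // n; elim: n => [|n IH] x x32; first by rewrite /= g0// mxE.
have [_ <-] := d n x.
rewrite (near_eq_derive (g := cst 0)); first by rewrite derive_cst.
apply/nbhs_ballP; exists (`|x| - 3 / 2); first by rewrite /= subr_gt0.
move=> y; rewrite /ball /= => xy; apply: IH.
by have := ler_normD (x - y) y; rewrite subrK; lra.
Qed.

End bump_of_smooth.

Section complex_integral.
Context {R : realType} d (T : measurableType d) (mu : {measure set T -> \bar R}).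

Definition cint (f : T -> R[i]) : R[i] :=
  (\int[mu]_x complex.Re (f x)) +i* (\int[mu]_x complex.Im (f x)).

End complex_integral.

Section kernel.
Context {R : realType} (phi0 : R -> R[i]).
Hypothesis hphi0 : lp_cutoff phi0.
Local Notation mu := (@lebesgue_measure R).

(* [F^-1 phi0] up to the factor sqrt(2 pi) of the unitary normalization. *)
Definition ker0 (u : R) : R[i] :=
  ((2 * pi)^-1)%:C * cint mu (fun xi => phi0 xi * expi (u * xi)).

Let fr n x := rpderiv (nseq n 0) (fun y : 'rV[R]_1 => complex.Re (phi0 (y 0 0))) (const_mx x).
Let fi n x := rpderiv (nseq n 0) (fun y : 'rV[R]_1 => complex.Im (phi0 (y 0 0))) (const_mx x).

Let bfr : bumpseq fr.
Proof.
case: hphi0 => [[[sm _] _] _ h0]; apply: (bumpseq_rpderiv sm) => x x32.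
exact: (congr1 (@complex.Re R) (h0 _ x32)).
Qed.

Let bfi : bumpseq fi.
Proof.
case: hphi0 => [[[_ sm] _] _ h0]; apply: (bumpseq_rpderiv sm) => x x32.
exact: (congr1 (@complex.Im R) (h0 _ x32)).
Qed.

Let fr0 x : fr 0 x = complex.Re (phi0 x). Proof. by rewrite /fr /= mxE. Qed.
Let fi0 x : fi 0 x = complex.Im (phi0 x). Proof. by rewrite /fi /= mxE. Qed.

Lemma cutoff_continuous : continuous (fun x => complex.Re (phi0 x)) /\
  continuous (fun x => complex.Im (phi0 x)).
Proof.
split.
  by rewrite (_ : (fun _ => _) = fr 0); [exact: bumpseq_continuous|apply/funext => x; rewrite fr0].
by rewrite (_ : (fun _ => _) = fi 0); [exact: bumpseq_continuous|apply/funext => x; rewrite fi0].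
Qed.

Let c2 : R := (2 * pi)^-1.

Let c2_gt0 : 0 < c2. Proof. by rewrite invr_gt0 mulr_gt0// pi_gt0. Qed.

Let support_itv (g : R -> R) : (forall x, 3 / 2 < `|x| -> g x = 0) ->
  \int[mu]_x g x = \int[mu]_(x in `[-2, 2]) g x.
Proof.
move=> g0; rewrite [RHS]Rintegral_mkcond; apply: eq_Rintegral => x _.
rewrite patchE; case: ifPn => // /negP; rewrite inE /= in_itv /= => xn.
apply: g0; rewrite ltNge ler_norml; apply/negP => /andP[h1 h2]; apply: xn.
by apply/andP; split; lra.
Qed.

Let cFr n : continuous (fr n). Proof. exact: bumpseq_continuous. Qed.
Let cFi n : continuous (fi n). Proof. exact: bumpseq_continuous. Qed.

Let phi0_0 x : 3 / 2 < `|x| -> phi0 x = 0.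
Proof. by case: hphi0 => _ _; apply. Qed.

Lemma Re_ker0 u : complex.Re (ker0 u) = c2 * (fcos (fr 0) u - fsin (fi 0) u).
Proof.
rewrite /ker0 complex_ReM /= mul0r subr0; congr (_ * _).
rewrite support_itv; last by move=> x /phi0_0 ->; rewrite mul0r.
rewrite /fcos /fsin -RintegralB//.
- by apply: eq_Rintegral => x _; rewrite complex_ReM fr0 fi0.
- by apply: continuous_itv_integrable; apply: continuousMr => //; exact: continuous_cosM.
- by apply: continuous_itv_integrable; apply: continuousMr => //; exact: continuous_sinM.
Qed.

Lemma Im_ker0 u : complex.Im (ker0 u) = c2 * (fsin (fr 0) u + fcos (fi 0) u).
Proof.
rewrite /ker0 complex_ImM /= mul0r addr0; congr (_ * _).
rewrite support_itv; last by move=> x /phi0_0 ->; rewrite mul0r.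
rewrite /fcos /fsin -RintegralD//.
- by apply: eq_Rintegral => x _; rewrite complex_ImM fr0 fi0.
- by apply: continuous_itv_integrable; apply: continuousMr => //; exact: continuous_sinM.
- by apply: continuous_itv_integrable; apply: continuousMr => //; exact: continuous_cosM.
Qed.

Let gr := (fun n x => x * fr n x + n%:R * fr n.-1 x).
Let gi := (fun n x => x * fi n x + n%:R * fi n.-1 x).

Let kr u := c2 * (fcos (fr 0) u - fsin (fi 0) u).
Let ki u := c2 * (fsin (fr 0) u + fcos (fi 0) u).
Let dkr u := c2 * (- fsin (gr 0) u - fcos (gi 0) u).
Let dki u := c2 * (fcos (gr 0) u - fsin (gi 0) u).

Let gr0 : gr 0 = (fun x => x * fr 0 x).
Proof. by apply/funext => x; rewrite /gr mul0r addr0. Qed.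
Let gi0 : gi 0 = (fun x => x * fi 0 x).
Proof. by apply/funext => x; rewrite /gi mul0r addr0. Qed.

Let dkrP (u : R) : is_derive u 1 kr (dkr u).
Proof.
apply: is_derive_cstM; rewrite gr0 gi0.
have d1 := is_derive_fcos (f := fr 0) u (@cFr 0%N).
have d2 := is_derive_fsin (f := fi 0) u (@cFi 0%N).
exact: (is_deriveB d1 d2).
Qed.

Let dkiP (u : R) : is_derive u 1 ki (dki u).
Proof.
apply: is_derive_cstM; rewrite gr0 gi0.
have d1 := is_derive_fsin (f := fr 0) u (@cFr 0%N).
have d2 := is_derive_fcos (f := fi 0) u (@cFi 0%N).
exact: (is_deriveD d1 d2).
Qed.

Lemma ker0_continuous : continuous (fun u => complex.Re (ker0 u)) /\
  continuous (fun u => complex.Im (ker0 u)).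
Proof.
split.
  rewrite (_ : (fun _ => _) = kr); last by apply/funext => u; exact: Re_ker0.
  exact: is_derive_continuous dkrP.
rewrite (_ : (fun _ => _) = ki); last by apply/funext => u; exact: Im_ker0.
exact: is_derive_continuous dkiP.
Qed.

Let decay : exists2 C, 0 <= C & forall u,
  [/\ `|kr u| <= C * tau u ^+ 3, `|ki u| <= C * tau u ^+ 3,
      `|dkr u| <= C * tau u ^+ 3 & `|dki u| <= C * tau u ^+ 3].
Proof.
have [C1 C10 H1] := fourier_decay bfr; have [C2 C20 H2] := fourier_decay bfi.
have [C3 C30 H3] := fourier_decay (bumpseq_mulX bfr).
have [C4 C40 H4] := fourier_decay (bumpseq_mulX bfi).
exists (c2 * (C1 + C2 + C3 + C4)) => [|u].
  by rewrite mulr_ge0 ?addr_ge0// ltW.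
have t0 : 0 <= tau u ^+ 3 by rewrite exprn_ge0 ?tau_ge0.
have [a1 b1] := H1 u; have [a2 b2] := H2 u; have [a3 b3] := H3 u; have [a4 b4] := H4 u.
have D x y Cx Cy : `|x| <= Cx * tau u ^+ 3 -> `|y| <= Cy * tau u ^+ 3 -> Cx + Cy <= C1 + C2 + C3 + C4 ->
    `|c2 * (x + y)| <= c2 * (C1 + C2 + C3 + C4) * tau u ^+ 3.
  move=> xC yC CC; rewrite normrM (ger0_norm (ltW c2_gt0)) -mulrA ler_wpM2l ?(ltW c2_gt0)//.
  apply: le_trans (ler_normD _ _) _; apply: le_trans (lerD xC yC) _.
  by rewrite -mulrDl ler_wpM2r.
rewrite /kr /ki /dkr /dki; split.
- by apply: (D _ _ C1 C2) => //; [rewrite normrN|lra].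
- by apply: (D _ _ C1 C2) => //; lra.
- by apply: (D _ _ C3 C4) => //; [rewrite normrN|rewrite normrN|lra].
- by apply: (D _ _ C3 C4) => //; [rewrite normrN|lra].
Qed.

(** Real and imaginary parts of [Th] are antiderivatives of those of [ker0]; passing from the two
    parts to the modulus doubles the constant. *)
Lemma profile_exists : exists (Th : R -> R[i]) (C : R), [/\ 0 <= C,
  forall u : R, is_derive u 1 (fun x => complex.Re (Th x)) (complex.Re (ker0 u)) /\
     is_derive u 1 (fun x => complex.Im (Th x)) (complex.Im (ker0 u)),
  forall u, normc (ker0 u) <= C * tau u ^+ 3,
  forall u, normc (Th (2 * u) - Th u) <= C * tau u ^+ 2 &
  forall B u h h', `|h| <= B -> `|h'| <= B ->
    normc (Th (u + h) - Th u) <= C * (2 * (1 + B ^+ 2)) ^+ 2 * `|h| * tau u ^+ 2 /\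
    normc ((Th (u + h + h') - Th (u + h)) - (Th (u + h') - Th u)) <=
     C * (2 * (1 + (2 * B) ^+ 2)) ^+ 2 * (`|h| * `|h'|) * tau u ^+ 2].
Proof.
have [C C0 H] := decay.
have t31 (u : R) : tau u ^+ 3 <= tau u.
  by rewrite -[leRHS]expr1 ler_wiXn2l ?tau_ge0 ?tau_le1.
have [Tr TrP] : exists T : R -> R, forall u : R, is_derive u 1 T (kr u).
  apply: (@antiderivative_exists _ _ C); first exact: is_derive_continuous dkrP.
  by move=> u; have [h _ _ _] := H u; rewrite (le_trans h)// ler_wpM2l.
have [Ti TiP] : exists T : R -> R, forall u : R, is_derive u 1 T (ki u).
  apply: (@antiderivative_exists _ _ C); first exact: is_derive_continuous dkiP.
  by move=> u; have [_ h _ _] := H u; rewrite (le_trans h)// ler_wpM2l.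
have Hkr u : `|kr u| <= C * tau u ^+ 3 by have [] := H u.
have Hki u : `|ki u| <= C * tau u ^+ 3 by have [] := H u.
have Hdkr u : `|dkr u| <= C * tau u ^+ 3 by have [] := H u.
have Hdki u : `|dki u| <= C * tau u ^+ 3 by have [] := H u.
have two (z : R[i]) (a : R) : `|complex.Re z| <= a -> `|complex.Im z| <= a -> normc z <= 2 * a.
  by move=> h1 h2; rewrite (le_trans (normc_le_ReIm z))// mulr_natl mulr2n lerD.
exists (fun u => Tr u +i* Ti u), (2 * C); split.
- by rewrite mulr_ge0.
- by move=> u; rewrite Re_ker0 Im_ker0; split; [exact: TrP|exact: TiP].
- by move=> u; rewrite -mulrA two// ?Re_ker0 ?Im_ker0; [exact: Hkr|exact: Hki].
- by move=> u; rewrite -mulrA two//=; [exact: (profile_double TrP)|exact: (profile_double TiP)].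
- move=> B u h h' hB h'B; split.
    rewrite [leRHS](_ : _ = 2 * (C * (2 * (1 + B ^+ 2)) ^+ 2 * `|h| * tau u ^+ 2)); last by ring.
    by apply: two; [exact: (profile_diff1 TrP)|exact: (profile_diff1 TiP)].
  rewrite [leRHS](_ : _ = 2 * (C * (2 * (1 + (2 * B) ^+ 2)) ^+ 2 * (`|h| * `|h'|) * tau u ^+ 2)); last by ring.
  by apply: two; [exact: (antiderivative_diff2 TrP dkrP)|exact: (antiderivative_diff2 TiP dkiP)].
Qed.

End kernel.

(** * Dyadic kernels and their weighted bounds *)

Section dyadic_profile.
Context {R : realType}.
Variables (Th ker : R -> R[i]) (K B : R).
Hypotheses (K0 : 0 <= K) (B1 : 1 <= B)
  (Th2 : forall u, normc (Th (2 * u) - Th u) <= K * tau u ^+ 2)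
  (ThD1 : forall u h, `|h| <= B -> normc (Th (u + h) - Th u) <= K * `|h| * tau u ^+ 2)
  (ThD2 : forall u h h', `|h| <= B -> `|h'| <= B ->
    normc ((Th (u + h + h') - Th (u + h)) - (Th (u + h') - Th u)) <=
      K * (`|h| * `|h'|) * tau u ^+ 2)
  (kerK : forall u, normc (ker u) <= K * tau u ^+ 3).
Implicit Types (x z u h : R).

(** The convolution kernel of the k-th dyadic piece (see [piece_cint]): like the piece, a difference
    of two dilates. *)
Definition kerk k u : R[i] := if k is k'.+1
  then (2 ^+ k)%:C * ker (2 ^+ k * u) - (2 ^+ k')%:C * ker (2 ^+ k' * u) else ker u.

(** The antiderivative of [kerk]. For k >= 1 the difference of dilates of [Th] decays at infinity,
    which [Th] itself need not do. *)
Definition Thk k u : R[i] :=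
  if k is k'.+1 then Th (2 ^+ k * u) - Th (2 ^+ k' * u) else Th u.

(* [gk k x z] carries all of the dependence on the net point z, and [ck] the
   boundary term at x = 1; at k = 0 nothing is gained by splitting that off. *)
Definition gk k x z : R[i] := Thk k (x - z) - (if k is k'.+1 then 0 else Th (x - 1)).

Definition ck k x : R[i] := if k is k'.+1 then - Thk k (x - 1) else 0.

Lemma gk_ck k x z : gk k x z + ck k x = Thk k (x - z) - Thk k (x - 1).
Proof. by case: k => [|k]; rewrite /gk /ck /= ?subr0 ?addr0. Qed.

Lemma expr2_ge1 k : 1 <= 2 ^+ k :> R. Proof. by rewrite exprn_ege1// ler1n. Qed.
Lemma tau_half k u : tau (2 ^+ k * u) <= 4 * tau (2 ^+ k.+1 * u).
Proof.
rewrite exprS -mulrA; move: (2 ^+ k * u) => t.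
rewrite /tau ler_pdivlMr ?tauV_gt0// mulrC ler_pdivrMr ?tauV_gt0//.
by have := sqr_ge0 t; rewrite !expr2; nra.
Qed.

Lemma tau_half_sqr k u : tau (2 ^+ k * u) ^+ 2 <= 16 * tau (2 ^+ k.+1 * u) ^+ 2.
Proof.
rewrite (_ : 16 = 4 ^+ 2); last by rewrite -natrX.
by rewrite -exprMn lerXn2r ?nnegrE ?mulr_ge0 ?tau_ge0 ?tau_half.
Qed.

(** For z in [0, 1] the weight satisfies 1 + x^2 <= 4 (1 + (x - z)^2), and dilation only decreases
    tau. *)
Lemma weight_tau k x z : 0 <= z <= 1 ->
  (1 + x ^+ 2) * tau (2 ^+ k * (x - z)) <= 4.
Proof.
move=> /andP[z0 z1]; rewrite mulrC /tau mulrC ler_pdivrMr ?tauV_gt0//.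
apply: (@le_trans _ _ (4 * (1 + (x - z) ^+ 2))); last first.
  rewrite ler_wpM2l// lerD2l exprMn ler_peMl ?sqr_ge0// exprn_ege1//.
  exact: expr2_ge1.
have z2 : z * z <= 1 by rewrite -[leRHS]mulr1 ler_pM.
by have := sqr_ge0 (3 * x - 4 * z); rewrite !expr2; nra.
Qed.

Lemma weight_tau_sqr k x z : 0 <= z <= 1 ->
  (1 + x ^+ 2) * tau (2 ^+ k * (x - z)) ^+ 2 <= 4 * tau (2 ^+ k * (x - z)).
Proof. by move=> z01; rewrite expr2 mulrA ler_wpM2r ?tau_ge0// weight_tau. Qed.

Let w0 x : 0 <= 1 + x ^+ 2. Proof. exact/ltW/tauV_gt0. Qed.

(** One power of tau pays for the weight 1 + x^2, the other one keeps the localization around z. *)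
Let weighted k x z (v : R[i]) a : 0 <= a -> 0 <= z <= 1 ->
  normc v <= a * tau (2 ^+ k * (x - z)) ^+ 2 ->
  (1 + x ^+ 2) * normc v <= 4 * a * tau (2 ^+ k * (x - z)).
Proof.
move=> a0 z01 va; apply: le_trans (ler_wpM2l (w0 x) va) _.
by rewrite mulrCA [4 * a]mulrC -mulrA ler_wpM2l// weight_tau_sqr.
Qed.

Lemma Thk_bound k u : normc (Thk k.+1 u) <= 16 * K * tau (2 ^+ k.+1 * u) ^+ 2.
Proof.
rewrite /Thk exprS -mulrA; apply: le_trans (Th2 _) _.
rewrite [16 * K]mulrC -mulrA ler_wpM2l//.
by have := tau_half_sqr k u; rewrite (exprS (2 : R) k) -mulrA.
Qed.

(** 17 = 1 + 16: the finer dilate, plus the coarser one, whose tau^2 is at most 16 times the finer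
    tau^2. *)
Lemma Thk_diff1 k u h : 2 ^+ k * `|h| <= B ->
  normc (Thk k (u + h) - Thk k u) <= 17 * K * (2 ^+ k * `|h|) * tau (2 ^+ k * u) ^+ 2.
Proof.
have nM m : `|2 ^+ m * h| = 2 ^+ m * `|h| by rewrite normrM ger0_norm// exprn_ge0.
case: k => [|k] hB.
  rewrite /Thk expr0 !mul1r; have := ThD1 u; rewrite expr0 mul1r in hB => /(_ _ hB) H.
  by apply: le_trans H _; rewrite -!mulrA ler_peMl ?ler1n ?mulr_ge0 ?tau_ge0.
have hB' : 2 ^+ k * `|h| <= B.
  by apply: le_trans hB; rewrite ler_wpM2r// ler_weXn2l// ler1n.
rewrite /Thk !mulrDr (_ : _ - _ - _ = (Th (2 ^+ k.+1 * u + 2 ^+ k.+1 * h) - Th (2 ^+ k.+1 * u)) -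
  (Th (2 ^+ k * u + 2 ^+ k * h) - Th (2 ^+ k * u))); last by ring.
apply: le_trans (normcB _ _) _.
have H1 := ThD1 (2 ^+ k.+1 * u) (h := 2 ^+ k.+1 * h).
have H2 := ThD1 (2 ^+ k * u) (h := 2 ^+ k * h).
apply: le_trans (lerD (H1 _) (H2 _)) _; rewrite ?nM//.
rewrite [leRHS](_ : _ = K * (2 ^+ k.+1 * `|h|) * tau (2 ^+ k.+1 * u) ^+ 2 +
  K * (2 ^+ k.+1 * `|h|) * (16 * tau (2 ^+ k.+1 * u) ^+ 2)); last by ring.
rewrite lerD2l; apply: ler_pM; rewrite ?tau_half_sqr ?sqr_ge0 ?mulr_ge0 ?exprn_ge0//.
by rewrite ler_wpM2l// ler_wpM2r// ler_weXn2l// ler1n.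
Qed.

Lemma Thk_diff2 k u h h' : 2 ^+ k * `|h| <= B -> 2 ^+ k * `|h'| <= B ->
  normc ((Thk k (u + h + h') - Thk k (u + h)) - (Thk k (u + h') - Thk k u)) <=
    17 * K * (2 ^+ k * `|h| * (2 ^+ k * `|h'|)) * tau (2 ^+ k * u) ^+ 2.
Proof.
have nM m a : `|2 ^+ m * a| = 2 ^+ m * `|a| by rewrite normrM ger0_norm// exprn_ge0.
case: k => [|k] hB h'B.
  rewrite /Thk expr0 !mul1r; rewrite expr0 mul1r in hB; rewrite expr0 mul1r in h'B.
  have := ThD2 u hB h'B => H.
  by apply: le_trans H _; rewrite -!mulrA ler_peMl ?ler1n ?mulr_ge0 ?tau_ge0.
have up a : 2 ^+ k.+1 * `|a| <= B -> 2 ^+ k * `|a| <= B.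
  by apply: le_trans; rewrite ler_wpM2r// ler_weXn2l// ler1n.
rewrite /Thk !mulrDr.
set a := 2 ^+ k.+1 * u; set a1 := 2 ^+ k.+1 * h; set a2 := 2 ^+ k.+1 * h'.
set c := 2 ^+ k * u; set c1 := 2 ^+ k * h; set c2 := 2 ^+ k * h'.
rewrite (_ : _ - _ - _ = ((Th (a + a1 + a2) - Th (a + a1)) - (Th (a + a2) - Th a)) -
  ((Th (c + c1 + c2) - Th (c + c1)) - (Th (c + c2) - Th c))); last by ring.
apply: le_trans (normcB _ _) _.
have H1 := @ThD2 a a1 a2; have H2 := @ThD2 c c1 c2.
apply: le_trans (lerD (H1 _ _) (H2 _ _)) _; rewrite ?nM ?up//.
rewrite [leRHS](_ : _ = K * (2 ^+ k.+1 * `|h| * (2 ^+ k.+1 * `|h'|)) * tau a ^+ 2 +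
  K * (2 ^+ k.+1 * `|h| * (2 ^+ k.+1 * `|h'|)) * (16 * tau a ^+ 2)); last by ring.
have k2 : 2 ^+ k <= 2 ^+ k.+1 :> R by rewrite ler_weXn2l// ler1n.
have p2 m : 0 <= 2 ^+ m :> R by rewrite exprn_ge0.
rewrite lerD2l; apply: ler_pM; rewrite ?tau_half_sqr ?sqr_ge0 ?mulr_ge0//.
by rewrite ler_wpM2l//; apply: ler_pM; rewrite ?mulr_ge0 ?ler_wpM2r.
Qed.

(** 4 from the weight times 17 from the differences; this also exceeds 4 * 16, the bound without
    differences. *)
Definition cst_k : R := 68 * K.

Lemma cst_k_ge0 : 0 <= cst_k. Proof. by rewrite mulr_ge0. Qed.

Lemma ck_bound k x : (1 + x ^+ 2) * normc (ck k x) <= cst_k * tau (2 ^+ k * (x - 1)).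
Proof.
case: k => [|k]; rewrite /ck; first by rewrite Normc.normc0 mulr0 mulr_ge0 ?cst_k_ge0 ?tau_ge0.
rewrite normcN; apply: (@le_trans _ _ (4 * (16 * K) * tau (2 ^+ k.+1 * (x - 1)))).
  by apply: weighted; rewrite ?mulr_ge0 ?ler01 ?lexx// Thk_bound.
by rewrite ler_wpM2r ?tau_ge0// /cst_k mulrA ler_wpM2r// -natrM ler_nat.
Qed.

Lemma gk_bound k x z : 0 <= z <= 1 ->
  (1 + x ^+ 2) * normc (gk k x z) <= cst_k * tau (2 ^+ k * (x - z)).
Proof.
move=> z01; case: k => [|k]; rewrite /gk.
  (* At k = 0 the decay comes from the subtracted [Th (x - 1)]: what remains is an increment of [Th]
     over a step z - 1 of length at most 1 <= B. *)
  apply: (@le_trans _ _ (4 * K * tau (2 ^+ 0 * (x - z)))).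
    apply: weighted => //; rewrite /Thk -normcN opprB expr0 mul1r.
    have -> : x - 1 = (x - z) + (z - 1) by ring.
    have z1 : `|z - 1| <= 1 by case/andP: z01; rewrite ler_norml; lra.
    apply: le_trans (ThD1 _ (le_trans z1 B1)) _.
    by rewrite ler_wpM2r ?sqr_ge0// ler_piMr.
  by rewrite ler_wpM2r ?tau_ge0// /cst_k ler_wpM2r// ler_nat.
rewrite subr0; apply: (@le_trans _ _ (4 * (16 * K) * tau (2 ^+ k.+1 * (x - z)))).
  by apply: weighted; rewrite ?mulr_ge0// Thk_bound.
by rewrite ler_wpM2r ?tau_ge0// /cst_k mulrA ler_wpM2r// -natrM ler_nat.
Qed.

Lemma gk_diff1 k x z z' : 0 <= z <= 1 -> 2 ^+ k * `|z - z'| <= B ->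
  (1 + x ^+ 2) * normc (gk k x z - gk k x z') <=
    cst_k * (2 ^+ k * `|z - z'|) * tau (2 ^+ k * (x - z)).
Proof.
move=> z01 zB; rewrite /gk opprB addrA subrK -normcN opprB.
have -> : x - z' = x - z + (z - z') by ring.
rewrite (_ : cst_k * _ = 4 * (17 * K * (2 ^+ k * `|z - z'|))); last by rewrite /cst_k; ring.
by apply: weighted; [rewrite !mulr_ge0// exprn_ge0|done|exact: Thk_diff1].
Qed.

Lemma gk_diff2 k x z z1 z2 z3 : 0 <= z <= 1 -> z - z1 = z2 - z3 ->
  2 ^+ k * `|z - z1| <= B -> 2 ^+ k * `|z - z2| <= B ->
  (1 + x ^+ 2) * normc ((gk k x z - gk k x z1) - (gk k x z2 - gk k x z3)) <=
    cst_k * (2 ^+ k * `|z - z1| * (2 ^+ k * `|z - z2|)) * tau (2 ^+ k * (x - z)).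
Proof.
move=> z01 zz h1 h2; rewrite /gk.
have -> : x - z1 = x - z + (z - z1) by ring.
have -> : x - z2 = x - z + (z - z2) by ring.
have -> : x - z3 = x - z + (z - z1) + (z - z2) by rewrite zz; ring.
set u := x - z; set a := z - z1; set c := z - z2; set q := (if _ is _.+1 then _ else _).
rewrite (_ : _ - _ - _ = (Thk k (u + a + c) - Thk k (u + a)) - (Thk k (u + c) - Thk k u)); last by ring.
rewrite (_ : cst_k * _ = 4 * (17 * K * (2 ^+ k * `|a| * (2 ^+ k * `|c|)))); last by rewrite /cst_k; ring.
by apply: weighted; [rewrite !mulr_ge0// exprn_ge0|done|exact: Thk_diff2].
Qed.

Lemma kerk_bound k u : normc (kerk k u) <= 2 * K * 2 ^+ k * tau u.
Proof.
have b m : normc ((2 ^+ m)%:C * ker (2 ^+ m * u)) <= K * 2 ^+ m * tau u.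
  rewrite Normc.normcM normc_real ger0_norm ?exprn_ge0//.
  rewrite [leRHS](_ : _ = 2 ^+ m * (K * tau u)); last by ring.
  rewrite ler_wpM2l ?exprn_ge0//.
  apply: le_trans (kerK _) _; rewrite ler_wpM2l//.
  apply: (@le_trans _ _ (tau (2 ^+ m * u))).
    by rewrite -[leRHS]expr1 ler_wiXn2l ?tau_ge0 ?tau_le1.
  by apply: tau_le; rewrite exprMn ler_peMl ?sqr_ge0// exprn_ege1// expr2_ge1.
have p0 m : 0 <= K * 2 ^+ m * tau u by rewrite !mulr_ge0 ?tau_ge0 ?exprn_ge0.
case: k => [|k].
  have := b 0%N; rewrite /= expr0 !mul1r => h; apply: le_trans h _.
  by rewrite !mulr1 -mulrA ler_peMl ?ler1n ?mulr_ge0 ?tau_ge0.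
rewrite /kerk; apply: le_trans (normcB _ _) _; apply: le_trans (lerD (b _) (b _)) _.
rewrite [leRHS](_ : _ = K * 2 ^+ k.+1 * tau u + K * 2 ^+ k.+1 * tau u); last by ring.
rewrite lerD2l ler_wpM2r ?tau_ge0// ler_wpM2l//.
by rewrite ler_weXn2l// ler1n.
Qed.

Lemma weight_kerk k x z : 0 <= z <= 1 ->
  (1 + x ^+ 2) * normc (kerk k (x - z)) <= 8 * K * 2 ^+ k.
Proof.
move=> z01; apply: le_trans (ler_wpM2l (w0 x) (kerk_bound k _)) _.
have := weight_tau 0 x z01; rewrite expr0 mul1r => H.
rewrite mulrCA [leRHS](_ : _ = 2 * K * 2 ^+ k * 4); last by ring.
by rewrite ler_wpM2l ?mulr_ge0 ?exprn_ge0.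
Qed.

End dyadic_profile.

(** * Complex integrals *)

Section complex_integration.
Context {R : realType} {d : measure_display} {T : measurableType d}.
Variable mu : {measure set T -> \bar R}.
Implicit Types (f g : T -> R[i]) (a : R[i]).

Definition cmeas f := measurable_fun setT (fun x => complex.Re (f x)) /\
  measurable_fun setT (fun x => complex.Im (f x)).

Definition cintg f := mu.-integrable setT (EFin \o (fun x => complex.Re (f x))) /\
  mu.-integrable setT (EFin \o (fun x => complex.Im (f x))).

Lemma cintg_meas f : cintg f -> cmeas f.
Proof. by case=> /integrableP[/measurable_EFinP ? _] /integrableP[/measurable_EFinP ? _]. Qed.

Lemma cmeasM f g : cmeas f -> cmeas g -> cmeas (fun x => f x * g x).
Proof.
move=> [f1 f2] [g1 g2]; split.
  by under eq_fun do rewrite complex_ReM; apply: measurable_funB; exact: measurable_funM.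
by under eq_fun do rewrite complex_ImM; apply: measurable_funD; exact: measurable_funM.
Qed.

Lemma cmeas_cst a : cmeas (fun _ => a).
Proof. by split; exact: measurable_cst. Qed.

Lemma cmeas_real (r : T -> R) : measurable_fun setT r -> cmeas (fun x => (r x)%:C).
Proof. by move=> mr; split => //=; exact: measurable_cst. Qed.

Lemma cmeas_prod (I : Type) (s : seq I) (P : pred I) (F : I -> T -> R[i]) :
  (forall i, cmeas (F i)) -> cmeas (fun x => \prod_(i <- s | P i) F i x).
Proof.
move=> mF; elim: s => [|i s IH].
  by under eq_fun do rewrite big_nil; exact: cmeas_cst.
under eq_fun do rewrite big_cons; case: (P i) => //.
exact: cmeasM.
Qed.

Lemma measurable_normc f : cmeas f -> measurable_fun setT (fun x => normc (f x)).
Proof.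
move=> [f1 f2].
rewrite (_ : (fun _ => _) = (@Num.sqrt R) \o (fun x => complex.Re (f x) ^+ 2 + complex.Im (f x) ^+ 2)).
  apply: measurableT_comp.
    by apply: continuous_measurable_fun; exact: sqrt_continuous.
  by apply: measurable_funD; apply: measurable_funX.
by apply/funext => x /=; case: (f x).
Qed.

Lemma cintg_dom f (g : T -> R) : cmeas f -> mu.-integrable setT (EFin \o g) ->
  (forall x, normc (f x) <= g x) -> cintg f.
Proof.
move=> [f1 f2] ig fg; split.
  apply: (le_integrable measurableT _ _ ig); first exact/measurable_EFinP.
  move=> x _; rewrite /= lee_fin (le_trans (normr_Re_le _))// (le_trans (fg x))//.
  exact: ler_norm.
apply: (le_integrable measurableT _ _ ig); first exact/measurable_EFinP.
move=> x _; rewrite /= lee_fin (le_trans (normr_Im_le _))// (le_trans (fg x))//.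
exact: ler_norm.
Qed.

Lemma cintgD f g : cintg f -> cintg g -> cintg (fun x => f x + g x).
Proof.
move=> [f1 f2] [g1 g2]; split.
  rewrite (_ : _ \o _ = (EFin \o (fun x => complex.Re (f x))) \+ (EFin \o (fun x => complex.Re (g x))))%E.
    exact: integrableD.
  by apply/funext => x /=; rewrite complex_ReD EFinD.
rewrite (_ : _ \o _ = (EFin \o (fun x => complex.Im (f x))) \+ (EFin \o (fun x => complex.Im (g x))))%E.
  exact: integrableD.
by apply/funext => x /=; rewrite complex_ImD EFinD.
Qed.

Lemma cintgZ a f : cintg f -> cintg (fun x => a * f x).
Proof.
case=> f1 f2.
have Z (r : R) (h : T -> R) : mu.-integrable setT (EFin \o h) ->
    mu.-integrable setT (EFin \o (fun x => r * h x)).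
  by move=> ih; have := integrableZl measurableT r ih; apply: eq_integrable.
split.
  rewrite (_ : _ \o _ = (EFin \o (fun x => complex.Re a * complex.Re (f x))%R) \-
     (EFin \o (fun x => complex.Im a * complex.Im (f x))%R))%E.
    by apply: integrableB => //; exact: Z.
  by apply/funext => x /=; rewrite complex_ReM EFinB.
rewrite (_ : _ \o _ = (EFin \o (fun x => complex.Re a * complex.Im (f x))%R) \+
   (EFin \o (fun x => complex.Im a * complex.Re (f x))%R))%E.
  by apply: integrableD => //; exact: Z.
by apply/funext => x /=; rewrite complex_ImM EFinD.
Qed.

Lemma cintg0 : cintg (fun=> 0).
Proof. by split; exact: integrable0. Qed.

Lemma cintg_sum (I : Type) (s : seq I) (P : pred I) (F : I -> T -> R[i]) :
  (forall i, cintg (F i)) -> cintg (fun x => \sum_(i <- s | P i) F i x).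
Proof.
move=> mF; elim: s => [|i s IH].
  by under eq_fun do rewrite big_nil; exact: cintg0.
under eq_fun do rewrite big_cons; case: (P i) => //.
exact: cintgD.
Qed.

Lemma eq_cint f g : (forall x, f x = g x) -> cint mu f = cint mu g.
Proof. by move=> fg; congr cint; apply/funext. Qed.

Lemma cintD f g : cintg f -> cintg g ->
  cint mu (fun x => f x + g x) = cint mu f + cint mu g.
Proof.
move=> [f1 f2] [g1 g2]; rewrite /cint.
under eq_Rintegral do rewrite complex_ReD.
under [X in _ +i* X]eq_Rintegral do rewrite complex_ImD.
by rewrite !RintegralD.
Qed.

Lemma cintZ a f : cintg f -> cint mu (fun x => a * f x) = a * cint mu f.
Proof.
move=> [f1 f2]; rewrite /cint.
have Z (r : R) (h : T -> R) : mu.-integrable setT (EFin \o h) ->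
    mu.-integrable setT (EFin \o (fun x => r * h x)).
  by move=> ih; have := integrableZl measurableT r ih; apply: eq_integrable.
under eq_Rintegral do rewrite complex_ReM.
under [X in _ +i* X]eq_Rintegral do rewrite complex_ImM.
rewrite RintegralB//; [|exact: Z..]; rewrite RintegralD//; [|exact: Z..].
rewrite !RintegralZl//.
apply/eqP; rewrite eq_complex complex_ReM complex_ImM /= !eqxx//.
Qed.

Lemma cint0 : cint mu (fun=> 0) = 0.
Proof. by rewrite /cint /= /Rintegral integral0. Qed.

Lemma cintB f g : cintg f -> cintg g ->
  cint mu (fun x => f x - g x) = cint mu f - cint mu g.
Proof.
move=> fi gi; under eq_cint do rewrite -mulN1r.
by rewrite cintD ?cintZ ?mulN1r//; exact: cintgZ.
Qed.

Lemma cint_sum (I : Type) (s : seq I) (P : pred I) (F : I -> T -> R[i]) :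
  (forall i, cintg (F i)) ->
  cint mu (fun x => \sum_(i <- s | P i) F i x) = \sum_(i <- s | P i) cint mu (F i).
Proof.
move=> mF; elim: s => [|i s IH].
  by rewrite big_nil; under eq_cint do rewrite big_nil; exact: cint0.
rewrite big_cons; under eq_cint do rewrite big_cons; case: (P i) => //.
by rewrite cintD ?IH//; exact: cintg_sum.
Qed.

(** The factor 2 stems from bounding the real and the imaginary part separately. *)
Lemma normc_cint f (g : T -> R) : cmeas f -> mu.-integrable setT (EFin \o g) ->
  (forall x, normc (f x) <= g x) -> normc (cint mu f) <= 2 * \int[mu]_x g x.
Proof.
move=> mf ig fg; have [f1 f2] := cintg_dom mf ig fg.
rewrite (le_trans (normc_le_ReIm _))// mulr_natl mulr2n; apply: lerD => /=.
  apply: le_trans (le_normr_Rintegral measurableT f1) _.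
  apply: le_Rintegral => //; first exact: (integrable_norm f1).
  by move=> x _; rewrite (le_trans (normr_Re_le _)).
apply: le_trans (le_normr_Rintegral measurableT f2) _.
apply: le_Rintegral => //; first exact: (integrable_norm f2).
by move=> x _; rewrite (le_trans (normr_Im_le _)).
Qed.

End complex_integration.

(** * Fubini for complex functions under a product majorant *)

Section complex_fubini.
Context {R : realType} {d1 d2 : measure_display} {T1 : measurableType d1} {T2 : measurableType d2}.
Variables (m1 : {sigma_finite_measure set T1 -> \bar R}) (m2 : {sigma_finite_measure set T2 -> \bar R}).
Variables (a : T1 -> R) (b : T2 -> R).
Hypotheses (ia : m1.-integrable setT (EFin \o a)) (ib : m2.-integrable setT (EFin \o b))
  (a0 : forall x, 0 <= a x) (b0 : forall x, 0 <= b x).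

Section real_fubini.
Variable g : T1 * T2 -> R.
Hypotheses (mg : measurable_fun setT g) (gab : forall x y, `|g (x, y)| <= a x * b y).

Lemma dominated_prod_integrable : (m1 \x m2)%E.-integrable setT (EFin \o g).
Proof.
apply/integrable12ltyP; first exact/measurable_EFinP.
apply: (@le_lt_trans _ _ (\int[m1]_x ((a x)%:E * (\int[m2]_y (b y)%:E)))%E).
  apply: ge0_le_integral => //.
  - by move=> x _; exact: integral_ge0.
  - apply: (measurable_fun_fubini_tonelli_F (m2 := m2) (abse \o (EFin \o g))); last by move=> z; exact: abse_ge0.
    by apply: measurableT_comp => //; exact/measurable_EFinP.
  - apply: emeasurable_funM => //; first by case/integrableP : ia.
  - move=> x _; rewrite -ge0_integralZl//.
    + apply: ge0_le_integral => //.
      * apply: measurableT_comp => //; apply/measurable_EFinP.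
        by apply: measurableT_comp => //; exact: measurable_pair1.
      * by apply: emeasurable_funM => //; case/integrableP : ib.
      * by move=> y _; rewrite /= -EFinM lee_fin.
    + by case/integrableP : ib.
    + by move=> y _; rewrite lee_fin.
    + by rewrite lee_fin.
have [r rE] : exists r, (\int[m2]_y (b y)%:E)%E = r%:E.
  by exists (fine (\int[m2]_y (b y)%:E)%E); rewrite fineK// integrable_fin_num.
have r0 : 0 <= r by rewrite -lee_fin -rE integral_ge0// => y _; rewrite lee_fin.
rewrite rE ge0_integralZr//; last 2 first.
- by case/integrableP : ia.
- by move=> x _; rewrite lee_fin.
rewrite lte_mul_pinfty ?lee_fin//.
- by apply: integral_ge0 => x _; rewrite lee_fin.
- by rewrite integrable_fin_num.
by rewrite ltry.
Qed.

Lemma inner_integrable2 x : m2.-integrable setT (EFin \o (fun y => g (x, y))).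
Proof.
have ibx : m2.-integrable setT (EFin \o (fun y => a x * b y)).
  by have := integrableZl measurableT (a x) ib; apply: eq_integrable.
apply: (le_integrable measurableT _ _ ibx).
  by apply/measurable_EFinP/measurableT_comp => //; exact: measurable_pair1.
by move=> y _; rewrite /= lee_fin (le_trans (gab x y))// ler_norm.
Qed.

Lemma inner_integrable1 y : m1.-integrable setT (EFin \o (fun x => g (x, y))).
Proof.
have iax : m1.-integrable setT (EFin \o (fun x => b y * a x)).
  by have := integrableZl measurableT (b y) ia; apply: eq_integrable.
apply: (le_integrable measurableT _ _ iax).
  by apply/measurable_EFinP/measurableT_comp => //; exact: measurable_pair2.
by move=> x _; rewrite /= lee_fin mulrC (le_trans (gab x y))// ler_norm.
Qed.

Lemma Rfubini12 : \int[m1]_x \int[m2]_y g (x, y) = \int[(m1 \x m2)%E]_z g z.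
Proof.
rewrite /Rintegral -(integral12_prod_meas1 dominated_prod_integrable) /fubini_F.
congr fine; apply: eq_integral => x _; rewrite fineK//.
exact: (integrable_fin_num measurableT (inner_integrable2 x)).
Qed.

Lemma Rfubini21 : \int[m2]_y \int[m1]_x g (x, y) = \int[(m1 \x m2)%E]_z g z.
Proof.
rewrite /Rintegral -(integral21_prod_meas1 dominated_prod_integrable) /fubini_G.
congr fine; apply: eq_integral => y _; rewrite fineK//.
exact: (integrable_fin_num measurableT (inner_integrable1 y)).
Qed.

Lemma Rfubini_integrable1 :
  m1.-integrable setT (EFin \o (fun x => \int[m2]_y g (x, y))).
Proof.
have := integrable_fubini_F dominated_prod_integrable.
apply: eq_integrable => // x _; rewrite /fubini_F /= fineK//.
exact: (integrable_fin_num measurableT (inner_integrable2 x)).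
Qed.

End real_fubini.

Variable f : T1 * T2 -> R[i].
Hypotheses (mf : cmeas f) (fab : forall x y, normc (f (x, y)) <= a x * b y).

Let fRe x y : `|complex.Re (f (x, y))| <= a x * b y.
Proof. exact: le_trans (normr_Re_le _) (fab x y). Qed.

Let fIm x y : `|complex.Im (f (x, y))| <= a x * b y.
Proof. exact: le_trans (normr_Im_le _) (fab x y). Qed.

Lemma cfubini12 : cint m1 (fun x => cint m2 (fun y => f (x, y))) = cint (m1 \x m2)%E f.
Proof.
case: mf => m_re m_im; rewrite {1}/cint /=.
by rewrite (Rfubini12 m_re fRe) (Rfubini12 m_im fIm).
Qed.

Lemma cfubini : cint m1 (fun x => cint m2 (fun y => f (x, y))) =
  cint m2 (fun y => cint m1 (fun x => f (x, y))).
Proof.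
rewrite cfubini12; case: mf => m_re m_im; rewrite [RHS]/cint /=.
by rewrite (Rfubini21 m_re fRe) (Rfubini21 m_im fIm).
Qed.

Lemma cfubini_prod_cintg : cintg (m1 \x m2)%E f.
Proof.
case: mf => m_re m_im; split.
  exact: (dominated_prod_integrable m_re fRe).
exact: (dominated_prod_integrable m_im fIm).
Qed.

Lemma cfubini_cintg1 : cintg m1 (fun x => cint m2 (fun y => f (x, y))).
Proof.
case: mf => m_re m_im; split => /=.
  exact: (Rfubini_integrable1 m_re fRe).
exact: (Rfubini_integrable1 m_im fIm).
Qed.

End complex_fubini.

(** * Integration over tuples of coordinates *)

Section tuple_integral.
Context {R : realType}.
Local Notation T := (measurableTypeR R).
Local Notation leb := (@lebesgue_measure R).

Lemma measurable_tuple_cons d : measurable_fun setT (@tuple_cons R d).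
Proof. exact: measurable_cons. Qed.

Lemma ge0_integral_tupleS d (f : d.+1.-tuple T -> \bar R) :
  measurable_fun setT f -> (forall t, 0 <= f t)%E ->
  (\int[lebesgue_tuple d.+1]_t f t =
   \int[(leb \x lebesgue_tuple d)]_u f (tuple_cons u))%E.
Proof.
move=> mf f0.
have E := @ge0_integral_pushforward _ _ _ _ R _ (@measurable_tuple_cons d)
  (leb \x lebesgue_tuple d)%E setT f measurableT mf (fun y _ => f0 y).
rewrite preimage_setT in E; rewrite -[RHS]E; apply: eq_measure_integral => [|A mA _ //].
exact: measurable_tuple_cons.
Qed.

Lemma integral_tupleS d (f : d.+1.-tuple T -> \bar R) :
  measurable_fun setT f -> (leb \x lebesgue_tuple d)%E.-integrable setT (f \o @tuple_cons R d) ->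
  (\int[lebesgue_tuple d.+1]_t f t =
   \int[(leb \x lebesgue_tuple d)]_u f (tuple_cons u))%E.
Proof.
move=> mf fi.
have E := @integral_pushforward _ _ _ _ R _ (@measurable_tuple_cons d)
  (leb \x lebesgue_tuple d)%E setT f mf fi measurableT.
rewrite preimage_setT in E; rewrite -[RHS]E; apply: eq_measure_integral => [|A mA _ //].
exact: measurable_tuple_cons.
Qed.

Lemma measurable_coord_prod d (f : 'I_d -> T -> R) :
  (forall i, measurable_fun setT (f i)) ->
  measurable_fun setT (fun t : d.-tuple T => \prod_i f i (tnth t i)).
Proof.
move=> mf; apply: measurable_prod => i _.
by apply: measurableT_comp => //; exact: measurable_tnth.
Qed.

Lemma tuple_cons_prod {A : comPzRingType} d (f : 'I_d.+1 -> T -> A) u :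
  \prod_i f i (tnth (tuple_cons u) i) = f ord0 u.1 * \prod_i f (lift ord0 i) (tnth u.2 i).
Proof.
rewrite big_ord_recl; congr (_ * _).
by apply: eq_bigr => i _; rewrite tnthS.
Qed.

Lemma ge0_integral_coord_prod d (f : 'I_d -> T -> R) :
  (forall i, measurable_fun setT (f i)) -> (forall i x, 0 <= f i x) ->
  (\int[lebesgue_tuple d]_t (\prod_i f i (tnth t i))%:E = \prod_i \int[leb]_x (f i x)%:E)%E.
Proof.
elim: d f => [|d IH] f mf f0.
  rewrite big_ord0 integral_dirac//; last by apply/measurable_EFinP; exact: measurable_coord_prod.
  by rewrite diracT mul1e big_ord0.
rewrite ge0_integral_tupleS; last 2 first.
- by apply/measurable_EFinP; exact: measurable_coord_prod.
- by move=> t; rewrite lee_fin; apply: prodr_ge0 => i _.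
pose P (t : d.-tuple T) := \prod_i f (lift ord0 i) (tnth t i).
have P0 t : 0 <= P t by apply: prodr_ge0.
have mP : measurable_fun setT P.
  exact: (measurable_coord_prod (f := fun i => f (lift ord0 i))).
under eq_integral do rewrite tuple_cons_prod.
rewrite (fubini_tonelli1 (fun u : T * d.-tuple T => (f ord0 u.1 * P u.2)%:E))/=; last 2 first.
- by apply/measurable_EFinP; apply: measurable_funM; apply: measurableT_comp => //.
- by move=> u; rewrite lee_fin mulr_ge0.
rewrite /fubini_F /=.
under eq_integral => x _.
  under eq_integral do rewrite EFinM.
  rewrite ge0_integralZl//; do ?[exact/measurable_EFinP|by move=> t _; rewrite lee_fin|by rewrite lee_fin].
  over.
rewrite ge0_integralZr//; last 3 first.
- exact/measurable_EFinP.
- by move=> x _; rewrite lee_fin.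
- by apply: integral_ge0 => t _; rewrite lee_fin.
by rewrite (IH (fun i => f (lift ord0 i)))// big_ord_recl.
Qed.

Lemma integrable_coord_prod d (f : 'I_d -> T -> R) :
  (forall i, leb.-integrable setT (EFin \o f i)) -> (forall i x, 0 <= f i x) ->
  (lebesgue_tuple d).-integrable setT (EFin \o (fun t => \prod_i f i (tnth t i))).
Proof.
move=> fi f0; have mf i : measurable_fun setT (f i).
  by case/integrableP : (fi i) => /measurable_EFinP.
apply/integrableP; split; first by apply/measurable_EFinP; exact: measurable_coord_prod.
under eq_integral => t _ do rewrite /= ger0_norm ?prodr_ge0//.
rewrite ge0_integral_coord_prod//.
rewrite (eq_bigr (fun i => (fine (\int[leb]_x (f i x)%:E)%E)%:E)).
  by rewrite prodEFin ltry.
by move=> i _; rewrite fineK//; exact: (integrable_fin_num measurableT (fi i)).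
Qed.

Lemma cmeas_coord d (f : T -> R[i]) (i : 'I_d) : cmeas f ->
  cmeas (fun t : d.-tuple T => f (tnth t i)).
Proof.
move=> [m1 m2]; split.
  apply: (measurableT_comp (f := fun x => complex.Re (f x))) => //; exact: measurable_tnth.
apply: (measurableT_comp (f := fun x => complex.Im (f x))) => //; exact: measurable_tnth.
Qed.

Lemma cmeas_coord_prod d (f : 'I_d -> T -> R[i]) : (forall i, cmeas (f i)) ->
  cmeas (fun t : d.-tuple T => \prod_i f i (tnth t i)).
Proof. by move=> mf; apply: cmeas_prod => i; exact: cmeas_coord. Qed.

Lemma cintg_normc (f : T -> R[i]) : cintg leb f ->
  leb.-integrable setT (EFin \o (fun x => normc (f x))).
Proof.
move=> fi; have [f1 f2] := fi.
have g1 := integrable_norm f1; have g2 := integrable_norm f2.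
apply: (le_integrable measurableT _ _ (integrableD measurableT g1 g2)).
  by apply/measurable_EFinP; apply: measurable_normc; exact: cintg_meas fi.
move=> x _; rewrite /= lee_fin [leRHS]ger0_norm ?addr_ge0// ger0_norm ?normc_ge0//.
exact: normc_le_ReIm.
Qed.

Lemma cintg_coord_prod d (f : 'I_d -> T -> R[i]) : (forall i, cintg leb (f i)) ->
  cintg (lebesgue_tuple d) (fun t => \prod_i f i (tnth t i)).
Proof.
move=> fi; apply: (cintg_dom (g := fun t => \prod_i normc (f i (tnth t i)))).
- by apply: cmeas_coord_prod => i; apply: cintg_meas.
- apply: (integrable_coord_prod (f := fun i x => normc (f i x))) => [i|i x].
    exact: cintg_normc.
  exact: normc_ge0.
- by move=> t; rewrite normc_prod.
Qed.

Lemma cint_tupleS d (f : d.+1.-tuple T -> R[i]) : cmeas f ->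
  cintg (leb \x lebesgue_tuple d)%E (fun u => f (tuple_cons u)) ->
  cint (lebesgue_tuple d.+1) f = cint (leb \x lebesgue_tuple d)%E (fun u => f (tuple_cons u)).
Proof.
move=> [m1 m2] [i1 i2]; rewrite /cint /Rintegral; congr (fine _ +i* fine _).
  by apply: (integral_tupleS (f := EFin \o (fun t => complex.Re (f t)))) => //; exact/measurable_EFinP.
by apply: (integral_tupleS (f := EFin \o (fun t => complex.Im (f t)))) => //; exact/measurable_EFinP.
Qed.

Lemma cint_coord_prod d (f : 'I_d -> T -> R[i]) : (forall i, cintg leb (f i)) ->
  cint (lebesgue_tuple d) (fun t => \prod_i f i (tnth t i)) = \prod_i cint leb (f i).
Proof.
elim: d f => [|d IH] f fi.
  rewrite big_ord0; under eq_cint do rewrite big_ord0.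
  rewrite /cint /Rintegral /= !integral_dirac//; try exact: measurable_cst.
  by rewrite diracT mul1e mule0.
have mf i : cmeas (f i) by exact: cintg_meas (fi i).
pose P (t : d.-tuple T) := \prod_i f (lift ord0 i) (tnth t i).
have Pi : cintg (lebesgue_tuple d) P.
  exact: (cintg_coord_prod (f := fun i => f (lift ord0 i))).
have mF : cmeas (fun u : T * d.-tuple T => f ord0 u.1 * P u.2).
  have [m1 m2] := mf ord0; have [n1 n2] := cintg_meas Pi.
  apply: cmeasM; split.
  - exact: (measurableT_comp m1 measurable_fst).
  - exact: (measurableT_comp m2 measurable_fst).
  - exact: (measurableT_comp n1 measurable_snd).
  - exact: (measurableT_comp n2 measurable_snd).
have ia := cintg_normc (fi ord0).
have ib : (lebesgue_tuple d).-integrable setT (EFin \o (fun t => \prod_i normc (f (lift ord0 i) (tnth t i)))).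
  apply: (integrable_coord_prod (f := fun i x => normc (f (lift ord0 i) x))) => [i|i x].
    exact: cintg_normc.
  exact: normc_ge0.
have a0 x : 0 <= normc (f ord0 x) by exact: normc_ge0.
have b0 (t : d.-tuple T) : 0 <= \prod_i normc (f (lift ord0 i) (tnth t i)).
  by apply: prodr_ge0 => i _; exact: normc_ge0.
have dom (x : T) (t : d.-tuple T) : normc (f ord0 x * P t) <=
    normc (f ord0 x) * \prod_i normc (f (lift ord0 i) (tnth t i)).
  by rewrite Normc.normcM normc_prod.
have FE : (fun u : T * d.-tuple T => \prod_i f i (tnth (tuple_cons u) i)) =
    (fun u => f ord0 u.1 * P u.2).
  by apply/funext => u; rewrite tuple_cons_prod.
rewrite cint_tupleS; last 2 first.
- exact: cmeas_coord_prod.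
- by rewrite FE; exact: (cfubini_prod_cintg ia ib a0 b0 mF dom).
rewrite FE -(cfubini12 ia ib a0 b0 mF dom) /=.
under eq_cint do rewrite cintZ// mulrC.
by rewrite cintZ// /P (IH (fun i => f (lift ord0 i)))// big_ord_recl mulrC.
Qed.

End tuple_integral.

Section continuous_measurable.
Context {R : realType} {d : nat}.
Local Notation T := (measurableTypeR R).

Lemma rV_norm_coord (x : 'rV[R]_d) i : `|x 0 i| <= `|x|.
Proof.
rewrite [leRHS](_ : _ = mx_norm x)// mx_normrE.
exact: (le_bigmax _ (fun ij : 'I_1 * 'I_d => `|x ij.1 ij.2|) (0, i)).
Qed.

Lemma rV_ballP (x y : 'rV[R]_d) e : 0 < e ->
  ball x e y <-> forall i, `|x 0 i - y 0 i| < e.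
Proof.
move=> e0; rewrite mx_norm_ball /ball_ /=; split.
  move=> xy i; apply: le_lt_trans xy.
  by have := rV_norm_coord (x - y) i; rewrite !mxE.
move=> xy; rewrite [X in X < _](_ : _ = mx_norm (x - y))// mx_normrE.
apply/bigmax_ltP; split => // -[i j] _ /=.
by rewrite !mxE ord1.
Qed.

Lemma measurable_rV_ball (x : 'rV[R]_d) e : 0 < e ->
  measurable (@rV_of_tuple R d @^-1` ball x e).
Proof.
move=> e0.
rewrite (_ : _ @^-1` _ = \bigcap_(i in [set: 'I_d])
   ((@tnth d T ^~ i) @^-1` (`]x 0 i - e, x 0 i + e[%classic : set T))).
  apply: fin_bigcap_measurable; first exact: finite_finset.
  by move=> i _; rewrite -[X in measurable X]setTI; exact: measurable_tnth.
apply/seteqP; split => [t /(rV_ballP _ _ e0) h i _|t h].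
  by have := h i; rewrite /rV_of_tuple mxE /= in_itv/= ltr_norml; lra.
apply/(rV_ballP _ _ e0) => i; have := h i I.
by rewrite /rV_of_tuple mxE /= in_itv/= ltr_norml; lra.
Qed.

(** Links the norm topology of row vectors to the product sigma-algebra of tuples: U is the
    countable union of the balls inside it with rational centres and radii 1 / (N + 1), and balls of
    the sup norm are boxes. *)
Lemma measurable_open_rV (U : set 'rV[R]_d) : open U ->
  measurable (@rV_of_tuple R d @^-1` U).
Proof.
move=> oU.
pose qb (p : {ffun 'I_d -> rat} * nat) : set 'rV[R]_d :=
  ball (\row_i ratr (p.1 i) : 'rV[R]_d) p.2.+1%:R^-1.
pose B (m : nat) : set 'rV[R]_d :=
  if unpickle m is Some p then if `[< qb p `<=` U >] then qb p else set0 else set0.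
have -> : U = \bigcup_m B m.
  apply/seteqP; split => [x Ux|x [m _]]; last first.
    rewrite /B; case: unpickle => // p; case: ifPn => // /asboolP qU; exact: qU.
  have /nbhs_ballP[e /= e0 eU] : nbhs x U by exact: open_nbhs_nbhs.
  have [N Ne] : exists N : nat, N.+1%:R^-1 < e / 2.
    have [N _ h] := near_infty_natSinv_lt (PosNum (divr_gt0 e0 (ltr0n R 2) : 0 < e / 2)).
    by exists N; apply: h => /=.
  have N0 : 0 < N.+1%:R^-1 :> R by rewrite invr_gt0 ltr0n.
  have /choice[q Hq] : forall i, exists q : rat, `|x 0 i - ratr q| < N.+1%:R^-1.
    move=> i; have lt_x : x 0 i - N.+1%:R^-1 < x 0 i + N.+1%:R^-1.
      by rewrite ltrD2l (lt_trans _ N0)// oppr_lt0.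
    have [q] := rat_in_itvoo lt_x; rewrite in_itv/= => /andP[q1 q2].
    by exists q; rewrite ltr_distlC q1 q2.
  pose p : {ffun 'I_d -> rat} * nat := ([ffun i => q i], N).
  have xp : qb p x.
    by apply/rV_ballP => // i; rewrite mxE ffunE distrC.
  exists (pickle p) => //; rewrite /B pickleK; case: asboolP => // -[] y /rV_ballP py.
  apply: eU; apply/rV_ballP => // i; have := py N0 i; have := Hq i; rewrite mxE ffunE.
  rewrite distrC => h1 h2; rewrite -(subrK (ratr (q i)) (x 0 i)) -addrA.
  apply: le_lt_trans (ler_normD _ _) _; rewrite (splitr e).
  by apply: ltrD; [rewrite distrC; exact: lt_trans h1 Ne|exact: lt_trans h2 Ne].
rewrite preimage_bigcup; apply: bigcup_measurable => m _.
rewrite /B; case: unpickle => [p|]; last by rewrite preimage_set0.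
case: ifP => _; last by rewrite preimage_set0.
exact: measurable_rV_ball.
Qed.

Lemma measurable_continuous_rV (g : 'rV[R]_d -> R) : continuous g ->
  measurable_fun setT (g \o @rV_of_tuple R d).
Proof.
move=> /continuousP cg mD; apply: (measurability _ (RGenOpens.measurableE R)) => //.
move=> _ [_ [a [b ->] <-]]; rewrite setTI comp_preimage.
by apply: measurable_open_rV; exact/cg/interval_open.
Qed.

End continuous_measurable.

(** * The blocks of the discrepancy function *)

Section one_dimensional_integrals.
Context {R : realType}.
Local Notation leb := (@lebesgue_measure R).

Lemma continuous_compR (f g : R -> R) : continuous f -> continuous g ->
  continuous (fun x => g (f x)).
Proof. by move=> cf cg x; exact: (@continuous_comp R R R f g x (cf x) (cg (f x))). Qed.

Lemma continuous_cstB (x : R) : continuous (fun y : R => x - y).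
Proof. by move=> y; apply: cvgB; [exact: cvg_cst|exact: cvg_id]. Qed.

Lemma continuous_cstM (a : R) : continuous (fun y : R => a * y).
Proof. by apply: is_derive_continuous => x; exact: is_derive_mull. Qed.

Lemma real_complex_sum (I : Type) (r : seq I) (P : pred I) (F : I -> R) :
  (\sum_(i <- r | P i) F i)%:C = \sum_(i <- r | P i) (F i)%:C :> R[i].
Proof. by elim/big_rec2 : _ => // i y1 y2 _ <-; rewrite rmorphD. Qed.

Lemma real_complexV_nat N : (N%:R^-1)%:C = N%:R^-1 :> R[i].
Proof. by rewrite fmorphV /= rmorph_nat. Qed.

Lemma Rintegral_support (g : R -> R) (a : R) : (forall x, a < `|x| -> g x = 0) ->
  \int[leb]_x g x = \int[leb]_(x in `[- a, a]) g x.
Proof.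
move=> g0; rewrite [RHS]Rintegral_mkcond; apply: eq_Rintegral => x _.
rewrite patchE; case: ifPn => // /negP; rewrite inE /= in_itv /= => xn.
by apply: g0; rewrite ltNge ler_norml; apply/negP.
Qed.

Lemma derivable_oo_LR_derive (F f : R -> R) a b : (forall x : R, is_derive x 1 F (f x)) ->
  derivable_oo_LRcontinuous F a b.
Proof.
move=> dF; have cF : continuous F by exact: is_derive_continuous dF.
split; first by move=> x _; case: (dF x).
  by apply: cvg_at_right_filter; exact: cF.
by apply: cvg_at_left_filter; exact: cF.
Qed.

Lemma Rintegral_FTC2 (f F : R -> R) a b : a <= b -> continuous f ->
  (forall x : R, is_derive x 1 F (f x)) ->
  \int[leb]_(x in `[a, b]) f x = F b - F a.
Proof.
rewrite le_eqVlt => /predU1P[<- _ _|ab cf dF].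
  by rewrite set_itv1 Rintegral_set1 subrr.
rewrite /Rintegral (@continuous_FTC2 _ f F)//.
- exact: continuous_subspaceT.
- exact: derivable_oo_LR_derive dF.
- by move=> x _; rewrite derive1E; apply: derive_val.
Qed.

Lemma Rintegral_scale (g : R -> R) a : 0 < a -> continuous g ->
  (forall x, 3 / 2 < `|x| -> g x = 0) ->
  \int[leb]_x g (a * x) = a^-1 * \int[leb]_x g x.
Proof.
move=> a0 cg g0.
rewrite (@Rintegral_support _ (a^-1 * 2)); last first.
  move=> x xa; apply: g0; rewrite normrM gtr0_norm//.
  have : a * (a^-1 * 2) < a * `|x| by rewrite ltr_pM2l.
  by rewrite mulVKf ?gt_eqF//; lra.
rewrite (@Rintegral_support g 2); last by move=> x x2; apply: g0; lra.
have dF (x : R) : is_derive x 1 (fun y : R => a * y) a by exact: is_derive_mull.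
have cF : continuous (fun x : R => a * x) by exact: is_derive_continuous dF.
have F1 : derive1 (fun y : R => a * y) = cst a.
  by apply/funext => x; rewrite derive1E; apply: derive_val.
have H := @integration_by_substitution_increasing R (fun y => a * y) g (- (a^-1 * 2)) (a^-1 * 2).
have E : (\int[leb]_(x in `[(-2)%R, 2%R]) (g x)%:E =
    \int[leb]_(x in `[(- (a^-1 * 2))%R, (a^-1 * 2)%R]) (g (a * x) * a)%:E)%E.
  rewrite -[X in `[-X, _]](_ : a * (a^-1 * 2) = 2); last by rewrite mulVKf ?gt_eqF.
  rewrite -{2}[2%R](_ : a * (a^-1 * 2) = 2); last by rewrite mulVKf ?gt_eqF.
  rewrite -mulrN H//.
  - by apply: eq_integral => x _; rewrite F1.
  - have : 0 < a^-1 * 2 by rewrite mulr_gt0// invr_gt0.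
    lra.
  - by move=> x y _ _ xy; rewrite ltr_pM2l.
  - by rewrite F1 => x _; exact: cst_continuous.
  - by rewrite F1; exact: is_cvg_cst.
  - by rewrite F1; exact: is_cvg_cst.
  - exact: derivable_oo_LR_derive dF.
  - exact: continuous_subspaceT.
rewrite {2}/Rintegral E -/(Rintegral _ _ _).
under [in RHS]eq_Rintegral do rewrite mulrC.
rewrite RintegralZl//; first by rewrite mulrA mulVf ?gt_eqF// mul1r.
by apply: continuous_itv_integrable => x; apply: continuous_comp; [exact: cF|exact: cg].
Qed.

Lemma cint_scale (g : R -> R[i]) a : 0 < a ->
  continuous (fun x => complex.Re (g x)) -> continuous (fun x => complex.Im (g x)) ->
  (forall x, 3 / 2 < `|x| -> g x = 0) ->
  cint leb (fun x => g (a * x)) = (a^-1)%:C * cint leb g.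
Proof.
move=> a0 c1 c2 g0; rewrite /cint (@Rintegral_scale (fun x => complex.Re (g x)))//; last first.
  by move=> x /g0 ->.
rewrite (@Rintegral_scale (fun x => complex.Im (g x)))//; last first.
  by move=> x /g0 ->.
by apply/eqP; rewrite eq_complex /= mul0r mul0r subr0 addr0 !eqxx.
Qed.

Lemma continuous_cintg (g : R -> R[i]) a :
  continuous (fun x => complex.Re (g x)) -> continuous (fun x => complex.Im (g x)) ->
  (forall x, a < `|x| -> g x = 0) -> cintg leb g.
Proof.
have H (f : R -> R) : continuous f -> (forall x, a < `|x| -> f x = 0) ->
    leb.-integrable setT (EFin \o f).
  move=> cf f0; have := @continuous_itv_integrable R f (- a) a cf.
  rewrite integrable_mkcond//; apply: eq_integrable => // x _.
  rewrite patchE; case: ifPn => // /negP; rewrite inE /= in_itv /= => xn.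
  by rewrite f0// ltNge ler_norml; apply/negP.
by move=> c1 c2 g0; split; apply: H => // x /g0 ->.
Qed.

Lemma expi_continuous u : continuous (fun x : R => complex.Re (expi (u * x))) /\
  continuous (fun x : R => complex.Im (expi (u * x))).
Proof. by split; [exact: continuous_cosM|exact: continuous_sinM]. Qed.

Lemma mul_complex_continuous {T : topologicalType} (f g : T -> R[i]) :
  continuous (fun x => complex.Re (f x)) /\ continuous (fun x => complex.Im (f x)) ->
  continuous (fun x => complex.Re (g x)) /\ continuous (fun x => complex.Im (g x)) ->
  continuous (fun x => complex.Re (f x * g x)) /\ continuous (fun x => complex.Im (f x * g x)).
Proof.
move=> [f1 f2] [g1 g2]; split.
  under eq_fun do rewrite complex_ReM.
  by move=> x; apply: cvgB; [exact: cvgM (f1 x) (g1 x)|exact: cvgM (f2 x) (g2 x)].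
under eq_fun do rewrite complex_ImM.
by move=> x; apply: cvgD; [exact: cvgM (f1 x) (g2 x)|exact: cvgM (f2 x) (g1 x)].
Qed.

End one_dimensional_integrals.

Section dyadic_kernel.
Context {R : realType} (phi0 : R -> R[i]).
Hypothesis hphi0 : lp_cutoff phi0.
Local Notation leb := (@lebesgue_measure R).

Let sc m x := phi0 (2 ^- m * x).

Let sc_cont m : continuous (fun x => complex.Re (sc m x)) /\ continuous (fun x => complex.Im (sc m x)).
Proof.
have [c1 c2] := cutoff_continuous hphi0.
by split; [exact: (continuous_compR (@continuous_cstM _ _) c1)|exact: (continuous_compR (@continuous_cstM _ _) c2)].
Qed.

Let sc0 m x : 2 ^+ m * 2 < `|x| -> sc m x = 0.
Proof.
move=> xm; case: hphi0 => _ _; apply; rewrite normrM gtr0_norm ?invr_gt0 ?exprn_gt0//.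
rewrite -(ltr_pM2l (exprn_gt0 m (ltr0n R 2))) mulrA divff ?expf_neq0// mul1r.
by apply: le_lt_trans xm; rewrite ler_wpM2l ?exprn_ge0//; lra.
Qed.

Let sc_cintg m u : cintg leb (fun xi => sc m xi * expi (u * xi)).
Proof.
have [c1 c2] := mul_complex_continuous (sc_cont m) (expi_continuous u).
by apply: (continuous_cintg (a := 2 ^+ m * 2)) => // x /sc0 ->; rewrite mul0r.
Qed.

Let sc_cint m u : ((2 * pi)^-1)%:C * cint leb (fun xi => sc m xi * expi (u * xi)) =
  (2 ^+ m)%:C * ker0 phi0 (2 ^+ m * u).
Proof.
rewrite /ker0 mulrCA; congr (_ * _).
have [c1 c2] := mul_complex_continuous (cutoff_continuous hphi0) (expi_continuous (2 ^+ m * u)).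
rewrite -[X in X%:C * _](invrK (2 ^+ m)) -(cint_scale (g := fun x => phi0 x * expi (2 ^+ m * u * x)))//.
- apply: eq_cint => x; rewrite /sc; congr (_ * expi _).
  by rewrite mulrACA divff ?expf_neq0// mul1r.
by case: hphi0 => _ _ h x /h ->; rewrite mul0r.
Qed.

Lemma piece_cintg k u : cintg leb (fun xi => dyadic_piece phi0 k xi * expi (u * xi)).
Proof.
case: k => [|k] /=.
  have := sc_cintg 0 u; congr cintg; apply/funext => x.
  by rewrite /sc expr0 invr1 mul1r.
have H := cintgD (sc_cintg k.+1 u) (cintgZ (-1) (sc_cintg k u)).
move: H; congr cintg; apply/funext => x.
by rewrite mulN1r mulrBl.
Qed.

Lemma piece_cint k u :
  ((2 * pi)^-1)%:C * cint leb (fun xi => dyadic_piece phi0 k xi * expi (u * xi)) =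
  kerk (ker0 phi0) k u.
Proof.
case: k => [|k] //=.
rewrite -!sc_cint -mulrBr -cintB//; congr (_ * _).
by apply: eq_cint => x; rewrite mulrBl.
Qed.

Lemma piece_cintg1 k : cintg leb (dyadic_piece phi0 k).
Proof.
have := piece_cintg k 0; congr cintg; apply/funext => x.
by rewrite mul0r /expi cos0 sin0 mulr1.
Qed.

End dyadic_kernel.

(** * Jumps and ramps smoothed by the dyadic kernels *)

Section integrals_of_kernel.
Context {R : realType}.
Variables (Th ker : R -> R[i]) (K : R).
Hypotheses (K0 : 0 <= K)
  (dTh : forall u : R, is_derive u 1 (fun x => complex.Re (Th x)) (complex.Re (ker u)) /\
     is_derive u 1 (fun x => complex.Im (Th x)) (complex.Im (ker u)))
  (ker_cont : continuous (fun x => complex.Re (ker x)) /\ continuous (fun x => complex.Im (ker x)))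
  (kerK : forall u, normc (ker u) <= K * tau u ^+ 3).
Local Notation leb := (@lebesgue_measure R).

Lemma kerk_cont k : continuous (fun x => complex.Re (kerk ker k x)) /\
  continuous (fun x => complex.Im (kerk ker k x)).
Proof.
have sc m : continuous (fun x : R => complex.Re ((2 ^+ m)%:C * ker (2 ^+ m * x))) /\
   continuous (fun x : R => complex.Im ((2 ^+ m)%:C * ker (2 ^+ m * x))).
  apply: mul_complex_continuous; first by split => x; exact: cvg_cst.
  case: ker_cont => c1 c2.
  by split; [exact: (continuous_compR (@continuous_cstM _ _) c1)|exact: (continuous_compR (@continuous_cstM _ _) c2)].
case: k => [//|k] /=; have [a1 a2] := sc k.+1; have [b1 b2] := sc k.
split.
  under eq_fun do rewrite complex_ReD complex_ReN.
  by move=> x; apply: cvgB; [exact: a1|exact: b1].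
under eq_fun do rewrite complex_ImD complex_ImN.
by move=> x; apply: cvgB; [exact: a2|exact: b2].
Qed.

Lemma Thk_derive k (u : R) :
  is_derive u 1 (fun x => complex.Re (Thk Th k x)) (complex.Re (kerk ker k u)) /\
  is_derive u 1 (fun x => complex.Im (Thk Th k x)) (complex.Im (kerk ker k u)).
Proof.
have sc m : is_derive u 1 (fun x => complex.Re (Th (2 ^+ m * x))) (complex.Re ((2 ^+ m)%:C * ker (2 ^+ m * u))) /\
  is_derive u 1 (fun x => complex.Im (Th (2 ^+ m * x))) (complex.Im ((2 ^+ m)%:C * ker (2 ^+ m * u))).
  have [d1 d2] := dTh (2 ^+ m * u).
  have dl : is_derive u 1 (fun x : R => 2 ^+ m * x) (2 ^+ m) by exact: is_derive_mull.
  rewrite complex_ReM complex_ImM /= !mul0r subr0 addr0.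
  by rewrite ![2 ^+ m * complex.Re _]mulrC ![2 ^+ m * complex.Im _]mulrC; split; [exact: (is_derive_compR d1 dl)|exact: (is_derive_compR d2 dl)].
case: k => [|k] /=; first exact: dTh.
have [a1 a2] := sc k.+1; have [b1 b2] := sc k.
rewrite complex_ReD complex_ReN complex_ImD complex_ImN; split.
  rewrite (_ : (fun _ => _) = (fun x => complex.Re (Th (2 ^+ k.+1 * x)) - complex.Re (Th (2 ^+ k * x)))).
    exact: is_deriveB.
  by apply/funext => x; rewrite complex_ReD complex_ReN.
rewrite (_ : (fun _ => _) = (fun x => complex.Im (Th (2 ^+ k.+1 * x)) - complex.Im (Th (2 ^+ k * x)))).
  exact: is_deriveB.
by apply/funext => x; rewrite complex_ImD complex_ImN.
Qed.

(* In one coordinate, and extended by zero from [0, 1[ to R, the counting part of D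
   is the indicator of y > z and the volume part is y; [jump] and [ramp] are the
   convolutions of these two with [kerk]. *)
Definition jump k x z : R[i] :=
  cint leb (fun y => (\1_(`]z, 1[%classic : set R) y)%:C * kerk ker k (x - y)).

Definition ramp k x : R[i] :=
  cint leb (fun y => (\1_(`[0, 1[%classic : set R) y * y)%:C * kerk ker k (x - y)).

Lemma kerk_shift_cmeas k x : cmeas (fun y : measurableTypeR R => kerk ker k (x - y)).
Proof.
have [c1 c2] := kerk_cont k.
split; apply: continuous_measurable_fun.
  exact: (continuous_compR (@continuous_cstB _ x) c1).
exact: (continuous_compR (@continuous_cstB _ x) c2).
Qed.

Lemma kerk_bound_cst k x y : normc (kerk ker k (x - y)) <= 2 * K * 2 ^+ k.
Proof.
apply: le_trans (kerk_bound K0 kerK _ _) _.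
by rewrite ler_piMr ?tau_le1// !mulr_ge0// exprn_ge0.
Qed.

Lemma kerk_itv_cintg k x (r : measurableTypeR R -> R) : measurable_fun setT r ->
  (forall y, `|r y| <= \1_(`[0, 1]%classic : set R) y) ->
  cintg leb (fun y => (r y)%:C * kerk ker k (x - y)).
Proof.
move=> mr r01.
apply: (cintg_dom (g := fun y : measurableTypeR R => 2 * K * 2 ^+ k * \1_(`[0, 1]%classic : set R) y)).
- by apply: cmeasM; [exact: cmeas_real|exact: kerk_shift_cmeas].
- have := integrableZl measurableT (2 * K * 2 ^+ k) (@integrable_indic_itv R 0 1 true false).
  by apply: eq_integrable.
- move=> y; rewrite Normc.normcM normc_real mulrC; apply: ler_pM; rewrite ?normc_ge0//.
  exact: kerk_bound_cst.
Qed.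

Lemma jump_cintg k x z : 0 <= z ->
  cintg leb (fun y => (\1_(`]z, 1[%classic : set R) y)%:C * kerk ker k (x - y)).
Proof.
move=> z0; apply: kerk_itv_cintg; first exact: measurable_indic.
move=> y; rewrite !indicE ger0_norm ?ler0n// ler_nat.
case: (boolP (y \in `]z, 1[%classic)) => //.
by rewrite inE /= in_itv /= => /andP[zy y1]; rewrite mem_set//= in_itv/= (le_trans z0 (ltW zy)) ltW.
Qed.

Lemma ramp_cintg k x :
  cintg leb (fun y => (\1_(`[0, 1[%classic : set R) y * y)%:C * kerk ker k (x - y)).
Proof.
apply: kerk_itv_cintg.
  by apply: measurable_funM => //; exact: measurable_indic.
move=> y; rewrite !indicE; case: (boolP (y \in `[0, 1[%classic)).
  rewrite inE /= in_itv /= => /andP[y0 y1].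
  by rewrite mul1r ger0_norm// mem_set/= ?in_itv/= ?y0 ltW.
by rewrite mul0r normr0.
Qed.

Lemma jumpE k x z : 0 <= z <= 1 -> jump k x z = Thk Th k (x - z) - Thk Th k (x - 1).
Proof.
move=> /andP[z0 z1]; rewrite /jump.
have H (f F : R -> R) : continuous f -> (forall u : R, is_derive u 1 F (f u)) ->
    \int[leb]_y (\1_(`]z, 1[%classic : set R) y * f (x - y)) = F (x - z) - F (x - 1).
  move=> cf dF.
  transitivity (\int[leb]_(y in `[z, 1]) f (x - y)).
    have cs := continuous_compR (@continuous_cstB _ x) cf.
    rewrite -Rintegral_itv_bndo_bndc; last first.
      apply: integrableS (continuous_itv_integrable z 1 cs) => //.
      by move=> y /=; rewrite !in_itv/= => /andP[-> /ltW ->].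
    rewrite -Rintegral_itv_obnd_cbnd; last first.
      apply: integrableS (continuous_itv_integrable z 1 cs) => //.
      by move=> y /=; rewrite !in_itv/= => /andP[/ltW -> /ltW ->].
    rewrite [RHS]Rintegral_mkcond; apply: eq_Rintegral => y _.
    by rewrite patchE indicE; case: ifP; rewrite ?mul1r ?mul0r.
  have dG (y : R) : is_derive y 1 (fun y : R => - F (x - y)) (f (x - y)).
    have ds : is_derive y 1 (fun y : R => x - y) (-1).
      rewrite -[X in is_derive _ _ _ X]add0r; apply: is_deriveB.
    have := @is_derive_compR _ F (fun y : R => x - y) y _ _ (dF (x - y)) ds; rewrite mulrN1 => h.
    by rewrite -[X in is_derive _ _ _ X]opprK; exact: is_deriveN h.
  rewrite (Rintegral_FTC2 _ _ dG)//; first by rewrite opprK addrC.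
  exact: (continuous_compR (@continuous_cstB _ x) cf).
have [c1 c2] := kerk_cont k.
rewrite /cint; under eq_Rintegral do rewrite complex_ReM /= mul0r subr0.
under [X in _ +i* X]eq_Rintegral do rewrite complex_ImM /= mul0r addr0.
rewrite (H _ _ c1 (fun u => (Thk_derive k u).1)) (H _ _ c2 (fun u => (Thk_derive k u).2)).
by case: (Thk Th k (x - z)); case: (Thk Th k (x - 1)).
Qed.

(** The sum is the ceiling of t. *)
Lemma count_le (N : nat) (t : R) : 0 <= t -> t <= N%:R ->
  `|t - \sum_(m < N) (m%:R < t)%R%:R| <= 1.
Proof.
elim: N => [|N IH] t0 tN.
  by rewrite big_ord0 subr0 ger0_norm// (le_trans tN)// ler01.
have [tN'|tN'] := lerP t N%:R.
  by rewrite big_ord_recr/= ltNge tN' addr0; exact: IH.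
rewrite (eq_bigr (fun=> 1)); last first.
  move=> m _; rewrite (le_lt_trans _ tN')// ler_nat; have := ltn_ord m; lia.
rewrite big_const_ord iter_addr_0 ler0_norm; last by rewrite subr_le0.
by rewrite opprB lerBlDr -natr1 addrC lerD2l ltW.
Qed.

(** On [0, 1[ the volume part y differs by at most 1 / N from the fraction of grid points m / N
    below y, so the ramp is nearly the mean of the jumps at the grid. 16 = 2 * 8, from [normc_cint]
    and [weight_kerk]. *)
Lemma ramp_riemann k x (N : nat) : (0 < N)%N ->
  (1 + x ^+ 2) * normc (ramp k x - N%:R^-1 * \sum_(m < N) jump k x (m%:R / N%:R)) <=
  16 * K * 2 ^+ k / N%:R.
Proof.
move=> N0; have N0' : 0 < N%:R :> R by rewrite ltr0n.
pose c (y : R) : R := \1_(`[0, 1[%classic : set R) y * y -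
  N%:R^-1 * \sum_(m < N) \1_(`]m%:R / N%:R, 1[%classic : set R) y.
have mI (i : interval R) : measurable_fun setT (\1_([set` i]) : R -> R) by exact: measurable_indic.
have ramp_i := ramp_cintg k x.
have jump_i := @jump_cintg k x.
have mN0 (m : 'I_N) : 0 <= m%:R / N%:R :> R by rewrite divr_ge0.
have -> : ramp k x - N%:R^-1 * \sum_(m < N) jump k x (m%:R / N%:R) =
    cint leb (fun y => (c y)%:C * kerk ker k (x - y)).
  rewrite /ramp /jump -cint_sum => [|m]; last exact: jump_i.
  rewrite -cintZ; last by apply: cintg_sum => m; exact: jump_i.
  rewrite -cintB//; last by apply/cintgZ/cintg_sum => m; exact: jump_i.
  apply: eq_cint => y; rewrite -mulr_suml mulrA -mulrBl; congr (_ * _).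
  by rewrite -real_complex_sum -real_complexV_nat -rmorphM -rmorphB.
have cB y : `|c y| <= N%:R^-1 * \1_(`[0, 1]%classic : set R) y.
  rewrite /c !indicE; case: (boolP (y \in `[0, 1[%classic)); last first.
    rewrite notin_setE /= => yn; rewrite mul0r sub0r normrN big1 ?mulr0 ?normr0 ?mulr_ge0 ?invr_ge0 ?ler0n//.
    move=> m _; rewrite indicE memNset//= => ym; apply: yn.
    move: ym; rewrite /= !in_itv /= => /andP[ym ->]; rewrite andbT.
    by rewrite ltW// (le_lt_trans _ ym).
  rewrite inE /= in_itv /= => /andP[y0 y1].
  rewrite mul1r mem_set/= ?in_itv/= ?y0 ?(ltW y1)// mulr1.
  rewrite (eq_bigr (fun m : 'I_N => (m%:R < y * N%:R)%R%:R)); last first.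
    move=> m _; rewrite indicE; congr (nat_of_bool _)%:R.
    apply/idP/idP; first by rewrite inE /= in_itv /= ltr_pdivrMr// => /andP[].
    by move=> h; rewrite inE /= in_itv /= ltr_pdivrMr// h.
  have := @count_le N (y * N%:R) _ _.
  set S := \sum_(_ < _) _ => H.
  rewrite -(ler_pM2l N0') divff ?gt_eqF// -[X in X * `|_|](ger0_norm (ltW N0')) -normrM.
  rewrite mulrBr mulrA divff ?gt_eqF// mul1r mulrC; apply: H.
    by rewrite mulr_ge0.
  by rewrite ler_piMl// ltW.
have mc : measurable_fun setT c.
  apply: measurable_funB; first exact: measurable_funM.
  by apply: measurable_funM => //; apply: measurable_sum => m; exact: mI.
have w0 : 0 < 1 + x ^+ 2 := tauV_gt0 x.
pose M : R := N%:R^-1 * (8 * K * 2 ^+ k / (1 + x ^+ 2)).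
have iM : leb.-integrable setT (EFin \o (fun y : R => M * \1_(`[0, 1]%classic : set R) y)).
  have := integrableZl measurableT M (@integrable_indic_itv R 0 1 true false).
  by apply: eq_integrable.
have := @normc_cint _ _ _ leb (fun y => (c y)%:C * kerk ker k (x - y)) _ _ iM.
move=> /(_ (cmeasM (cmeas_real mc) (kerk_shift_cmeas k x))) H.
rewrite -ler_pdivlMl//; apply: le_trans (H _) _.
  move=> y; rewrite Normc.normcM normc_real.
  have [y01|y01] := boolP (y \in (`[0, 1]%classic : set R)); last first.
    have := cB y; rewrite !indicE (negbTE y01) !mulr0 => h.
    by rewrite (_ : `|c y| = 0) ?mul0r//; apply/eqP; rewrite eq_le h normr_ge0.
  have := cB y; rewrite !indicE y01 !mulr1 => h.
  rewrite /M; apply: ler_pM; rewrite ?normc_ge0//.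
  rewrite ler_pdivlMr// mulrC; apply: (weight_kerk K0 kerK).
  by move: y01; rewrite inE /= in_itv.
rewrite RintegralZl//; last exact: (@integrable_indic_itv R 0 1 true false).
rewrite /Rintegral integral_indic//= setIT lebesgue_measure_itv /= lte_fin ltr01 sube0 /= mulr1.
by rewrite /M le_eqVlt; apply/orP; left; apply/eqP; field; rewrite !gt_eqF.
Qed.

End integrals_of_kernel.

Section complex_exponential.
Context {R : realType}.

Lemma expiD (a c : R) : expi (a + c) = expi a * expi c.
Proof. by rewrite /expi cosD sinD; apply/eqP; rewrite eq_complex /= eqxx addrC eqxx. Qed.

Lemma expi_sum (I : finType) (F : I -> R) : expi (\sum_i F i) = \prod_i expi (F i).
Proof.
elim/big_rec2 : _ => [|i y1 y2 _ <-]; first by rewrite /expi cos0 sin0.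
by rewrite expiD.
Qed.

Lemma lipschitz_complex_continuous (f : R -> R[i]) L e : 0 < e -> 0 <= L ->
  (forall x x', `|x - x'| <= e -> normc (f x - f x') <= L * `|x - x'|) ->
  continuous (fun x => complex.Re (f x)) /\ continuous (fun x => complex.Im (f x)).
Proof.
move=> e0 L0 fL.
have H (g : R -> R) : (forall x x', `|g x - g x'| <= normc (f x - f x')) -> continuous g.
  move=> gf x; apply/cvgrPdist_lt => a a0.
  apply/nbhs_ballP; exists (Num.min e (a / (L + 1))) => /=.
    by rewrite lt_min e0 divr_gt0// ltr_wpDl.
  move=> y; rewrite /ball /= lt_min => /andP[xe xa].
  apply: le_lt_trans (gf _ _) _; apply: le_lt_trans (fL _ _ (ltW xe)) _.
  rewrite ltr_pdivlMr ?ltr_wpDl// in xa.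
  apply: le_lt_trans xa; rewrite mulrC ler_wpM2l// lerDl//.
split; apply: H => x x'.
  by rewrite -complex_ReN -complex_ReD; exact: normr_Re_le.
by rewrite -complex_ImN -complex_ImD; exact: normr_Im_le.
Qed.

End complex_exponential.

(** * Schwartz functions and the discrepancy as a distribution *)

Section schwartz_functions.
Context {R : realType} {d : nat}.
Local Notation T := (measurableTypeR R).
Local Notation mu := (@lebesgue_tuple R d).
Local Notation leb := (@lebesgue_measure R).
Implicit Types (f : 'rV[R]_d -> R[i]).

Lemma pderiv_nil f x : pderiv [::] f x = f x.
Proof. by rewrite /pderiv /=; case: (f x). Qed.

Lemma schwartz_norm_ge N f x : ((normc (f x))%:E <= schwartz_norm N f)%E.
Proof.
apply: (@le_trans _ _ ((1 + `|x|) ^+ N * normc (pderiv [::] f x))%:E).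
  by rewrite lee_fin pderiv_nil ler_peMl ?normc_ge0// exprn_ege1// lerDl.
by apply: ereal_sup_ubound; exists [::], x.
Qed.

Lemma schwartz_bounded f : schwartz f -> exists2 S, (schwartz_norm 0 f = S%:E) &
  forall x, normc (f x) <= S.
Proof.
case=> _ /(_ 0%N) fin.
have S0 : (0 <= schwartz_norm 0 f)%E.
  by apply: le_trans (schwartz_norm_ge 0 f 0); rewrite lee_fin normc_ge0.
exists (fine (schwartz_norm 0 f)) => [|x]; first by rewrite fineK// ge0_fin_numE.
by rewrite -lee_fin fineK ?ge0_fin_numE// schwartz_norm_ge.
Qed.

(** The seminorm of order 2 d suffices: |x| is the sup norm, so (1 + |x|)^(2 d) dominates the
    product of the 1 + x_i^2. *)
Lemma schwartz_decay f : schwartz f ->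
  exists2 M, 0 <= M & forall x, normc (f x) <= M * \prod_i tau (x 0 i).
Proof.
case=> _ /(_ (2 * d)%N) fin.
have S0 : (0 <= schwartz_norm (2 * d) f)%E.
  by apply: le_trans (schwartz_norm_ge _ f 0); rewrite lee_fin normc_ge0.
exists (fine (schwartz_norm (2 * d) f)) => [|x]; first exact: fine_ge0.
rewrite (eq_bigr (fun i => (1 + x 0 i ^+ 2)^-1))// prodfV ler_pdivlMr; last first.
  by apply: prodr_gt0 => i _; exact: tauV_gt0.
apply: (@le_trans _ _ ((1 + `|x|) ^+ (2 * d) * normc (f x))).
  rewrite mulrC ler_wpM2r ?normc_ge0// exprM.
  have -> : ((1 + `|x|) ^+ 2) ^+ d = \prod_(i < d) (1 + `|x|) ^+ 2.
    by rewrite prodr_const card_ord.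
  apply: ler_prod => i _; rewrite (ltW (tauV_gt0 _))/=.
  have := rV_norm_coord x i; have := normr_ge0 (x 0 i).
  rewrite -[x 0 i ^+ 2]real_normK ?num_real//; move: `|x 0 i| `|x| => a c a0 ac.
  by rewrite !expr2; nra.
rewrite -lee_fin fineK ?ge0_fin_numE//; apply: ereal_sup_ubound.
by exists [::], x; rewrite pderiv_nil.
Qed.

Lemma schwartz_cmeas f : schwartz f ->
  cmeas (fun t : d.-tuple T => f (rV_of_tuple t)).
Proof.
case=> -[s1 s2] _; split.
  by have [c _] := s1 [::]; exact: (measurable_continuous_rV c).
by have [c _] := s2 [::]; exact: (measurable_continuous_rV c).
Qed.

Lemma integrable_prod_tau : mu.-integrable setT (EFin \o (fun t => \prod_i tau (tnth t i))).
Proof.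
apply: (integrable_coord_prod (f := fun=> @tau R)) => [_|_ x].
  exact: integrable_tau.
exact: tau_ge0.
Qed.

Lemma integrableZ_EFin (M : R) (g : d.-tuple T -> R) : mu.-integrable setT (EFin \o g) ->
  mu.-integrable setT (EFin \o (fun t => M * g t)).
Proof. by move=> ig; have := integrableZl measurableT M ig; apply: eq_integrable. Qed.

Lemma schwartz_normc_integrable f : schwartz f ->
  mu.-integrable setT (EFin \o (fun t => normc (f (rV_of_tuple t)))).
Proof.
move=> sf; have [M M0 fM] := schwartz_decay sf.
apply: (le_integrable measurableT _ _ (integrableZ_EFin M integrable_prod_tau)).
  by apply/measurable_EFinP; apply: measurable_normc; exact: schwartz_cmeas.
move=> t _; rewrite /= lee_fin ger0_norm ?normc_ge0//.
rewrite ger0_norm; last by apply: mulr_ge0 => //; apply: prodr_ge0 => i _; exact: tau_ge0.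
apply: le_trans (fM _) _; rewrite ler_wpM2l//; apply: ler_prod => i _.
by rewrite tau_ge0 mxE /=.
Qed.

Lemma cintegralT f : cintegral setT f = cint mu (fun t => f (rV_of_tuple t)).
Proof. by rewrite /cintegral /integral_rV preimage_setT. Qed.

Lemma cintegrableT f : cintegrable setT f <-> cintg mu (fun t => f (rV_of_tuple t)).
Proof. by rewrite /cintegrable /integrable_rV preimage_setT. Qed.

Lemma cintegral_indic (D : set 'rV[R]_d) f : measurable (@rV_of_tuple R d @^-1` D) ->
  cintegral D f = cint mu (fun t => (\1_D (rV_of_tuple t))%:C * f (rV_of_tuple t)).
Proof.
move=> mD.
have E (g : 'rV[R]_d -> R) : integral_rV D g =
    \int[mu]_t (\1_D (rV_of_tuple t) * g (rV_of_tuple t)).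
  rewrite /integral_rV Rintegral_mkcond; apply: eq_Rintegral => t _.
  rewrite patchE indicE; case: ifPn => h.
    by rewrite (_ : rV_of_tuple t \in D) ?mul1r//; move: h; rewrite !inE.
  rewrite (_ : rV_of_tuple t \in D = false) ?mul0r//.
  by apply/negbTE; move: h; apply: contra; rewrite !inE.
rewrite /cintegral /cint !E; congr (_ +i* _); apply: eq_Rintegral => t _.
  by rewrite complex_ReM /= mul0r subr0.
by rewrite complex_ImM /= mul0r addr0.
Qed.

Lemma cube_indic (t : d.-tuple T) :
  \1_cube (rV_of_tuple t) = \prod_i \1_(`[0, 1[%classic : set R) (tnth t i) :> R.
Proof.
rewrite indicE; case: (boolP (rV_of_tuple t \in cube)).
  rewrite inE => tc; rewrite big1// => i _; rewrite indicE mem_set//= in_itv /=.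
  by have := tc i; rewrite mxE.
rewrite notin_setE => /existsNP[i ti]; rewrite (bigD1 i)//= indicE memNset ?mul0r//=.
by rewrite in_itv /= => h; apply: ti; rewrite mxE.
Qed.

Lemma measurable_cube : measurable (@rV_of_tuple R d @^-1` cube).
Proof.
rewrite (_ : _ @^-1` _ = \bigcap_(i in [set: 'I_d])
   ((@tnth d T ^~ i) @^-1` (`[0, 1[%classic : set T))).
  apply: fin_bigcap_measurable; first exact: finite_finset.
  by move=> i _; rewrite -[X in measurable X]setTI; exact: measurable_tnth.
apply/seteqP; split => [t h i _|t h i].
  by have := h i; rewrite mxE /= in_itv.
by have := h i I; rewrite mxE /= in_itv.
Qed.

End schwartz_functions.

Section discrepancy_distribution.
Context {R : realType} {d N : nat} (P : 'I_N -> 'rV[R]_d).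
Hypotheses (N0 : (0 < N)%N) (P01 : forall j i, 0 <= P j 0 i < 1).
Local Notation T := (measurableTypeR R).
Local Notation mu := (@lebesgue_tuple R d).

(** The discrepancy extended by zero, with box and cube indicators written as products over the
    coordinates, so that integrals against product kernels factorize. *)
Definition discr (t : d.-tuple T) : R :=
  N%:R^-1 * (\sum_j \prod_i \1_(`]P j 0 i, 1[%classic : set R) (tnth t i))
    - \prod_i (\1_(`[0, 1[%classic : set R) (tnth t i) * tnth t i).

Lemma discrE t : \1_cube (rV_of_tuple t) * discrepancy P (rV_of_tuple t) = discr t.
Proof.
rewrite cube_indic /discrepancy /discr mulrBr -big_split /=; congr (_ - _); last first.
  by apply: eq_bigr => i _; rewrite mxE.
rewrite mulrCA mulr_sumr; congr (_ * _); apply: eq_bigr => j _.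
have -> : \1_(box0 (rV_of_tuple t)) (P j) =
    \prod_i (P j 0 i < tnth t i)%R%:R :> R.
  rewrite indicE; case: (boolP (P j \in _)).
    rewrite inE => h; rewrite big1// => i _.
    by have := h i; rewrite mxE => /andP[_ ->].
  rewrite notin_setE => /existsNP[i ti]; rewrite (bigD1 i)//=.
  case: ltP => //; last by rewrite mul0r.
  by move=> h; exfalso; apply: ti; rewrite mxE h andbT; case/andP: (P01 j i).
rewrite -big_split /=; apply: eq_bigr => i _; rewrite !indicE -natrM mulnb.
congr (nat_of_bool _)%:R; apply/idP/idP.
  move=> /andP[]; rewrite inE /= in_itv /= => /andP[_ t1] Pt.
  by rewrite inE /= in_itv /= Pt.
rewrite inE /= in_itv /= => /andP[Pt t1].
rewrite Pt andbT inE /= in_itv /= t1 andbT.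
by case/andP: (P01 j i) => h _; exact: le_trans h (ltW Pt).
Qed.

Lemma measurable_discr : measurable_fun setT discr.
Proof.
have mI (i : interval R) : measurable_fun setT (\1_([set` i]) : T -> R) by exact: measurable_indic.
apply: measurable_funB.
  apply: measurable_funM => //; apply: measurable_sum => j.
  exact: (measurable_coord_prod (f := fun i => \1_(`]P j 0 i, 1[%classic : set R))).
apply: (measurable_coord_prod (f := fun i y => \1_(`[0, 1[%classic : set R) y * y)) => i.
exact: measurable_funM.
Qed.

Lemma normr_discr t : `|discr t| <= 2 * \prod_i \1_(`[0, 1[%classic : set R) (tnth t i).
Proof.
rewrite -discrE cube_indic.
have p0 : 0 <= \prod_i \1_(`[0, 1[%classic : set R) (tnth t i) :> R.
  by apply: prodr_ge0 => i _; rewrite indicE ler0n.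
have [tc|tc] := boolP (rV_of_tuple t \in cube); last first.
  by rewrite -cube_indic indicE (negbTE tc) mul0r mulr0 normr0.
rewrite normrM ger0_norm// mulrC ler_wpM2r// /discrepancy.
apply: le_trans (ler_normB _ _) _; rewrite (_ : 2 = 1 + 1 :> R)//; apply: lerD.
  rewrite normrM ger0_norm ?invr_ge0// mulrC ler_pdivrMr ?ltr0n// mul1r.
  rewrite ger0_norm; last by apply: sumr_ge0 => j _; rewrite indicE ler0n.
  rewrite -[X in _ <= X%:R]card_ord -sum1_card natr_sum.
  by apply: ler_sum => j _; rewrite indicE; case: (_ \in _).
rewrite normr_prod; apply: (@le_trans _ _ (\prod_(i < d) 1)); last by rewrite big1.
apply: ler_prod => i _; rewrite normr_ge0/=.
by move: tc; rewrite inE => /(_ i)/andP[h0 h1]; rewrite ger0_norm// ltW.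
Qed.

Lemma cube_distr_discr (f : 'rV[R]_d -> R[i]) :
  cube_distr (discrepancy P) f = cint mu (fun t => (discr t)%:C * f (rV_of_tuple t)).
Proof.
rewrite /cube_distr cintegral_indic; last exact: measurable_cube.
by apply: eq_cint => t; rewrite mulrA -rmorphM /= discrE.
Qed.

Lemma integrable_cube_indic :
  mu.-integrable setT (EFin \o (fun t => \prod_i (\1_(`[0, 1[%classic : set R) (tnth t i) : R))).
Proof.
apply: (integrable_coord_prod (f := fun=> \1_(`[0, 1[%classic : set R))) => [_|_ x].
  exact: (@integrable_indic_itv R 0 1 true true).
by rewrite indicE ler0n.
Qed.

Lemma discr_schwartz_cintg f : schwartz f ->
  cintg mu (fun t => (discr t)%:C * f (rV_of_tuple t)).
Proof.
move=> sf; have [S _ fS] := schwartz_bounded sf.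
apply: (cintg_dom (g := fun t : d.-tuple T => S * 2 * \prod_i (\1_(`[0, 1[%classic : set R) (tnth t i) : R))).
- apply: cmeasM; last exact: schwartz_cmeas.
  apply: cmeas_real; exact: measurable_discr.
- exact/integrableZ_EFin/integrable_cube_indic.
- move=> t; rewrite Normc.normcM normc_real mulrC -mulrA.
  by apply: ler_pM; rewrite ?normc_ge0// normr_discr.
Qed.

Lemma tempered_cube_distr : tempered (cube_distr (discrepancy P)).
Proof.
split=> [a f g sf sg|].
  rewrite !cube_distr_discr -cintZ; last exact: discr_schwartz_cintg.
  rewrite -cintD; last 2 first.
  - exact/cintgZ/discr_schwartz_cintg.
  - exact: discr_schwartz_cintg.
  by apply: eq_cint => t; rewrite mulrDr; congr (_ + _); rewrite mulrCA.
exists 0%N, (2 * \int[mu]_t (2 * \prod_i \1_(`[0, 1[%classic : set R) (tnth t i))) => f sf.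
have [S -> fS] := schwartz_bounded sf.
rewrite -EFinM lee_fin cube_distr_discr.
have iI := integrableZ_EFin 2 integrable_cube_indic.
have := @normc_cint _ _ _ mu (fun t => (discr t)%:C * f (rV_of_tuple t)) _ _ (integrableZ_EFin S iI).
move=> h; apply: le_trans (h _ _) _.
- apply: cmeasM; last exact: schwartz_cmeas.
  apply: cmeas_real; exact: measurable_discr.
- move=> t; rewrite Normc.normcM normc_real mulrC.
  by apply: ler_pM; rewrite ?normc_ge0// normr_discr.
- by rewrite RintegralZl// mulrA mulrAC.
Qed.

End discrepancy_distribution.

(** * Continuity and representation of the blocks *)

Section discrepancy_blocks.
Context {R : realType} (phi0 : R -> R[i]).
Hypothesis hphi0 : lp_cutoff phi0.
Variables (Th : R -> R[i]) (K B : R).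
Local Notation ker := (ker0 phi0).
Hypotheses (K0 : 0 <= K) (B1 : 1 <= B)
  (dTh : forall u : R, is_derive u 1 (fun x => complex.Re (Th x)) (complex.Re (ker u)) /\
     is_derive u 1 (fun x => complex.Im (Th x)) (complex.Im (ker u)))
  (ThD1 : forall u h, `|h| <= B -> normc (Th (u + h) - Th u) <= K * `|h| * tau u ^+ 2)
  (kerK : forall u, normc (ker u) <= K * tau u ^+ 3).
Local Notation T := (measurableTypeR R).
Local Notation leb := (@lebesgue_measure R).

Let kc := ker0_continuous hphi0.

Lemma jump_lipschitz k x x' z : 0 <= z <= 1 -> 2 ^+ k * `|x - x'| <= B ->
  normc (jump ker k x z - jump ker k x' z) <= 34 * K * 2 ^+ k * `|x - x'|.
Proof.
move=> z01 xB; rewrite !(jumpE dTh kc)//.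
have H w : normc (Thk Th k (x - w) - Thk Th k (x' - w)) <= 17 * K * (2 ^+ k * `|x - x'|).
  have := Thk_diff1 K0 ThD1 (x' - w) xB.
  rewrite (_ : x' - w + (x - x') = x - w); last by ring.
  move=> h; apply: le_trans h _; rewrite ler_piMr ?mulr_ge0 ?exprn_ge0//.
  by rewrite exprn_ile1 ?tau_ge0 ?tau_le1.
rewrite (_ : _ - _ = (Thk Th k (x - z) - Thk Th k (x' - z)) -
   (Thk Th k (x - 1) - Thk Th k (x' - 1))); last by ring.
apply: le_trans (normcB _ _) _; apply: le_trans (lerD (H _) (H _)) _.
by rewrite le_eqVlt; apply/orP; left; apply/eqP; ring.
Qed.

(** The bound for jumps passes to their Riemann means and then to the limit: N is chosen so that the
    two Riemann errors, 32 K 2^k / N together, are at most e. *)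
Lemma ramp_lipschitz k x x' : 2 ^+ k * `|x - x'| <= B ->
  normc (ramp ker k x - ramp ker k x') <= 34 * K * 2 ^+ k * `|x - x'|.
Proof.
move=> xB; apply/ler_addgt0Pr => e e0.
have [N [N0 Ne]] : exists N : nat, (0 < N)%N /\ 32 * K * 2 ^+ k / N%:R <= e.
  pose M := 32 * K * 2 ^+ k / e.
  have M0 : 0 <= M by rewrite divr_ge0 ?mulr_ge0 ?exprn_ge0// ltW.
  exists (Num.truncn M).+1; split => //.
  have -> : 32 * K * 2 ^+ k = M * e by rewrite divfK// gt_eqF.
  by rewrite ler_pdivrMr ?ltr0n// mulrC ler_wpM2l// ltW// truncnS_gt.
pose A y := N%:R^-1 * \sum_(m < N) jump ker k y (m%:R / N%:R).
have mN (m : 'I_N) : 0 <= (m%:R / N%:R : R) <= 1.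
  by rewrite divr_ge0//= ler_pdivrMr ?ltr0n// mul1r ler_nat ltnW.
have rA y : normc (ramp ker k y - A y) <= 16 * K * 2 ^+ k / N%:R.
  have := ramp_riemann K0 kc kerK k y N0.
  by apply: le_trans; rewrite ler_peMl ?normc_ge0// lerDl sqr_ge0.
have AL : normc (A x - A x') <= 34 * K * 2 ^+ k * `|x - x'|.
  rewrite /A -mulrBr -sumrB Normc.normcM -real_complexV_nat normc_real ger0_norm ?invr_ge0//.
  rewrite mulrC ler_pdivrMr ?ltr0n//; apply: le_trans (normc_sum _ _ _) _.
  apply: le_trans (ler_sum _ (fun m _ => jump_lipschitz (mN m) xB)) _.
  by rewrite sumr_const card_ord mulr_natr.
have split4 (r r' c c' : R[i]) : r - r' = (r - c) - (r' - c') + (c - c') by ring.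
rewrite (split4 _ _ (A x) (A x')).
apply: le_trans (le_normcD _ _) _; rewrite addrC; apply: lerD => //.
apply: le_trans (normcB _ _) _; apply: le_trans (lerD (rA _) (rA _)) _.
by apply: le_trans Ne; rewrite -mulrDl -mulrDl -mulrDl -natrD.
Qed.

Lemma jump_continuous k z : 0 <= z <= 1 ->
  continuous (fun x => complex.Re (jump ker k x z)) /\
  continuous (fun x => complex.Im (jump ker k x z)).
Proof.
move=> z01; apply: (@lipschitz_complex_continuous _ _ (34 * K * 2 ^+ k) (B / 2 ^+ k)).
- by rewrite divr_gt0 ?exprn_gt0// (lt_le_trans ltr01).
- by rewrite !mulr_ge0 ?exprn_ge0.
- by move=> x x' xB; apply: jump_lipschitz; rewrite // mulrC -ler_pdivlMr ?exprn_gt0.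
Qed.

Lemma ramp_continuous k : continuous (fun x => complex.Re (ramp ker k x)) /\
  continuous (fun x => complex.Im (ramp ker k x)).
Proof.
apply: (@lipschitz_complex_continuous _ _ (34 * K * 2 ^+ k) (B / 2 ^+ k)).
- by rewrite divr_gt0 ?exprn_gt0// (lt_le_trans ltr01).
- by rewrite !mulr_ge0 ?exprn_ge0.
- by move=> x x' xB; apply: ramp_lipschitz; rewrite // mulrC -ler_pdivlMr ?exprn_gt0.
Qed.

Context {d N : nat} (P : 'I_N -> 'rV[R]_d).
Hypotheses (N0 : (0 < N)%N) (P01 : forall j i, 0 <= P j 0 i < 1).
Local Notation mu := (@lebesgue_tuple R d).

(** The convolution of [discr] with the product of the kernels [kerk], evaluated coordinate by
    coordinate (see [kprod_discr_cint]). *)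
Definition discr_block (k : {ffun 'I_d -> nat}) (x : 'rV[R]_d) : R[i] :=
  N%:R^-1 * \sum_j \prod_i jump ker (k i) (x 0 i) (P j 0 i)
    - \prod_i ramp ker (k i) (x 0 i).

Let ccont (f : 'rV[R]_d -> R[i]) := continuous (fun x => complex.Re (f x)) /\
  continuous (fun x => complex.Im (f x)).

Let ccont_coord (f : R -> R[i]) i : continuous (fun x => complex.Re (f x)) /\
  continuous (fun x => complex.Im (f x)) -> ccont (fun x => f (x 0 i)).
Proof.
move=> [c1 c2]; have cc : continuous (fun x : 'rV[R]_d => x 0 i) by exact: coord_continuous.
split => x.
  exact: (@continuous_comp _ _ _ (fun x : 'rV[R]_d => x 0 i) (fun y => complex.Re (f y)) x (cc x) (c1 (x 0 i))).
exact: (@continuous_comp _ _ _ (fun x : 'rV[R]_d => x 0 i) (fun y => complex.Im (f y)) x (cc x) (c2 (x 0 i))).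
Qed.

Let ccont_cst a : ccont (fun=> a).
Proof. by split; apply: cst_continuous. Qed.

Let ccontD f g : ccont f -> ccont g -> ccont (fun x => f x + g x).
Proof.
move=> [f1 f2] [g1 g2]; split.
  by under eq_fun do rewrite complex_ReD; move=> x; exact: cvgD (f1 x) (g1 x).
by under eq_fun do rewrite complex_ImD; move=> x; exact: cvgD (f2 x) (g2 x).
Qed.

Let ccontM f g : ccont f -> ccont g -> ccont (fun x => f x * g x).
Proof. exact: mul_complex_continuous. Qed.

Let ccont_prod (I : finType) (F : I -> 'rV[R]_d -> R[i]) : (forall i, ccont (F i)) ->
  ccont (fun x => \prod_i F i x).
Proof.
move=> cF; elim: (index_enum I) => [|i s IH].
  by rewrite (_ : (fun _ => _) = (fun=> 1)); [exact: ccont_cst|apply/funext => x; rewrite big_nil].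
by rewrite (_ : (fun _ => _) = (fun x => F i x * \prod_(i <- s) F i x)); [exact: ccontM|apply/funext => x; rewrite big_cons].
Qed.

Let ccont_sum (I : finType) (F : I -> 'rV[R]_d -> R[i]) : (forall i, ccont (F i)) ->
  ccont (fun x => \sum_i F i x).
Proof.
move=> cF; elim: (index_enum I) => [|i s IH].
  by rewrite (_ : (fun _ => _) = (fun=> 0)); [exact: ccont_cst|apply/funext => x; rewrite big_nil].
by rewrite (_ : (fun _ => _) = (fun x => F i x + \sum_(i <- s) F i x)); [exact: ccontD|apply/funext => x; rewrite big_cons].
Qed.

Lemma discr_block_continuous k : ccontinuous (discr_block k).
Proof.
rewrite (_ : discr_block k = (fun x => N%:R^-1 * (\sum_j \prod_i jump ker (k i) (x 0 i) (P j 0 i))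
    + (-1) * \prod_i ramp ker (k i) (x 0 i))); last by apply/funext => x; rewrite mulN1r.
apply: ccontD.
  apply: ccontM => //; apply: ccont_sum => j; apply: ccont_prod => i.
  apply: (ccont_coord (f := fun y => jump ker (k i) y (P j 0 i))).
  by apply: jump_continuous; case/andP: (P01 j i) => -> /ltW.
apply: ccontM => //; apply: ccont_prod => i.
by apply: (ccont_coord (f := fun y => ramp ker (k i) y)); exact: ramp_continuous.
Qed.

End discrepancy_blocks.

Section block_representation.
Context {R : realType} (phi0 : R -> R[i]).
Hypothesis hphi0 : lp_cutoff phi0.
Variable K : R.
Local Notation ker := (ker0 phi0).
Hypotheses (K0 : 0 <= K) (kerK : forall u, normc (ker u) <= K * tau u ^+ 3).
Local Notation T := (measurableTypeR R).
Local Notation leb := (@lebesgue_measure R).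
Context {d N : nat} (P : 'I_N -> 'rV[R]_d).
Hypotheses (N0 : (0 < N)%N) (P01 : forall j i, 0 <= P j 0 i < 1).
Local Notation mu := (@lebesgue_tuple R d).
Variable k : {ffun 'I_d -> nat}.
Implicit Types (f : 'rV[R]_d -> R[i]) (x y xi : d.-tuple T).

Let kc := ker0_continuous hphi0.

Let kprod y x : R[i] := \prod_i kerk ker (k i) (tnth x i - tnth y i).

Let pexp u xi : R[i] :=
  \prod_i (dyadic_piece phi0 (k i) (tnth xi i) * expi (tnth u i * tnth xi i)).

Let kprod_bound y x : normc (kprod y x) <= \prod_i (2 * K * 2 ^+ k i).
Proof.
rewrite normc_prod; apply: ler_prod => i _; rewrite normc_ge0/=.
exact: kerk_bound_cst.
Qed.

Let piece_cmeas (i : 'I_d) : cmeas (dyadic_piece phi0 (k i) : T -> R[i]).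
Proof. exact: cintg_meas (piece_cintg1 hphi0 (k i)). Qed.

Let cmeas_cont (D : measure_display) (S : measurableType D) (g : R -> R[i]) (h : S -> T) :
  continuous (fun x : R => complex.Re (g x)) /\ continuous (fun x : R => complex.Im (g x)) ->
  measurable_fun setT h -> cmeas (fun s => g (h s)).
Proof.
move=> [c1 c2] mh; split.
  exact: (measurableT_comp (continuous_measurable_fun c1) mh).
exact: (measurableT_comp (continuous_measurable_fun c2) mh).
Qed.

Let tnth_fst (i : 'I_d) : measurable_fun setT (fun u : d.-tuple T * d.-tuple T => tnth u.1 i).
Proof. exact: (measurableT_comp (measurable_tnth i) measurable_fst). Qed.

Let tnth_snd (i : 'I_d) : measurable_fun setT (fun u : d.-tuple T * d.-tuple T => tnth u.2 i).
Proof. exact: (measurableT_comp (measurable_tnth i) measurable_snd). Qed.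

Let expi_cont : continuous (fun x : R => complex.Re (expi x)) /\
  continuous (fun x : R => complex.Im (expi x)).
Proof. by split; [exact: continuous_cos|exact: continuous_sin]. Qed.

Let kprod_cmeas2 : cmeas (fun u : d.-tuple T * d.-tuple T => kprod u.1 u.2).
Proof.
apply: cmeas_prod => i; apply: cmeas_cont; first exact: (kerk_cont kc).
by apply: measurable_funB; [exact: tnth_snd|exact: tnth_fst].
Qed.

Let kprod_cmeas y : cmeas (kprod y).
Proof.
apply: cmeas_prod => i; apply: cmeas_cont; first exact: (kerk_cont kc).
by apply: measurable_funB; [exact: measurable_tnth|exact: measurable_cst].
Qed.

Let kprod_cmeasl x : cmeas (fun y => kprod y x).
Proof.
apply: cmeas_prod => i; apply: cmeas_cont; first exact: (kerk_cont kc).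
by apply: measurable_funB; [exact: measurable_cst|exact: measurable_tnth].
Qed.

Let normc_pexp u xi : normc (pexp u xi) = \prod_i normc (dyadic_piece phi0 (k i) (tnth xi i)).
Proof.
by rewrite normc_prod; apply: eq_bigr => i _; rewrite Normc.normcM normc_expi mulr1.
Qed.

Let pieces_integrable :
  mu.-integrable setT (EFin \o (fun xi => \prod_i normc (dyadic_piece phi0 (k i) (tnth xi i)))).
Proof.
apply: (integrable_coord_prod (f := fun i (z : T) => normc (dyadic_piece phi0 (k i) z))) => [i|i z].
  exact: cintg_normc (piece_cintg1 hphi0 (k i)).
exact: normc_ge0.
Qed.

Let cst_pi : R[i] := ((2 * pi) `^ (- (d%:R / 2)))%:C.

Let cst_piE : cst_pi * cst_pi = \prod_(i < d) ((2 * pi)^-1)%:C.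
Proof.
have p0 : 0 < 2 * pi :> R by rewrite mulr_gt0// pi_gt0.
rewrite -rmorphM /= -powRD; last by rewrite [X in _ ==> X]lt0r_neq0// implybT.
rewrite -opprD -splitr powRN powR_mulrn; last exact: ltW.
by rewrite prodr_const card_ord -rmorphXn /= exprVn.
Qed.

Let cst_pi_neq0 : cst_pi * cst_pi != 0.
Proof.
have p0 : 0 < 2 * pi :> R by rewrite mulr_gt0// pi_gt0.
rewrite cst_piE; apply/prodf_neq0 => i _.
by rewrite fmorph_eq0 invr_eq0 gt_eqF.
Qed.

Let pexp_cint u : cst_pi * cst_pi * cint mu (pexp u) =
  \prod_i kerk ker (k i) (tnth u i).
Proof.
rewrite /pexp (cint_coord_prod (f := fun i (z : T) => dyadic_piece phi0 (k i) z * expi (tnth u i * z))).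
  by rewrite cst_piE -big_split /=; apply: eq_bigr => i _; rewrite piece_cint.
by move=> i; exact: piece_cintg.
Qed.

Let dif x y : d.-tuple T := [tuple tnth x i - tnth y i | i < d].

(** The block of a distribution is defined by duality, so the multiplier acts on the test function.
    Fubini moves the integral over frequencies inside, where it is the product kernel at x - y; the
    two normalizing constants combine to 1 / (2 pi) per coordinate. *)
Lemma fourier_block f y : schwartz f ->
  fourier (fun z => dyadic_prod phi0 k z * inv_fourier f z) (rV_of_tuple y) =
  cint mu (fun x => f (rV_of_tuple x) * kprod y x).
Proof.
move=> sf; have mf := schwartz_cmeas sf; have nf := schwartz_normc_integrable sf.
have fk_i : cintg mu (fun x => f (rV_of_tuple x) * kprod y x).
  apply: (cintg_dom (g := fun x : d.-tuple T => \prod_i (2 * K * 2 ^+ k i) * normc (f (rV_of_tuple x)))).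
  - by apply: cmeasM.
  - exact: integrableZ_EFin.
  - by move=> x; rewrite Normc.normcM mulrC ler_wpM2r ?normc_ge0.
pose G (u : d.-tuple T * d.-tuple T) := pexp (dif u.2 y) u.1 * f (rV_of_tuple u.2).
have mG : cmeas G.
  apply: cmeasM.
    apply: cmeas_prod => i; apply: cmeasM.
      have [m1 m2] := piece_cmeas i.
      by split; [exact: (measurableT_comp m1 (tnth_fst i))|exact: (measurableT_comp m2 (tnth_fst i))].
    apply: cmeas_cont => //; apply: measurable_funM; last exact: tnth_fst.
    rewrite (_ : (fun _ => _) = (fun u : d.-tuple T * d.-tuple T => tnth u.2 i - tnth y i)).
      by apply: measurable_funB => //; exact: tnth_snd.
    by apply/funext => u; rewrite tnth_mktuple.
  have [m1 m2] := mf.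
  by split; [exact: (measurableT_comp m1 measurable_snd)|exact: (measurableT_comp m2 measurable_snd)].
have Gab xi x : normc (G (xi, x)) <=
    (\prod_i normc (dyadic_piece phi0 (k i) (tnth xi i))) * normc (f (rV_of_tuple x)).
  by rewrite Normc.normcM normc_pexp.
have a0 xi : 0 <= \prod_i normc (dyadic_piece phi0 (k i) (tnth xi i)).
  by apply: prodr_ge0 => i _; exact: normc_ge0.
have b0 x : 0 <= normc (f (rV_of_tuple x)) by exact: normc_ge0.
have inner xi : dyadic_prod phi0 k (rV_of_tuple xi) * inv_fourier f (rV_of_tuple xi) *
     expi (- dotr (rV_of_tuple xi) (rV_of_tuple y)) = cst_pi * cint mu (fun x => G (xi, x)).
  pose p := dyadic_prod phi0 k (rV_of_tuple xi) * expi (- dotr (rV_of_tuple xi) (rV_of_tuple y)).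
  have -> : cint mu (fun x => G (xi, x)) =
      p * cint mu (fun x => f (rV_of_tuple x) * expi (dotr (rV_of_tuple xi) (rV_of_tuple x))).
    rewrite -cintZ; last first.
      apply: (cintg_dom (g := fun x : d.-tuple T => normc (f (rV_of_tuple x)))) => //.
        apply: cmeasM => //; apply: cmeas_cont => //.
        rewrite /dotr; apply: measurable_sum => i; apply: measurable_funM => //.
        by under eq_fun do rewrite mxE; exact: measurable_tnth.
      by move=> x; rewrite Normc.normcM normc_expi mulr1.
    apply: eq_cint => x; rewrite /G /= [RHS]mulrCA [LHS]mulrC; congr (_ * _).
    rewrite /p /pexp /dyadic_prod /dotr -sumrN !expi_sum big_split /= -mulrA.
    congr (_ * _); first by apply: eq_bigr => i _; rewrite mxE.
    rewrite -big_split /=; apply: eq_bigr => i _.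
    by rewrite -expiD tnth_mktuple !mxE; congr expi; ring.
  have mAC (a c I e : R[i]) : a * (c * I) * e = c * ((a * e) * I) by ring.
  rewrite /inv_fourier cintegralT; exact: mAC.
rewrite /fourier cintegralT -/cst_pi.
under eq_cint do rewrite inner.
rewrite cintZ; last exact: (cfubini_cintg1 pieces_integrable nf a0 b0 mG Gab).
rewrite (cfubini pieces_integrable nf a0 b0 mG Gab) mulrA.
have Gx x : cint mu (fun xi => G (xi, x)) = (cst_pi * cst_pi)^-1 * (f (rV_of_tuple x) * kprod y x).
  rewrite /G /=; under eq_cint do rewrite mulrC.
  rewrite cintZ; last first.
    apply: (cintg_coord_prod (f := fun i z => dyadic_piece phi0 (k i) z * expi (tnth (dif x y) i * z))) => i.
    exact: piece_cintg.
  rewrite mulrCA; congr (_ * _); apply: (mulfI cst_pi_neq0).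
  rewrite mulVKf// pexp_cint; apply: eq_bigr => i _.
  by rewrite tnth_mktuple.
under eq_cint do rewrite Gx.
by rewrite cintZ// mulVKf.
Qed.

Lemma kprod_discr_cint x :
  cint mu (fun y => (discr P y)%:C * kprod y x) = discr_block phi0 P k (rV_of_tuple x).
Proof.
have ji j i : cintg leb (fun z : T => (\1_(`]P j 0 i, 1[%classic : set R) z)%:C *
    kerk ker (k i) (tnth x i - z)).
  by apply: (jump_cintg K0 kc kerK); case/andP: (P01 j i).
have ri i : cintg leb (fun z : T => (\1_(`[0, 1[%classic : set R) z * z)%:C *
    kerk ker (k i) (tnth x i - z)).
  exact: (ramp_cintg K0 kc kerK).
have H y : (discr P y)%:C * kprod y x =
   N%:R^-1 * (\sum_j \prod_i ((\1_(`]P j 0 i, 1[%classic : set R) (tnth y i))%:C *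
      kerk ker (k i) (tnth x i - tnth y i))) -
   \prod_i ((\1_(`[0, 1[%classic : set R) (tnth y i) * tnth y i)%:C *
      kerk ker (k i) (tnth x i - tnth y i)).
  rewrite /discr rmorphB /= rmorphM /= real_complexV_nat real_complex_sum mulrBl.
  congr (_ - _); last by rewrite rmorph_prod -big_split.
  rewrite -mulrA; congr (_ * _); rewrite mulr_suml; apply: eq_bigr => j _.
  by rewrite rmorph_prod -big_split.
under eq_cint do rewrite H.
have Pj j : cintg mu (fun y : d.-tuple T => \prod_i ((\1_(`]P j 0 i, 1[%classic : set R) (tnth y i))%:C *
      kerk ker (k i) (tnth x i - tnth y i))).
  exact: (cintg_coord_prod (f := fun i z => (\1_(`]P j 0 i, 1[%classic : set R) z)%:C *
    kerk ker (k i) (tnth x i - z))).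
rewrite cintB; last 2 first.
- by apply/cintgZ/cintg_sum.
- exact: (cintg_coord_prod (f := fun i z => (\1_(`[0, 1[%classic : set R) z * z)%:C *
    kerk ker (k i) (tnth x i - z))).
rewrite cintZ; last exact: cintg_sum.
have EJ j : cint mu (fun y : d.-tuple T => \prod_i ((\1_(`]P j 0 i, 1[%classic : set R) (tnth y i))%:C *
      kerk ker (k i) (tnth x i - tnth y i))) = \prod_i jump ker (k i) (rV_of_tuple x 0 i) (P j 0 i).
  rewrite (cint_coord_prod (ji j)).
  by apply: eq_bigr => i _; rewrite mxE.
have ER : cint mu (fun y : d.-tuple T => \prod_i ((\1_(`[0, 1[%classic : set R) (tnth y i) * tnth y i)%:C *
      kerk ker (k i) (tnth x i - tnth y i))) = \prod_i ramp ker (k i) (rV_of_tuple x 0 i).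
  rewrite (cint_coord_prod ri).
  by apply: eq_bigr => i _; rewrite mxE.
rewrite (cint_sum _ _ Pj) ER.
apply: (congr1 (fun z => N%:R^-1 * z - \prod_i ramp ker (k i) (rV_of_tuple x 0 i))).
by apply: eq_bigr => j _; exact: EJ.
Qed.

(** A second use of Fubini moves the kernel from the test function to [discr]. *)
Lemma discr_block_cint f : schwartz f ->
  cintg mu (fun x => discr_block phi0 P k (rV_of_tuple x) * f (rV_of_tuple x)) /\
  dyadic_block phi0 k (cube_distr (discrepancy P)) f =
    cint mu (fun x => discr_block phi0 P k (rV_of_tuple x) * f (rV_of_tuple x)).
Proof.
move=> sf; have mf := schwartz_cmeas sf; have nf := schwartz_normc_integrable sf.
pose G (u : d.-tuple T * d.-tuple T) := ((discr P u.1)%:C * kprod u.1 u.2) * f (rV_of_tuple u.2).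
have md : cmeas (fun y => (discr P y)%:C : R[i]) by apply: cmeas_real; exact: measurable_discr.
have mG : cmeas G.
  apply: cmeasM.
    apply: cmeasM => //; have [m1 m2] := md.
    by split; [exact: (measurableT_comp m1 measurable_fst)|exact: (measurableT_comp m2 measurable_fst)].
  have [m1 m2] := mf.
  by split; [exact: (measurableT_comp m1 measurable_snd)|exact: (measurableT_comp m2 measurable_snd)].
pose C := 2 * \prod_i (2 * K * 2 ^+ k i).
pose a y : R := C * \prod_i \1_(`[0, 1[%classic : set R) (tnth y i).
have ia : mu.-integrable setT (EFin \o a) by exact/integrableZ_EFin/integrable_cube_indic.
have C0 : 0 <= C.
  by apply: mulr_ge0 => //; apply: prodr_ge0 => i _; rewrite !mulr_ge0// exprn_ge0.
have a0 y : 0 <= a y.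
  by apply: mulr_ge0 => //; apply: prodr_ge0 => i _; rewrite indicE ler0n.
have b0 x : 0 <= normc (f (rV_of_tuple x)) by exact: normc_ge0.
have Gab y x : normc (G (y, x)) <= a y * normc (f (rV_of_tuple x)).
  rewrite /G !Normc.normcM normc_real /= ler_wpM2r ?normc_ge0// /a /C mulrAC.
  by apply: ler_pM; rewrite ?normc_ge0// normr_discr.
have Gx x : cint mu (fun y => G (y, x)) = discr_block phi0 P k (rV_of_tuple x) * f (rV_of_tuple x).
  rewrite /G /=; under eq_cint do rewrite mulrC.
  rewrite cintZ; last first.
    apply: (cintg_dom (g := a)) => //.
      by apply: cmeasM; [exact: md|exact: kprod_cmeasl].
    move=> y; rewrite Normc.normcM normc_real /a /C mulrAC.
    by apply: ler_pM; rewrite ?normc_ge0// normr_discr.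
  by rewrite kprod_discr_cint mulrC.
have Gy y : (discr P y)%:C * cint mu (fun x => f (rV_of_tuple x) * kprod y x) = cint mu (fun x => G (y, x)).
  rewrite -cintZ; first by apply: eq_cint => x; rewrite /G /= -mulrA [kprod _ _ * _]mulrC.
  apply: (cintg_dom (g := fun x : d.-tuple T => \prod_i (2 * K * 2 ^+ k i) * normc (f (rV_of_tuple x)))).
  - by apply: cmeasM.
  - exact: integrableZ_EFin.
  - by move=> x; rewrite Normc.normcM mulrC ler_wpM2r ?normc_ge0.
split.
  have mG' : cmeas (fun u : d.-tuple T * d.-tuple T => G (u.2, u.1)).
    have [m1 m2] := mG; have ms : measurable_fun setT (fun u : d.-tuple T * d.-tuple T => (u.2, u.1)).
      by apply: measurable_fun_pair; [exact: measurable_snd|exact: measurable_fst].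
    by split; [exact: (measurableT_comp m1 ms)|exact: (measurableT_comp m2 ms)].
  have := @cfubini_cintg1 _ _ _ _ _ mu mu _ _ nf ia b0 a0 (fun u => G (u.2, u.1)) mG'.
  rewrite (_ : (fun x => _ * _) = (fun x => cint mu (fun y => G (y, x)))); last first.
    by apply/funext => x; rewrite Gx.
  by apply => x y; rewrite mulrC.
rewrite /dyadic_block /distr_inv_fourier /distr_mul /distr_fourier.
rewrite (cube_distr_discr P01); under eq_cint do rewrite fourier_block// Gy.
rewrite (cfubini ia nf a0 b0 mG Gab).
by apply: eq_cint => x; rewrite Gx.
Qed.

End block_representation.

(** * Estimates of the blocks *)

Section tau_sums.
Context {R : realType}.
Implicit Types (x u h : R).

(** The increment of atan is h times a value of tau at distance at most 1 from u, and such a shift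
    changes tau by a factor of at most 4. *)
Lemma tau_atan u h : 0 <= h <= 1 -> h * tau u <= 4 * (atan (u + h) - atan u).
Proof.
move=> /andP[h0 h1].
have dat (x : R) : is_derive x 1 (@atan R) (tau x) by exact: is_derive1_atan.
have [t /andP[t0 t1]] := mean_value u (u + h) dat.
rewrite [u + h - u]addrAC subrr add0r => ->.
rewrite [_ * h]mulrC mulrCA ler_wpM2l//.
have th : `|- (t * h)| <= 1 by rewrite normrN ger0_norm ?mulr_ge0// mulr_ile1.
have := tau_shift_sqr (u + t * h) th; rewrite addrK expr1n.
by move=> H; apply: le_trans H _; rewrite ler_wpM2r ?tau_ge0//; lra.
Qed.

(** The bounding increments of atan telescope, and atan has total variation pi. *)
Lemma sum_tau u h N : 0 <= h <= 1 -> h * \sum_(m < N) tau (m%:R * h - u) <= 4 * pi.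
Proof.
move=> h01; rewrite mulr_sumr.
apply: (@le_trans _ _ (\sum_(m < N) 4 * (atan (m.+1%:R * h - u) - atan (m%:R * h - u)))).
  apply: ler_sum => m _; have := tau_atan (m%:R * h - u) h01.
  by rewrite (_ : m%:R * h - u + h = m.+1%:R * h - u)// -natr1; ring.
rewrite -mulr_sumr ler_wpM2l//.
rewrite -(big_mkord xpredT (fun m => atan (m.+1%:R * h - u) - atan (m%:R * h - u))).
rewrite (telescope_sumr (fun m => atan (m%:R * h - u)))//.
have := @atan_ltpi2 R (N%:R * h - u); have := @atan_gtNpi2 R (0%:R * h - u); lra.
Qed.

Lemma integral_tau_scale (a z : R) : 0 < a ->
  (\int[@lebesgue_measure R]_x (tau (a * (x - z)))%:E = (pi / a)%:E)%E.
Proof.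
move=> a0.
have dF (x : R) : is_derive x 1 (fun y : R => a * (y - z)) a.
  have d1 : is_derive x 1 (fun y : R => y - z) 1.
    rewrite -[X in is_derive _ _ _ X]subr0; exact: is_deriveB.
  by have := is_derive_cstM a d1; rewrite mulr1.
have F1 : derive1 (fun y : R => a * (y - z)) = cst a.
  by apply/funext => x; rewrite derive1E; apply: derive_val.
have cF : continuous (fun y : R => a * (y - z)) by exact: is_derive_continuous dF.
have H := @increasing_ge0_integration_by_substitutionT R (fun y => a * (y - z)) (@tau R).
have E : (\int[@lebesgue_measure R]_x (tau x)%:E =
   \int[@lebesgue_measure R]_x (tau (a * (x - z)) * a)%:E)%E.
  rewrite H//.
  - by apply: eq_integral => x _; rewrite F1.
  - by move=> x y xy; rewrite ltr_pM2l// ltrD2r.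
  - by rewrite F1 => x; exact: cst_continuous.
  - by rewrite F1; exact: is_cvg_cst.
  - by rewrite F1; exact: is_cvg_cst.
  - apply/cvgrNyPle => A; near=> x.
    rewrite -ler_pdivlMl// lerBlDr; near: x; apply: nbhs_ninfty_le; exact: num_real.
  - apply/cvgryPge => A; near=> x.
    rewrite -ler_pdivrMl// lerBrDr; near: x; apply: nbhs_pinfty_ge; exact: num_real.
  - exact: continuous_tau.
  - exact: tau_ge0.
have E' : (\int[@lebesgue_measure R]_x (tau (a * (x - z)) * a)%:E =
    (\int[@lebesgue_measure R]_x (tau (a * (x - z)))%:E) * a%:E)%E.
  under eq_integral do rewrite EFinM.
  rewrite ge0_integralZr//.
  - apply/measurable_EFinP; apply: continuous_measurable_fun.
    exact: (continuous_compR cF (@continuous_tau R)).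
  - by move=> x _; rewrite lee_fin tau_ge0.
  - by rewrite lee_fin ltW.
move: E; rewrite integral_tau E'; case: (\int[_]_x _)%E => [r| |].
- by rewrite -EFinM => -[->]; rewrite mulfK// gt_eqF.
- by rewrite mulyr gtr0_sg// mul1e.
- by rewrite mulNyr gtr0_sg// mul1e.
Unshelve. all: by end_near. Qed.

End tau_sums.

(** * The factor of one coordinate as a function of digits *)

Section one_coordinate.
Context {R : realType}.
Variables (b s : nat).
Hypothesis b_prime : prime b.
Local Notation Y := 'cV['F_b]_s.
Variables (Th ker : R -> R[i]) (K : R).
Local Notation bR := (GRing.natmul (GRing.one R) b).
Hypotheses (K0 : 0 <= K)
  (dTh : forall u : R, is_derive u 1 (fun x => complex.Re (Th x)) (complex.Re (ker u)) /\
     is_derive u 1 (fun x => complex.Im (Th x)) (complex.Im (ker u)))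
  (ker_cont : continuous (fun x => complex.Re (ker x)) /\ continuous (fun x => complex.Im (ker x)))
  (Th2 : forall u, normc (Th (2 * u) - Th u) <= K * tau u ^+ 2)
  (ThD1 : forall u h, `|h| <= bR -> normc (Th (u + h) - Th u) <= K * `|h| * tau u ^+ 2)
  (ThD2 : forall u h h', `|h| <= bR -> `|h'| <= bR ->
    normc ((Th (u + h + h') - Th (u + h)) - (Th (u + h') - Th u)) <=
      K * (`|h| * `|h'|) * tau u ^+ 2)
  (kerK : forall u, normc (ker u) <= K * tau u ^+ 3).

Let b1 : 1 <= bR. Proof. by rewrite ler1n prime_gt0. Qed.
Let b0 : 0 < bR. Proof. by rewrite ltr0n prime_gt0. Qed.
Let bX0 m : 0 < bR ^+ m. Proof. by rewrite exprn_gt0. Qed.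

(* [1 / tau x]: the blocks are divided by omega = prod_i tau (x_i), and the finite
   measure omega dx replaces Lebesgue measure. *)
Definition wgt x : R := 1 + x ^+ 2.

Lemma wgt_ge1 x : 1 <= wgt x. Proof. by rewrite lerDl sqr_ge0. Qed.

Lemma normc_wgt x (z : R[i]) : normc ((wgt x)%:C * z) = wgt x * normc z.
Proof. by rewrite Normc.normcM normc_real ger0_norm// (le_trans ler01)// wgt_ge1. Qed.

(* The scale 2^-k resolves [kp k] digits in base b. *)
Definition kp k := trunc_log b (2 ^ k).

Lemma kp_le k : bR ^+ kp k <= 2 ^+ k.
Proof. by rewrite -!natrX ler_nat trunc_logP ?prime_gt1// expn_gt0. Qed.

Lemma kp_ge k : 2 ^+ k <= bR * bR ^+ kp k.
Proof. by rewrite -exprS -!natrX ler_nat ltnW// trunc_log_ltn// prime_gt1. Qed.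

Definition wg k x z : R[i] := (wgt x)%:C * gk Th k x z.
Definition wc k x : R[i] := (wgt x)%:C * ck Th k x.
(** The exact mean that belongs to [wg]: a jump is [gk] + [ck] and its mean over [0, 1] is the ramp,
    so [gk] has mean ramp - [ck]. *)
Definition we k x : R[i] := (wgt x)%:C * (ramp ker k x - ck Th k x).
(** Majorant of [wg] that sees only the first m digits of the point; 272 = 4 * 68, with 4 for moving
    from the point to its truncation. *)
Definition vv m x (y : Y) : R := 272 * K * tau (bR ^+ m * (x - zpt (ztrunc m y))).

Let z01 (y : Y) : 0 <= (zpt y : R) <= 1.
Proof. by have /andP[-> /ltW ->] := @zpt_ge0_lt1 R b s b_prime y. Qed.

Lemma normc_wc k x : normc (wc k x) <= 68 * K * tau (2 ^+ k * (x - 1)).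
Proof. by rewrite normc_wgt; exact: (ck_bound K0 Th2). Qed.

Lemma normc_wg k x z : 0 <= z <= 1 -> normc (wg k x z) <= 68 * K * tau (2 ^+ k * (x - z)).
Proof. by move=> z0; rewrite normc_wgt; exact: (gk_bound K0 b1 Th2 ThD1). Qed.

Lemma vv_ge0 m x y : 0 <= vv m x y.
Proof. by rewrite /vv !mulr_ge0 ?tau_ge0. Qed.

Lemma tau_trunc m x (y : Y) :
  tau (bR ^+ m * (x - zpt y)) <= 4 * tau (bR ^+ m * (x - zpt (ztrunc m y))).
Proof.
have h : `|bR ^+ m * (zpt (ztrunc m y) - zpt y)| <= 1.
  rewrite normrM ger0_norm ?(ltW (bX0 m))// distrC mulrC -ler_pdivlMr// mul1r.
  exact: zpt_trunc.
have := tau_shift_sqr (bR ^+ m * (x - zpt (ztrunc m y))) h.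
by rewrite -mulrDr subrKA expr1n (_ : 2 * (1 + 1) = 4 :> R)//; ring.
Qed.

Lemma tau_trunc_le m x (y : Y) :
  tau (bR ^+ m * (x - zpt (ztrunc m y))) <= 4 * tau (bR ^+ m * (x - zpt y)).
Proof.
have h : `|bR ^+ m * (zpt y - zpt (ztrunc m y))| <= 1.
  rewrite normrM ger0_norm ?(ltW (bX0 m))// mulrC -ler_pdivlMr// mul1r.
  exact: zpt_trunc.
have := tau_shift_sqr (bR ^+ m * (x - zpt y)) h.
by rewrite -mulrDr subrKA expr1n (_ : 2 * (1 + 1) = 4 :> R)//; ring.
Qed.

Lemma tau_scale_le m k x z : (m <= kp k)%N -> tau (2 ^+ k * (x - z)) <= tau (bR ^+ m * (x - z)).
Proof.
move=> mk; apply: tau_le; rewrite !exprMn ler_wpM2r ?sqr_ge0//.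
rewrite lerXn2r ?nnegrE ?exprn_ge0 ?(ltW b0)//.
by apply: le_trans (kp_le k); rewrite ler_weXn2l.
Qed.

Lemma wg_vv_aux m k x (y : Y) (C : R) : 0 <= C -> (m <= kp k)%N ->
  68 * K * C * tau (2 ^+ k * (x - zpt y)) <= C * vv m x y.
Proof.
move=> C0 mk; rewrite /vv [leRHS](_ : _ = 68 * K * C * (4 * tau (bR ^+ m * (x - zpt (ztrunc m y))))); last by ring.
rewrite ler_wpM2l ?mulr_ge0//.
exact: le_trans (tau_scale_le _ _ mk) (tau_trunc _ _ _).
Qed.

Lemma wg_vv m k x (y : Y) : (m <= kp k)%N -> normc (wg k x (zpt y)) <= vv m x y.
Proof.
move=> mk; apply: le_trans (normc_wg _ _ (z01 y)) _.
by have := wg_vv_aux x y ler01 mk; rewrite mulr1 mul1r.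
Qed.

Lemma vv_depends m x : depends_on (fun j => j < m)%N (vv m x).
Proof.
move=> y y' yy'; rewrite /vv (_ : ztrunc m y = ztrunc m y')//.
by apply/colP => j; rewrite !mxE; case: ifP => // /yy'.
Qed.

(** 4352 = 272 * 4 * 4: the return from truncated points to the full grid, and the Riemann sum bound
    4 pi. *)
Lemma avg_vv m x : (m <= s)%N -> avg (vv m x) <= 4352 * pi * K / bR ^+ m.
Proof.
move=> ms; rewrite /vv avgZ.
apply: (@le_trans _ _ (272 * K * (4 * avg (fun y : Y => tau (bR ^+ m * (x - zpt y)))))).
  rewrite ler_wpM2l ?mulr_ge0// -avgZ; apply: ler_avg => y; exact: tau_trunc_le.
rewrite (avg_zpt s b_prime (fun z => tau (bR ^+ m * (x - z)))).
rewrite [leRHS](_ : _ = 272 * K * (4 * (4 * pi / bR ^+ m))); last by field; rewrite gt_eqF.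
rewrite ler_wpM2l ?mulr_ge0// ler_wpM2l//.
pose h := bR ^+ m / bR ^+ s.
have h01 : 0 <= h <= 1.
  by rewrite divr_ge0 ?exprn_ge0 ?(ltW b0)//= ler_pdivrMr// mul1r ler_weXn2l.
have := sum_tau (bR ^+ m * x) (b ^ s) h01.
under eq_bigr => j _.
  rewrite (_ : tau _ = tau (bR ^+ m * (x - j%:R / (b ^ s)%:R))); first over.
  by rewrite /tau /h natrX; congr (_^-1); rewrite -[in LHS]sqrrN; congr (_ + _ ^+ _); ring.
rewrite ler_pdivlMr// => H; apply: le_trans H.
by rewrite /h natrX le_eqVlt; apply/orP; left; apply/eqP; ring.
Qed.

Lemma zpt_differ_atE (j : 'I_s) (y y' : Y) : differ_at j y y' ->
  zpt y - zpt y' = ((y j 0 : nat)%:R - (y' j 0 : nat)%:R) * bR ^- j.+1.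
Proof.
move=> yy'; rewrite /zpt -sumrB (bigD1 j)//= big1 ?addr0 ?mulrBl// => k kj.
by rewrite yy'// subrr.
Qed.

Let step k (j : 'I_s) (y y' : Y) : (kp k <= j)%N -> differ_at j y y' ->
  2 ^+ k * `|zpt y - zpt y'| <= bR * bR ^+ kp k / bR ^+ j.
Proof.
move=> kj yy'; apply: ler_pM; rewrite ?exprn_ge0 ?kp_ge//.
exact: zpt_differ_at.
Qed.

Let step_le1 k (j : 'I_s) : (kp k <= j)%N -> bR ^+ kp k / bR ^+ j <= 1.
Proof. by move=> kj; rewrite ler_pdivrMr// mul1r ler_weXn2l. Qed.

Variable rho : R.
Hypotheses (rho0 : 0 < rho) (rho4 : rho ^+ 4 = bR^-1).

Let stepE k (j : 'I_s) : (kp k <= j)%N ->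
  bR * bR ^+ kp k / bR ^+ j = bR ^+ 2 * rho ^+ (4 * (j.+1 - kp k)).
Proof.
move=> kj; rewrite exprM rho4 exprVn subSn// -[X in _ / bR ^+ X](subnKC kj) exprD.
by rewrite (exprS bR (j - _)); field; rewrite !gt_eqF.
Qed.

Let cX (a : R) m : (a ^+ m)%:C = a%:C ^+ m :> R[i]. Proof. exact: rmorphXn. Qed.

Let cM (a c : R) : (a * c)%:C = a%:C * c%:C :> R[i]. Proof. exact: rmorphM. Qed.

(** Changing the digit of index j moves the point, in units of 2^-k, by at most b^2 rho^(4 (j + 1 -
    kp k)); two such moves give L = b^4. Changes of different digits commute, so the four points
    satisfy the parallelogram condition of [gk_diff2]. *)
Lemma dominates_wg k x : dominates rho%:C (bR ^+ 4)%:C (kp k)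
  (fun y => (vv (kp k) x y)%:C) (fun y : Y => wg k x (zpt y)).
Proof.
have sub z z' : wg k x z - wg k x z' = (wgt x)%:C * (gk Th k x z - gk Th k x z').
  by rewrite [RHS]mulrBr.
split.
- by move=> y; rewrite normC_normc lecR wg_vv.
- move=> j y y' kj yy'; rewrite normC_normc -!cX -!cM lecR sub normc_wgt.
  have st := step kj yy'.
  have stB : 2 ^+ k * `|zpt y - zpt y'| <= bR.
    by apply: le_trans st _; rewrite -mulrA ler_piMr ?(ltW b0)// step_le1.
  apply: le_trans (gk_diff1 K0 ThD1 x (z01 y) stB) _.
  rewrite stepE// in st; rewrite /cst_k.
  set q := rho ^+ _ in st *.
  have q0 : 0 <= q by rewrite exprn_ge0// ltW.
  apply: (@le_trans _ _ (68 * K * (bR ^+ 2 * q) * tau (2 ^+ k * (x - zpt y)))).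
    by rewrite ler_wpM2r ?tau_ge0// ler_wpM2l// mulr_ge0.
  have C0 : 0 <= bR ^+ 2 * q := mulr_ge0 (ltW (bX0 2)) q0.
  apply: le_trans (wg_vv_aux x y C0 (leqnn _)) _.
  by rewrite ler_wpM2r ?vv_ge0// ler_wpM2r// ler_weXn2l.
- move=> j l y00 y10 y01 y11 kj kl lj d1 d2 d3 d4.
  rewrite normC_normc -!cX -!cM lecR !sub -mulrBr normc_wgt.
  have s1 := step kj d1; have s2 := step kl d2.
  have B1 : 2 ^+ k * `|zpt y00 - zpt y10| <= bR.
    by apply: le_trans s1 _; rewrite -mulrA ler_piMr ?(ltW b0)// step_le1.
  have B2 : 2 ^+ k * `|zpt y00 - zpt y01| <= bR.
    by apply: le_trans s2 _; rewrite -mulrA ler_piMr ?(ltW b0)// step_le1.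
  have jl : j != l by rewrite neq_ltn lj orbT.
  have zz : zpt y00 - zpt y10 = zpt y01 - zpt y11 :> R.
    by rewrite (zpt_differ_atE d1) (zpt_differ_atE d4) (d2 j jl) (d3 j jl).
  apply: le_trans (gk_diff2 K0 ThD2 x (z01 y00) zz B1 B2) _.
  rewrite stepE// in s1; rewrite stepE// in s2; rewrite /cst_k.
  set q := rho ^+ _ in s1 *; set q' := rho ^+ _ in s2 *.
  have q0 : 0 <= q by rewrite exprn_ge0// ltW.
  have q0' : 0 <= q' by rewrite exprn_ge0// ltW.
  apply: (@le_trans _ _ (68 * K * (bR ^+ 2 * q * (bR ^+ 2 * q')) * tau (2 ^+ k * (x - zpt y00)))).
    by rewrite ler_wpM2r ?tau_ge0// ler_wpM2l ?mulr_ge0// ler_pM ?mulr_ge0 ?exprn_ge0.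
  have B20 : 0 <= bR ^+ 2 := ltW (bX0 2).
  have C0 : 0 <= bR ^+ 2 * q * (bR ^+ 2 * q') := mulr_ge0 (mulr_ge0 B20 q0) (mulr_ge0 B20 q0').
  apply: le_trans (wg_vv_aux x y00 C0 (leqnn _)) _.
  rewrite ler_wpM2r ?vv_ge0// le_eqVlt; apply/orP; left; apply/eqP; ring.
Qed.

(** After adding [ck] to both means this compares the ramp with the mean of the jumps over the grid
    of mesh b^-s. *)
Lemma we_avg k x : normc (we k x - avg (fun y : Y => wg k x (zpt y))) <=
  16 * bR * K * bR ^+ kp k / bR ^+ s.
Proof.
have bs0 : (0 < b ^ s)%N by rewrite expn_gt0 prime_gt0.
have E : we k x - avg (fun y : Y => wg k x (zpt y)) =
    (wgt x)%:C * (ramp ker k x - (b ^ s)%:R^-1 * \sum_(m < b ^ s) jump ker k x (m%:R / (b ^ s)%:R)).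
  rewrite /we /wg avgZ -mulrBr; congr (_ * _).
  rewrite -[in RHS](avg_zpt s b_prime (fun z => jump ker k x z)).
  have -> : avg (fun y : Y => jump ker k x (zpt y)) =
      avg (fun y : Y => gk Th k x (zpt y)) + ck Th k x.
    rewrite -[in RHS](avg_cst (ck Th k x) (card_cV_gt0 b s)) -avgD; apply: eq_avg => y.
    by rewrite gk_ck (jumpE dTh ker_cont).
  by rewrite opprD addrCA addrC.
rewrite E normc_wgt; apply: le_trans (ramp_riemann K0 ker_cont kerK k x bs0) _.
rewrite natrX ler_wpM2r ?invr_ge0 ?exprn_ge0 ?(ltW b0)//.
rewrite [leRHS](_ : _ = 16 * K * (bR * bR ^+ kp k)); last by ring.
by rewrite ler_wpM2l ?mulr_ge0// kp_ge.
Qed.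

Lemma normc_avg_wg k x : (kp k <= s)%N ->
  normc (avg (fun y : Y => wg k x (zpt y))) <= 4352 * pi * K / bR ^+ kp k.
Proof.
move=> ks; apply: le_trans (avg_vv x ks).
rewrite -lecR -normC_normc; apply: le_trans (norm_avg _) _.
rewrite /avg rmorphM /= real_complexV_nat real_complex_sum.
rewrite ler_wpM2l ?invr_ge0 ?ler0n//; apply: ler_sum => y _.
by rewrite normC_normc lecR wg_vv.
Qed.

End one_coordinate.

Lemma prod_bool_expand (K : comNzRingType) (I : finType) (F : I -> bool -> K) :
  \prod_i (F i true + F i false) = \sum_(u : {ffun I -> bool}) \prod_i F i (u i).
Proof.
rewrite -bigA_distr_bigA; apply: eq_bigr => i _.
by rewrite big_bool.
Qed.

Lemma prod_diff_le (R : realType) (I : Type) (r : seq I) (a c : I -> R[i]) (B e : I -> R) :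
  (forall i, 0 <= e i) ->
  (forall i, normc (a i) <= B i) -> (forall i, normc (c i) <= B i) ->
  (forall i, normc (a i - c i) <= e i * B i) ->
  normc (\prod_(i <- r) a i - \prod_(i <- r) c i) <=
    (\sum_(i <- r) e i) * \prod_(i <- r) B i.
Proof.
move=> e0 aB cB acB; have B0 i : 0 <= B i := le_trans (normc_ge0 _) (aB i).
elim: r => [|i r IH]; first by rewrite !big_nil subrr Normc.normc0 mul0r.
rewrite !big_cons; set A := \prod_(j <- r) a j in IH *; set C := \prod_(j <- r) c j in IH *.
have -> : a i * A - c i * C = a i * (A - C) + (a i - c i) * C by ring.
apply: le_trans (le_normcD _ _) _; rewrite !Normc.normcM mulrDl addrC; apply: lerD.
  rewrite mulrA; apply: ler_pM; rewrite ?normc_ge0//.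
  by rewrite /C normc_prod; apply: ler_prod => j _; rewrite normc_ge0 cB.
rewrite mulrCA; apply: ler_pM; rewrite ?normc_ge0//.
Qed.

(** * The error of the net on one block *)

Section kernel_profile.
Context {R : realType}.

Record kernel_profile (B K : R) (ker Th : R -> R[i]) : Prop := KernelProfile {
  profile_ge1 : 1 <= K;
  profile_derive : forall u : R,
    is_derive u 1 (fun x => complex.Re (Th x)) (complex.Re (ker u)) /\
    is_derive u 1 (fun x => complex.Im (Th x)) (complex.Im (ker u));
  profile_continuous : continuous (fun x : R => complex.Re (ker x)) /\
    continuous (fun x : R => complex.Im (ker x));
  profile_dilation : forall u, normc (Th (2 * u) - Th u) <= K * tau u ^+ 2;
  profile_diff : forall u h, `|h| <= B -> normc (Th (u + h) - Th u) <= K * `|h| * tau u ^+ 2;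
  profile_diff2 : forall u h h', `|h| <= B -> `|h'| <= B ->
    normc ((Th (u + h + h') - Th (u + h)) - (Th (u + h') - Th u)) <=
      K * (`|h| * `|h'|) * tau u ^+ 2;
  profile_kernel : forall u, normc (ker u) <= K * tau u ^+ 3 }.

End kernel_profile.

Lemma net_exponentE n v S : (v <= 2 * n)%N -> (S <= n)%N ->
  (3 * (2 * n - v) + 3 * v = 6 * (n - S) + 6 * S)%N.
Proof. lia. Qed.

(** With a resolved digits the grid mean misses the exact one by a relative error b^-(s - 2 a). As s
    >= 2 n and a <= S, this is no larger than the net error rho^(6 (n - S)) = b^(-3/2 (n - S)). *)
Lemma net_exponent_le n s S a : (2 * n <= s)%N -> (S <= n)%N -> (a <= S)%N ->
  [/\ (a <= s)%N, (2 * a <= s)%N & (6 * (n - S) <= 4 * (s - 2 * a))%N].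
Proof. by move=> *; split; lia. Qed.

Lemma leq_double_trans n s a : (2 * n <= s)%N -> (a <= n)%N -> (a <= s)%N.
Proof. lia. Qed.

Lemma leq_add_sub_uphalf n v : (n <= v + (n - uphalf v))%N.
Proof. rewrite uphalf_half; have := odd_double_half v; lia. Qed.

Section net_blocks.
Context {R : realType}.
Variables (b d : nat).
Hypothesis b_prime : prime b.
Local Notation bR := (GRing.natmul (GRing.one R) b).
Variables (Th ker : R -> R[i]) (K : R).
Hypothesis prf : kernel_profile bR K ker Th.

Let b1 : 1 <= bR. Proof. by rewrite ler1n prime_gt0. Qed.
Let b0 : 0 < bR. Proof. by rewrite ltr0n prime_gt0. Qed.
Let bX0 m : 0 < bR ^+ m. Proof. by rewrite exprn_gt0. Qed.
Let K1 : 1 <= K := profile_ge1 prf.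
Let K0 : 0 <= K := le_trans ler01 K1.
Let dTh := profile_derive prf.
Let kc := profile_continuous prf.
Let Th2 := profile_dilation prf.
Let ThD1 := profile_diff prf.
Let ThD2 := profile_diff2 prf.
Let kerK := profile_kernel prf.

(** One constant for a factor of any kind: the mean of the majorant (4352 pi K), the Riemann error
    (16 b K), and the boundary term (68 K). *)
Definition blkM : R := (4352 * pi + 16 * bR) * K.

Let pi1 : 1 <= pi :> R. Proof. by apply: le_trans (pi_ge2 R); rewrite ler1n. Qed.

Lemma blkM_ge : 68 * K <= blkM /\ 4352 * pi * K <= blkM.
Proof.
rewrite /blkM; split; apply: ler_wpM2r => //; have := pi1; have := b1; lra.
Qed.

Lemma blkM_ge1 : 1 <= blkM.
Proof. by have [h _] := blkM_ge; apply: le_trans h; have := K1; lra. Qed.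

Let M0 : 0 <= blkM := le_trans ler01 blkM_ge1.

Lemma blk_wc k x : normc (wc Th k x) <= blkM.
Proof.
apply: le_trans (normc_wc K0 Th2 k x) _; apply: le_trans (proj1 blkM_ge).
by rewrite ler_piMr ?tau_le1// mulr_ge0.
Qed.

Lemma blk_we_avg s k x : normc (we Th ker k x - avg (fun y : 'cV['F_b]_s => wg Th k x (zpt y))) <=
  blkM * bR ^+ kp b k / bR ^+ s.
Proof.
apply: le_trans (we_avg s b_prime K0 dTh kc kerK k x) _.
rewrite ler_wpM2r ?invr_ge0 ?(ltW (bX0 _))// ler_wpM2r ?(ltW (bX0 _))//.
by rewrite /blkM [leRHS]mulrDl lerDr; have := pi1; have := K0; nra.
Qed.

Lemma blk_we k x : normc (we Th ker k x) <= blkM / bR ^+ kp b k.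
Proof.
(* [we] does not involve the grid; twice the resolved digits bring the Riemann error down to the
   size b^-kp of the mean. *)
pose s := (kp b k + kp b k)%N.
pose a := avg (fun y : 'cV['F_b]_s => wg Th k x (zpt y)).
rewrite -[we Th ker k x](subrK a); apply: le_trans (le_normcD _ _) _.
have h1 : normc a <= 4352 * pi * K / bR ^+ kp b k.
  by apply: (normc_avg_wg b_prime K0 Th2 ThD1); rewrite leq_addr.
have h2 := we_avg s b_prime K0 dTh kc kerK k x.
apply: le_trans (lerD h2 h1) _.
rewrite /s exprD /blkM le_eqVlt; apply/orP; left; apply/eqP; field.
by rewrite gt_eqF.
Qed.

Variables (s n v : nat) (A : 'I_d -> 'M['F_b]_(s, n)).
Hypothesis netA : order_digital_net 2 v A.
Variables (k : {ffun 'I_d -> nat}) (x : 'I_d -> R).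
Implicit Types (u : {ffun 'I_d -> bool}).

Let N0 : (0 < b ^ n)%N. Proof. by rewrite expn_gt0 prime_gt0. Qed.
Let ns : (2 * n <= s)%N. Proof. by case: netA. Qed.
Let v2n : (v <= 2 * n)%N. Proof. by case: netA. Qed.

Definition blkF u i (y : 'cV['F_b]_s) : R[i] :=
  if u i then wg Th (k i) (x i) (zpt y) else wc Th (k i) (x i).

Definition blkE u i : R[i] :=
  if u i then we Th ker (k i) (x i) else wc Th (k i) (x i).

(* [u] selects the coordinates in which the part depending on the net is taken. *)
Definition blkT u : R[i] := netavg A (blkF u) - \prod_i blkE u i.

(** Each jump is [gk] + [ck] and each ramp (ramp - [ck]) + [ck], so both products expand over the
    same sets u of coordinates. *)
Lemma blkT_sum :
  (\prod_i (wgt (x i))%:C) * ((b ^ n)%:R^-1 * (\sum_(nu < b ^ n) \prod_i jump ker (k i) (x i) (digital_net A nu 0 i))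
     - \prod_i ramp ker (k i) (x i)) = \sum_u blkT u.
Proof.
rewrite mulrBr sumrB; congr (_ - _); last first.
  rewrite -big_split /= -[RHS](prod_bool_expand (fun i (c : bool) => if c then we Th ker (k i) (x i) else wc Th (k i) (x i))).
  by apply: eq_bigr => i _; rewrite /we /wc mulrBr subrK.
rewrite mulrCA mulr_sumr /netavg -avg_sum avg_digits//; congr (_ * _).
apply: eq_bigr => nu _; rewrite -big_split /=.
rewrite -(prod_bool_expand (fun i (c : bool) => if c then wg Th (k i) (x i) (zpt (A i *m digits nu)) else wc Th (k i) (x i))).
apply: eq_bigr => i _; rewrite /wg /wc -mulrDr gk_ck; congr (_ * _).
rewrite digital_netE (jumpE dTh kc)//.
by have /andP[-> /ltW ->] := @zpt_ge0_lt1 R b s b_prime (A i *m digits nu).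
Qed.

(** The total number of resolved digits; boundary terms are constant on the net and need none. *)
Definition blkS u := (\sum_i (if u i then kp b (k i) else 0))%N.

Definition blkG u : R := \prod_i (if u i then (bR ^+ kp b (k i))^-1 else normc (wc Th (k i) (x i))).

Variable rho : R.
Hypotheses (rho0 : 0 < rho) (rho4 : rho ^+ 4 = bR^-1).

Let rho1 : rho < 1.
Proof.
rewrite -(ltr_pXn2r (ltn0Sn 3)) ?nnegrE ?(ltW rho0)// rho4 expr1n invf_lt1//.
by rewrite ltr1n prime_gt1.
Qed.

(** The constant of [net_error] at L = b^4; dividing by rho^(3 v) turns the exponent 3 (2 n - v) - 6
    S into 6 (n - S). *)
Definition netC : R := (4 * bR ^+ 4 * bR ^+ 2) ^+ d * bR ^+ v * (2 / (1 - rho)) ^+ (2 * d) / rho ^+ (3 * v).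

Let kap u i := if u i then kp b (k i) else 0%N.

Let blkV u i (y : 'cV['F_b]_s) : R :=
  if u i then vv K (kp b (k i)) (x i) y else normc (wc Th (k i) (x i)).

Let cX (a : R) m : (a ^+ m)%:C = a%:C ^+ m :> R[i]. Proof. exact: rmorphXn. Qed.
Let cM (a c : R) : (a * c)%:C = a%:C * c%:C :> R[i]. Proof. exact: rmorphM. Qed.
Let cP (I : finType) (F : I -> R) : (\prod_i F i)%:C = \prod_i (F i)%:C :> R[i].
Proof. exact: rmorph_prod. Qed.
Let cA (T : finType) (F : T -> R) : (avg F)%:C = avg (fun y => (F y)%:C) :> R[i].
Proof. by rewrite /avg cM real_complexV_nat real_complex_sum. Qed.

(** [net_error] over R[i] with the real majorants embedded; coordinates outside u carry constants,
    whose differences vanish. *)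
Lemma blk_error_net u : (blkS u <= n)%N ->
  normc (netavg A (blkF u) - \prod_i avg (blkF u i)) <=
    netC * rho ^+ (6 * (n - blkS u)) * \prod_i avg (blkV u i).
Proof.
move=> Sn.
have kV i : depends_on (fun j => j < kap u i)%N (fun y => (blkV u i y)%:C : R[i]).
  rewrite /blkV /kap; case: (u i); last by move=> y y'.
  by move=> y y' yy'; rewrite (vv_depends K (x i) yy').
have dom i : dominates rho%:C (bR ^+ 4)%:C (kap u i) (fun y => (blkV u i y)%:C) (blkF u i).
  rewrite /blkV /kap /blkF; case: (u i).
    exact: (dominates_wg s b_prime K0 Th2 ThD1 ThD2 rho0 rho4).
  split=> *; first by rewrite normC_normc lecR.
    rewrite subrr normr0 -!cX -!cM lecR !mulr_ge0 ?exprn_ge0 ?normc_ge0 ?(ltW rho0) ?(ltW b0)//.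
  rewrite !subrr normr0 -!cX -!cM lecR !mulr_ge0 ?exprn_ge0 ?normc_ge0 ?(ltW rho0) ?(ltW b0)//.
have r0 : 0 < rho%:C :> R[i] by rewrite ltcR.
have r1 : rho%:C < 1 :> R[i] by rewrite ltcR.
have L1 : 1 <= (bR ^+ 4)%:C :> R[i] by rewrite lecR exprn_ege1.
have := net_error b_prime netA r0 r1 L1 Sn kV dom.
have -> : (b%:R : R[i]) = bR%:C by rewrite rmorph_nat.
have -> : (2 / (1 - rho%:C) : R[i]) = (2 / (1 - rho))%:C.
  by rewrite cM fmorphV rmorphB /= rmorph1 rmorph_nat.
have -> : (4 * (bR ^+ 4)%:C * bR%:C ^+ 2 : R[i]) = (4 * bR ^+ 4 * bR ^+ 2)%:C.
  have c4 : (4 : R[i]) = 4%:C by rewrite rmorph_nat.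
  by rewrite c4 -cX -!cM.
have PA : \prod_i avg (fun y => (blkV u i y)%:C) = (\prod_i avg (blkV u i))%:C :> R[i].
  by rewrite cP; apply: eq_bigr => i _; rewrite cA.
rewrite PA normC_normc -!cX -!cM lecR => H.
have rX m : 0 < rho ^+ m by rewrite exprn_gt0.
rewrite -(ler_pM2r (rX (6 * blkS u)%N)); apply: le_trans H _.
rewrite le_eqVlt; apply/orP; left; apply/eqP; rewrite /netC.
have E : rho ^+ (3 * (2 * n - v)) * rho ^+ (3 * v) = rho ^+ (6 * (n - blkS u)) * rho ^+ (6 * blkS u).
  by rewrite -!exprD; congr (_ ^+ _); exact: net_exponentE v2n Sn.
rewrite -[rho ^+ (3 * (2 * n - v))](mulfK (lt0r_neq0 (rX (3 * v)%N))) E.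
by field; rewrite !gt_eqF ?rX.
Qed.

Lemma avg_blkV u i : (blkS u <= n)%N ->
  avg (blkV u i) <= blkM * (if u i then (bR ^+ kp b (k i))^-1 else normc (wc Th (k i) (x i))).
Proof.
move=> Sn; have kn : u i -> (kp b (k i) <= s)%N.
  move=> ui; apply: leq_double_trans ns (leq_trans _ Sn).
  by rewrite /blkS (bigD1 i)//= ui leq_addr.
rewrite /blkV; case: ifP => ui; last first.
  by rewrite avg_cst ?card_cV_gt0// ler_peMl ?normc_ge0// blkM_ge1.
apply: le_trans (avg_vv b_prime K0 (x i) (kn ui)) _.
by rewrite ler_wpM2r ?invr_ge0 ?(ltW (bX0 _))// (proj2 blkM_ge).
Qed.

Lemma prod_blkM_le (F G : 'I_d -> R) : (forall i, 0 <= F i) -> (forall i, F i <= blkM * G i) ->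
  \prod_i F i <= blkM ^+ d * \prod_i G i.
Proof.
move=> F0 FG; apply: (@le_trans _ _ (\prod_i (blkM * G i))).
  by apply: ler_prod => i _; rewrite F0 FG.
by rewrite big_split /= prodr_const card_ord.
Qed.

(** Two errors add up: the net against the mean over the whole grid, and the grid mean against the
    exact one; [net_exponent_le] makes the second as small as the first. *)
Lemma blkT_low u : (blkS u <= n)%N ->
  normc (blkT u) <= (netC + d%:R) * blkM ^+ d * rho ^+ (6 * (n - blkS u)) * blkG u.
Proof.
move=> Sn.
have G0 i : 0 <= (if u i then (bR ^+ kp b (k i))^-1 else normc (wc Th (k i) (x i))).
  by case: (u i); rewrite ?normc_ge0// invr_ge0 ltW.
have VG := prod_blkM_le (fun i => avg_ge0 (F := blkV u i) _) (fun i => avg_blkV i Sn).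
have {}VG : \prod_i avg (blkV u i) <= blkM ^+ d * blkG u.
  apply: VG => i y; rewrite /blkV; case: (u i); rewrite ?normc_ge0//.
  exact: vv_ge0.
have rX m : 0 < rho ^+ m by rewrite exprn_gt0.
have netC0 : 0 <= netC.
  rewrite /netC !mulr_ge0 ?invr_ge0 ?exprn_ge0 ?mulr_ge0 ?exprn_ge0 ?invr_ge0 ?subr_ge0 ?(ltW rho1) ?(ltW rho0) ?(ltW b0)//.
have E1 : normc (netavg A (blkF u) - \prod_i avg (blkF u i)) <=
    netC * blkM ^+ d * rho ^+ (6 * (n - blkS u)) * blkG u.
  apply: le_trans (blk_error_net Sn) _.
  rewrite [leRHS](_ : _ = netC * rho ^+ (6 * (n - blkS u)) * (blkM ^+ d * blkG u)); last by ring.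
  by rewrite ler_wpM2l// mulr_ge0// ltW.
have E2 : normc (\prod_i avg (blkF u i) - \prod_i blkE u i) <=
    d%:R * blkM ^+ d * rho ^+ (6 * (n - blkS u)) * blkG u.
  pose B i := blkM * (if u i then (bR ^+ kp b (k i))^-1 else normc (wc Th (k i) (x i))).
  have kS i : u i -> (kp b (k i) <= blkS u)%N.
    by move=> ui; rewrite /blkS (bigD1 i)//= ui leq_addr.
  have := @prod_diff_le R 'I_d (index_enum _) (fun i => avg (blkF u i)) (blkE u) B
    (fun=> rho ^+ (6 * (n - blkS u))).
  have PB : \prod_i B i = blkM ^+ d * blkG u by rewrite big_split /= prodr_const card_ord.
  rewrite sumr_const card_ord PB.
  rewrite [X in _ -> _ -> _ -> _ -> _ <= X](_ : _ = d%:R * blkM ^+ d * rho ^+ (6 * (n - blkS u)) * blkG u); last first.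
    by rewrite -mulr_natl; ring.
  apply.
  - by move=> i; exact/ltW/rX.
  - move=> i; rewrite /B /blkF; case: ifP => ui.
      apply: le_trans (normc_avg_wg b_prime K0 Th2 ThD1 _ _) _.
        by have [] := net_exponent_le ns Sn (kS i ui).
      by rewrite ler_wpM2r ?invr_ge0 ?(ltW (bX0 _))// (proj2 blkM_ge).
    by rewrite avg_cst ?card_cV_gt0// ler_peMl ?normc_ge0// blkM_ge1.
  - move=> i; rewrite /B /blkE; case: ifP => ui; first exact: blk_we.
    by rewrite ler_peMl ?normc_ge0// blkM_ge1.
  - move=> i; rewrite /B /blkF /blkE; case: ifP => ui; last first.
      rewrite avg_cst ?card_cV_gt0// subrr Normc.normc0.
      exact: (mulr_ge0 (ltW (rX _)) (mulr_ge0 M0 (normc_ge0 _))).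
    rewrite -normcN opprB; apply: le_trans (blk_we_avg _ _ _) _.
    rewrite mulrCA -mulrA ler_wpM2l//.
    have H : rho ^+ (4 * (s - 2 * kp b (k i))) <= rho ^+ (6 * (n - blkS u)).
      have [_ _ h] := net_exponent_le ns Sn (kS i ui).
      by apply: ler_wiXn2l; rewrite ?(ltW rho0) ?(ltW rho1).
    apply: le_trans (ler_wpM2r _ H); last by rewrite invr_ge0 ltW.
    rewrite exprM rho4 exprVn -{1}(subnK (_ : 2 * kp b (k i) <= s)%N); last first.
      by have [] := net_exponent_le ns Sn (kS i ui).
    rewrite exprD mul2n -addnn exprD le_eqVlt; apply/orP; left; apply/eqP; field.
    by rewrite !gt_eqF.
rewrite /blkT -[netavg A _](subrK (\prod_i avg (blkF u i))) -addrA.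
apply: le_trans (le_normcD _ _) _; apply: le_trans (lerD E1 E2) _.
by rewrite le_eqVlt; apply/orP; left; apply/eqP; ring.
Qed.

(** No cancellation is used: the net average and the exact mean are bounded separately. For the
    former the majorants are coarsened to n - ceil(v / 2) digits in total, which the net integrates
    exactly. *)
Lemma blkT_high u : (n < blkS u)%N -> normc (blkT u) <= 2 * blkM ^+ d * bR ^+ v / bR ^+ n.
Proof.
move=> Sn.
have [m mk mN] := subsum_exists (leq_trans (leq_subr (uphalf v) n) (ltnW Sn) : (_ <= \sum_i kap u i)%N).
have ms i : (m i <= s)%N.
  apply: leq_double_trans ns _.
  by apply: leq_trans (leq_subr (uphalf v) n); rewrite -mN (bigD1 i)//= leq_addr.
pose V i (y : 'cV['F_b]_s) : R := if u i then vv K (m i) (x i) y else normc (wc Th (k i) (x i)).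
have V0 i y : 0 <= V i y by rewrite /V; case: (u i); rewrite ?normc_ge0// vv_ge0.
have mkp i : u i -> (m i <= kp b (k i))%N by move=> ui; have := mk i; rewrite /kap ui.
have m0 i : ~~ u i -> m i = 0%N.
  by move=> ui; have := mk i; rewrite /kap (negbTE ui) leqn0 => /eqP.
have E1 : normc (netavg A (blkF u)) <= blkM ^+ d * bR ^+ v / bR ^+ n.
  apply: (@le_trans _ _ (\prod_i avg (V i))).
    have FV i y : `|blkF u i y| <= (V i y)%:C.
      rewrite normC_normc lecR /blkF /V; case: ifP => ui => //.
      exact: (wg_vv b_prime K0 Th2 ThD1 _ _ (mkp i ui)).
    have := @norm_netavg R[i] b d s n A _ (fun i y => (V i y)%:C) FV.
    rewrite (@netavg_low R[i] b d s n v A b_prime netA m (fun i y => (V i y)%:C)); last 2 first.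
    - by rewrite mN.
    - move=> i y y' yy'; rewrite /V; case: (u i) => //.
      by rewrite (vv_depends K (x i) yy').
    under eq_bigr do rewrite -cA.
    by rewrite -cP normC_normc lecR.
  have avgV0 i : 0 <= avg (V i) by exact: avg_ge0.
  have avgVM i : avg (V i) <= blkM * (bR ^+ m i)^-1.
    rewrite /V; case: (boolP (u i)) => ui.
      apply: le_trans (avg_vv b_prime K0 (x i) (ms i)) _.
      by rewrite ler_wpM2r ?invr_ge0 ?(ltW (bX0 _))// (proj2 blkM_ge).
    by rewrite avg_cst ?card_cV_gt0// m0// expr0 invr1 mulr1 blk_wc.
  apply: le_trans (prod_blkM_le avgV0 avgVM) _.
  rewrite -mulrA ler_wpM2l ?exprn_ge0// prodfV -expr_sum mN.
  rewrite ler_pdivlMr// mulrC ler_pdivrMr// -exprD ler_weXn2l//.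
  exact: leq_add_sub_uphalf.
have E2 : normc (\prod_i blkE u i) <= blkM ^+ d * bR ^+ v / bR ^+ n.
  have eE i : normc (blkE u i) <= blkM * (bR ^+ kap u i)^-1.
    rewrite /blkE /kap; case: ifP => ui; first exact: blk_we.
    by rewrite expr0 invr1 mulr1 blk_wc.
  rewrite normc_prod; apply: le_trans (prod_blkM_le (fun i => normc_ge0 _) eE) _.
  rewrite -mulrA ler_wpM2l ?exprn_ge0// prodfV -expr_sum.
  rewrite ler_pdivlMr// mulrC ler_pdivrMr// -exprD ler_weXn2l//.
  exact: leq_trans (ltnW Sn) (leq_addl _ _).
rewrite /blkT; apply: le_trans (normcB _ _) _; apply: le_trans (lerD E1 E2) _.
by rewrite le_eqVlt; apply/orP; left; apply/eqP; ring.
Qed.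

End net_blocks.

Lemma ge0_integral_finsum {R : realType} d (T : measurableType d)
    (mu : {measure set T -> \bar R}) (I : finType) (f : I -> T -> R) :
  (forall i, measurable_fun setT (f i)) -> (forall i x, 0 <= f i x) ->
  (\int[mu]_x (\sum_i f i x)%:E = \sum_i \int[mu]_x (f i x)%:E)%E.
Proof.
move=> mf f0; under eq_integral do rewrite -sumEFin.
rewrite ge0_integral_sum//; first by move=> i; apply/measurable_EFinP.
by move=> i x _; rewrite lee_fin.
Qed.

Lemma ge0_integral_scaled_finsum {R : realType} d (T : measurableType d)
    (mu : {measure set T -> \bar R}) (I : finType) (c : R) (f : I -> T -> R) : 0 <= c ->
  (forall i, measurable_fun setT (f i)) -> (forall i x, 0 <= f i x) ->
  (\int[mu]_x (c * \sum_i f i x)%:E = c%:E * \sum_i \int[mu]_x (f i x)%:E)%E.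
Proof.
move=> c0 mf f0; under eq_integral do rewrite EFinM.
rewrite ge0_integralZl// ?ge0_integral_finsum//.
- by apply/measurable_EFinP; exact: measurable_sum.
- by move=> x _; rewrite lee_fin sumr_ge0.
Qed.

(** * Weighted integrals of powers of the blocks *)

Section coordinate_tau.
Context {R : realType} {d : nat}.
Local Notation T := (measurableTypeR R).
Local Notation mu := (@lebesgue_tuple R d).

Definition prodtau (c a z : 'I_d -> R) (t : d.-tuple T) : R :=
  \prod_i (c i * tau (a i * (tnth t i - z i))).

Lemma prodtau_ge0 c a z t : (forall i, 0 <= c i) -> 0 <= prodtau c a z t.
Proof. by move=> c0; apply: prodr_ge0 => i _; rewrite mulr_ge0 ?tau_ge0. Qed.

Let mtau (c a z : R) : measurable_fun setT (fun x : T => c * tau (a * (x - z))).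
Proof.
apply: continuous_measurable_fun; apply: (continuous_compR _ (continuous_cstM (a := c))).
have h1 : continuous (fun x : R => x - z).
  by move=> y; apply: cvgB; [exact: cvg_id|exact: cvg_cst].
exact: (continuous_compR (continuous_compR h1 (continuous_cstM (a := a))) (@continuous_tau R)).
Qed.

Lemma measurable_prodtau c a z : measurable_fun setT (prodtau c a z).
Proof.
exact: (measurable_coord_prod (f := fun i x => c i * tau (a i * (x - z i)))).
Qed.

Lemma integral_prodtau c a z : (forall i, 0 <= c i) -> (forall i, 0 < a i) ->
  (\int[mu]_t (prodtau c a z t)%:E = (\prod_i (c i * (pi / a i)))%:E)%E.
Proof.
move=> c0 a0.
rewrite (ge0_integral_coord_prod (f := fun i x => c i * tau (a i * (x - z i))))//; last first.
  by move=> i x; rewrite mulr_ge0 ?tau_ge0.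
rewrite -prodEFin; apply: eq_bigr => i _.
under eq_integral do rewrite EFinM.
rewrite ge0_integralZl//.
- by rewrite integral_tau_scale.
- apply/measurable_EFinP; have := mtau 1 (a i) (z i).
  by apply: eq_measurable_fun => x _; rewrite mul1r.
- by move=> x _; rewrite lee_fin tau_ge0.
- by rewrite lee_fin.
Qed.

End coordinate_tau.

Section powers.
Context {R : realType}.

Lemma powR_expR (a p : R) : expR a `^ p = expR (p * a).
Proof. by rewrite /powR gt_eqF ?expR_gt0// expRK. Qed.

Lemma powR_prod (I : Type) (r : seq I) (F : I -> R) p : (forall i, 0 <= F i) ->
  (\prod_(i <- r) F i) `^ p = \prod_(i <- r) F i `^ p.
Proof.
move=> F0; elim: r => [|i r IH]; first by rewrite !big_nil powR1.
by rewrite !big_cons powRM// ?IH// prodr_ge0.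
Qed.

(** Each term is at most the p-th root of the sum of the p-th powers. *)
Lemma sum_powR_le (I : finType) (a : I -> R) p : 0 < p -> (forall i, 0 <= a i) ->
  (\sum_i a i) `^ p <= #|I|%:R `^ p * \sum_i a i `^ p.
Proof.
move=> p0 a0; set S := \sum_i a i `^ p.
have S0 : 0 <= S by apply: sumr_ge0 => i _; exact: powR_ge0.
have aS i : a i <= S `^ p^-1.
  rewrite -[a i]powRr1// -(mulfV (lt0r_neq0 p0)) powRrM.
  apply: ge0_ler_powR; rewrite ?nnegrE ?invr_ge0 ?powR_ge0 ?(ltW p0)//.
  by rewrite /S (bigD1 i)//= lerDl; apply: sumr_ge0 => j _; exact: powR_ge0.
have h : \sum_i a i <= #|I|%:R * S `^ p^-1.
  apply: le_trans (ler_sum _ (fun i _ => aS i)) _.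
  by rewrite sumr_const -[leLHS]mulr_natl.
apply: (@le_trans _ _ ((#|I|%:R * S `^ p^-1) `^ p)).
  by apply: ge0_ler_powR; rewrite ?nnegrE ?(ltW p0) ?sumr_ge0 ?mulr_ge0 ?powR_ge0.
by rewrite powRM ?powR_ge0// -powRrM mulVf ?gt_eqF// powRr1.
Qed.

Lemma powR_le_id (x p : R) : 0 <= x -> x <= 1 -> 1 <= p -> x `^ p <= x.
Proof.
move=> x0 x1 p1; have [->|xn0] := eqVneq x 0.
  by rewrite powR0// gt_eqF// (lt_le_trans ltr01).
by apply: ge1r_powR => //; rewrite lt0r xn0 x0.
Qed.

End powers.

Section block_integral.
Context {R : realType}.
Variables (b d v : nat).
Hypothesis b_prime : prime b.
Local Notation bR := (GRing.natmul (GRing.one R) b).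
Variables (Th : R -> R[i]) (phi0 : R -> R[i]) (K : R).
Local Notation ker := (ker0 phi0).
Hypothesis prf : kernel_profile bR K ker Th.
Variables (P r del : R).
Hypotheses (P1 : 1 <= P) (r0 : 0 <= r) (del0 : 0 < del) (del2 : del <= 2^-1)
  (Prd : P * (r + del) <= 1).
Local Notation T := (measurableTypeR R).
Local Notation mu := (@lebesgue_tuple R d).

Let b1 : 1 <= bR. Proof. by rewrite ler1n prime_gt0. Qed.
Let b0 : 0 < bR. Proof. by rewrite ltr0n prime_gt0. Qed.
Let bX0 m : 0 < bR ^+ m. Proof. by rewrite exprn_gt0. Qed.
Let K1 : 1 <= K := profile_ge1 prf.
Let K0 : 0 <= K := le_trans ler01 K1.
Let Th2 := profile_dilation prf.
Let ThD1 := profile_diff prf.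
Let P0 : 0 < P := lt_le_trans ltr01 P1.
Let lb : R := ln bR.
Let l2 : R := ln 2.
Let rho : R := expR (- (lb / 4)).

Let lb0 : 0 <= lb. Proof. exact: ln_ge0. Qed.
Let l20 : 0 <= l2. Proof. by apply: ln_ge0; rewrite ler1n. Qed.

Let bE m : bR ^+ m = expR (m%:R * lb).
Proof. by rewrite expRM_natl /lb lnK. Qed.

Let twoE m : 2 ^+ m = expR (m%:R * l2).
Proof. by rewrite expRM_natl /l2 lnK// posrE. Qed.

Let rho0 : 0 < rho. Proof. exact: expR_gt0. Qed.

Let rho4 : rho ^+ 4 = bR^-1.
Proof.
rewrite /rho -expRM_natl (_ : 4%:R * - (lb / 4) = - lb); last by field.
by rewrite expRN lnK.
Qed.

Definition kappa (k : {ffun 'I_d -> nat}) : R := (\sum_i k i)%:R * ln 2.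

(* [2^(-r P |k|) N^((r-1) P) min(Y, 1/Y)^(del P)] with [N = b^n], [Y = 2^|k| / N]. *)
Definition block_rate (n : nat) (k : {ffun 'I_d -> nat}) : R :=
  expR (- (r * P) * kappa k + (r - 1) * P * (n%:R * ln bR)
    - del * P * `|kappa k - n%:R * ln bR|).

Let sel (u : {ffun 'I_d -> bool}) (k : {ffun 'I_d -> nat}) (c : bool) : R :=
  \sum_i (if u i == c then (k i)%:R * l2 else 0).

Let kappa_sel u k : kappa k = sel u k true + sel u k false.
Proof.
rewrite /kappa natr_sum mulr_suml /sel -big_split /=; apply: eq_bigr => i _.
by case: (u i); rewrite ?addr0 ?add0r.
Qed.

Let sel_ge0 u k c : 0 <= sel u k c.
Proof. by apply: sumr_ge0 => i _; case: ifP => // _; rewrite mulr_ge0. Qed.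

Let S_sel u k : (blkS b k u)%:R * lb <= sel u k true.
Proof.
rewrite /blkS natr_sum mulr_suml /sel; apply: ler_sum => i _.
case: (u i); rewrite /= ?mul0r//.
by rewrite -ler_expR -bE -twoE kp_le.
Qed.

Let sel_S u k : sel u k true <= (blkS b k u)%:R * lb + d%:R * lb.
Proof.
rewrite /blkS natr_sum mulr_suml (_ : d%:R * lb = \sum_(i < d) lb); last first.
  by rewrite sumr_const card_ord mulr_natl.
rewrite -big_split /= /sel; apply: ler_sum => i _.
case: (u i) => /=; last by rewrite mul0r add0r.
by rewrite -ler_expR expRD -bE -twoE /lb lnK// mulrC kp_ge.
Qed.

(* In logarithms: y = kappa - m; the first regime has [S ln b <= m]. *)
Let low_exponent (a e m l : R) : 0 <= e -> a - m <= l -> 0 <= l ->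
  P * (2^-1 * a - 3 / 2 * m) - e <=
  (P / 2 + 1) * l + (- (r * P) * (a + e) + (r - 1) * P * m - del * P * `|a + e - m|).
Proof.
move=> e0 al l0; set y := a + e - m.
have -> : a = y - e + m by rewrite /y; ring.
rewrite -subr_ge0 (_ : _ - _ = (P / 2 + 1) * l + (P / 2 + 1) * e
  - (r * P + P / 2) * y - del * P * `|y|); last by field.
(* Above m the bound y - e <= l and [P * (r + del) <= 1] absorb the excess; below m there is a spare
   half power of Y, of which only del <= 1/2 is needed. *)
have [y0|y0] := leP 0 y.
  rewrite ger0_norm//.
  have h1 : (P / 2 + 1) * (y - e) <= (P / 2 + 1) * l.
    rewrite ler_wpM2l ?addr_ge0 ?divr_ge0 ?(ltW P0)//.
    by move: al; rewrite /y; lra.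
  have h2 : P * (r + del) * y <= 1 * y by rewrite ler_wpM2r.
  lra.
rewrite ltr0_norm//.
have h1 : 0 <= (P / 2 + 1) * l by rewrite mulr_ge0 ?addr_ge0 ?divr_ge0 ?(ltW P0).
have h2 : 0 <= (P / 2 + 1) * e by rewrite mulr_ge0 ?addr_ge0 ?divr_ge0 ?(ltW P0).
have h3 : 0 <= r * P * - y by rewrite !mulr_ge0 ?oppr_ge0 ?(ltW P0) ?(ltW y0).
have h4 : 0 <= (2^-1 - del) * P * - y.
  by rewrite !mulr_ge0 ?oppr_ge0 ?subr_ge0 ?(ltW P0) ?(ltW y0).
lra.
Qed.

(** The left side is the logarithm of (1 / N)^(P - 1) 2^-|k|, a power of the supremum times the L_1
    norm; the two sides differ by (1 - P (r + del)) (kp - m). *)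
Let high_exponent (kp m : R) : m <= kp ->
  - (P - 1) * m - kp <= - (r * P) * kp + (r - 1) * P * m - del * P * `|kp - m|.
Proof.
move=> mk; rewrite ger0_norm ?subr_ge0//.
have h : P * (r + del) * (kp - m) <= 1 * (kp - m) by rewrite ler_wpM2r// subr_ge0.
lra.
Qed.

Let C1 : R := (netC b d v rho + d%:R) * blkM b K ^+ d.
Let Q : R := (68 * K) `^ P * pi.
Let clow : R := C1 `^ P * Q ^+ d * expR ((P / 2 + 1) * (d%:R * lb)).
Let C2 : R := 2 * blkM b K ^+ d * bR ^+ v.
Let chigh : R := C2 `^ (P - 1) * (2 * (blkM b K * bR * pi) ^+ d).

Let K68 : 1 <= 68 * K. Proof. by have := K1; lra. Qed.
Let pi1 : 1 <= pi :> R. Proof. by apply: le_trans (pi_ge2 R); rewrite ler1n. Qed.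

Let Kp1 : 1 <= (68 * K) `^ P.
Proof. exact: le_trans K68 (le1r_powR K68 P1). Qed.

Variables (s n : nat) (A : 'I_d -> 'M['F_b]_(s, n)).
Hypothesis netA : order_digital_net 2 v A.
Variable k : {ffun 'I_d -> nat}.

Let xs (t : d.-tuple T) i : R := tnth t i.
Let Tu u t : R := normc (blkT Th ker A k (xs t) u).

Let M0 : 0 <= blkM b K := le_trans ler01 (blkM_ge1 b_prime prf).

(** The majorant H carries the measurability, so that only H is ever integrated. *)
Definition dominated_integral (F : d.-tuple T -> R) (B : R) := exists H : d.-tuple T -> R,
  [/\ measurable_fun setT H, forall t, 0 <= H t,
      forall t, F t <= H t & (\int[mu]_t (H t)%:E <= B%:E)%E].

Let omega (t : d.-tuple T) : R := \prod_i tau (tnth t i).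

Let C10 : 0 <= C1.
Proof.
rewrite /C1; apply: mulr_ge0; last exact: exprn_ge0.
apply: addr_ge0 => //; rewrite /netC.
have rho1 : rho < 1.
  rewrite -(ltr_pXn2r (ltn0Sn 3)) ?nnegrE ?(ltW rho0)// rho4 expr1n invf_lt1//.
  by rewrite ltr1n prime_gt1.
apply: mulr_ge0; last by rewrite invr_ge0 exprn_ge0// ltW.
apply: mulr_ge0; last by rewrite exprn_ge0// divr_ge0// subr_ge0 ltW.
by apply: mulr_ge0; rewrite exprn_ge0// ?mulr_ge0 ?exprn_ge0.
Qed.

Lemma low_integral u : (blkS b k u <= n)%N ->
  dominated_integral (fun t => omega t * Tu u t `^ P) (clow * block_rate n k).
Proof.
move=> Sn; pose E := C1 * rho ^+ (6 * (n - blkS b k u)).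
have E0 : 0 <= E by rewrite /E mulr_ge0// exprn_ge0// ltW.
(* In a selected coordinate the integrable factor is that of omega; in the others omega is bounded
   by 1 and the boundary layer at 1, of width 2^-k_i, is integrated. *)
pose c i : R := if u i then ((bR ^+ kp b (k i))^-1) `^ P else (68 * K) `^ P.
pose a i : R := if u i then 1 else 2 ^+ k i.
pose z i : R := if u i then 0 else 1.
have c0 i : 0 <= c i by rewrite /c; case: (u i); exact: powR_ge0.
have a0 i : 0 < a i by rewrite /a; case: (u i) => //; rewrite exprn_gt0.
exists (fun t => E `^ P * prodtau c a z t); split.
- by apply: measurable_funM => //; exact: measurable_prodtau.
- by move=> t; rewrite mulr_ge0 ?powR_ge0 ?prodtau_ge0.
- move=> t; have := blkT_low b_prime prf netA (xs t) rho0 rho4 Sn.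
  rewrite -/C1 -/E -/(Tu u t) => h.
  have G0 i : 0 <= (if u i then (bR ^+ kp b (k i))^-1 else normc (wc Th (k i) (xs t i))).
    by case: (u i); rewrite ?normc_ge0// invr_ge0 ltW.
  have hP : Tu u t `^ P <= E `^ P * \prod_i (if u i then (bR ^+ kp b (k i))^-1 else normc (wc Th (k i) (xs t i))) `^ P.
    have GP : 0 <= \prod_i (if u i then (bR ^+ kp b (k i))^-1 else normc (wc Th (k i) (xs t i))).
      by apply: prodr_ge0 => i _; exact: G0.
    rewrite -powR_prod// -powRM//.
    apply: ge0_ler_powR => //; rewrite ?nnegrE ?(ltW P0)//; first exact: normc_ge0.
    exact: mulr_ge0.
  have om0 : 0 <= omega t by apply: prodr_ge0 => i _; exact: tau_ge0.
  apply: le_trans (ler_wpM2l om0 hP) _; rewrite mulrCA ler_wpM2l ?powR_ge0//.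
  rewrite /omega -big_split /=; apply: ler_prod => i _.
  rewrite mulr_ge0 ?tau_ge0 ?powR_ge0//= /c /a /z; case: (u i).
    by rewrite mul1r subr0 mulrC.
  apply: (@le_trans _ _ (1 * (68 * K * tau (2 ^+ k i * (tnth t i - 1))) `^ P)).
    apply: ler_pM; rewrite ?tau_ge0 ?powR_ge0 ?tau_le1//.
    apply: ge0_ler_powR; rewrite ?nnegrE ?normc_ge0 ?(ltW P0) ?mulr_ge0 ?tau_ge0//.
    exact: (normc_wc K0 Th2).
  rewrite mul1r powRM ?tau_ge0 ?mulr_ge0// ler_wpM2l ?powR_ge0//.
  by apply: powR_le_id; rewrite ?tau_ge0 ?tau_le1.
- under eq_integral do rewrite EFinM.
  rewrite ge0_integralZl//; last 3 first.
  + by apply/measurable_EFinP; exact: measurable_prodtau.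
  + by move=> t _; rewrite lee_fin prodtau_ge0.
  + by rewrite lee_fin powR_ge0.
  rewrite integral_prodtau// -EFinM lee_fin.
  apply: (@le_trans _ _ (E `^ P * (Q ^+ d * (expR (- (P * ((blkS b k u)%:R * lb))) * expR (- sel u k false))))).
    rewrite ler_wpM2l ?powR_ge0//.
    rewrite -[X in Q ^+ X](card_ord d) -prodr_const /blkS natr_sum mulr_suml mulr_sumr.
    rewrite -!sumrN !expR_sum -!big_split /=; apply: ler_prod => i _.
    rewrite mulr_ge0 ?divr_ge0 ?pi_ge0 ?(ltW (a0 i))//= /c /a; case: (u i) => /=.
      rewrite oppr0 expR0 mulr1 divr1 bE -expRN powR_expR mulrN [leRHS]mulrC.
      by rewrite ler_wpM2l ?expR_ge0// /Q ler_peMl ?pi_ge0.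
    by rewrite mul0r mulr0 oppr0 expR0 mul1r /Q -mulrA twoE -expRN.
  rewrite /E powRM ?exprn_ge0 ?(ltW rho0)// /rho -expRM_natl powR_expR.
  have Qd0 : 0 <= Q ^+ d by rewrite exprn_ge0// /Q mulr_ge0 ?powR_ge0 ?pi_ge0.
  rewrite /clow /block_rate -!mulrA ler_wpM2l ?powR_ge0// mulrCA ler_wpM2l//.
  rewrite -!expRD ler_expR.
  have SS := S_sel u k; have al : sel u k true - n%:R * lb <= d%:R * lb.
    have Snl : (blkS b k u)%:R * lb <= n%:R * lb by rewrite ler_wpM2r// ler_nat.
    by have := sel_S u k; lra.
  have l0 : 0 <= d%:R * lb by rewrite mulr_ge0.
  have h := low_exponent (sel_ge0 u k false) al l0; rewrite -kappa_sel in h.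
  rewrite -/lb; apply: le_trans (_ : _ <= (P / 2 + 1) * (d%:R * lb) + (- (r * P) * kappa k +
    (r - 1) * P * (n%:R * lb) - del * P * `|kappa k - n%:R * lb|)) _; last by lra.
  apply: le_trans h; rewrite natrM natrB//.
  have : 0 <= P * (sel u k true - (blkS b k u)%:R * lb) by rewrite mulr_ge0 ?(ltW P0) ?subr_ge0.
  set D := (n%:R : R); set S := ((blkS b k u)%:R : R); lra.
Qed.

Lemma high_integral u : (n < blkS b k u)%N ->
  dominated_integral (fun t => omega t * Tu u t `^ P) (chigh * block_rate n k).
Proof.
move=> Sn.
(* The centres of localization: the net point in the selected coordinates, the boundary 1 in the
   others. *)
pose zz (w : 'cV['F_b]_n) i : R := if u i then zpt (A i *m w) else 1.
pose c2 i : R := if u i then blkM b K / bR ^+ kp b (k i) else 68 * K.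
pose a2 i : R := if u i then 1 else 2 ^+ k i.
pose z2 i : R := if u i then 0 else 1.
pose L1 w := prodtau (fun=> 68 * K) (fun i => 2 ^+ k i) (zz w).
pose L t : R := avg (fun w => L1 w t) + prodtau c2 a2 z2 t.
have c20 i : 0 <= c2 i.
  by rewrite /c2; case: (u i); [rewrite divr_ge0// ltW|exact: le_trans K68].
have a20 i : 0 < a2 i by rewrite /a2; case: (u i) => //; rewrite exprn_gt0.
have L10 w t : 0 <= L1 w t by apply: prodtau_ge0 => i; exact: le_trans K68.
have L0 t : 0 <= L t by rewrite addr_ge0 ?prodtau_ge0 ?avg_ge0.
have mL1 : measurable_fun setT (fun t => avg (fun w => L1 w t)).
  apply: measurable_funM => //; apply: measurable_sum => w; exact: measurable_prodtau.
have mL : measurable_fun setT L.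
  by apply: measurable_funD => //; exact: measurable_prodtau.
have C20 : 0 <= C2 by rewrite /C2 !mulr_ge0// ?exprn_ge0.
have om0 t : 0 <= omega t by apply: prodr_ge0 => i _; exact: tau_ge0.
have TL t : omega t * Tu u t <= L t.
  rewrite /Tu /blkT; apply: le_trans (ler_wpM2l (om0 t) (normcB _ _)) _.
  rewrite mulrDr; apply: lerD.
    apply: (@le_trans _ _ (avg (fun w => omega t * \prod_i normc (blkF Th k (xs t) u i (A i *m w))))).
      rewrite avgZ ler_wpM2l// /netavg -lecR -normC_normc; apply: le_trans (norm_avg _) _.
      rewrite /avg rmorphM /= real_complexV_nat real_complex_sum.
      rewrite ler_wpM2l ?invr_ge0 ?ler0n//; apply: ler_sum => w _.
      by rewrite normC_normc lecR normc_prod.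
    apply: ler_avg => w; rewrite /omega -big_split /=; apply: ler_prod => i _.
    rewrite mulr_ge0 ?tau_ge0 ?normc_ge0//= -[leRHS]mul1r.
    apply: ler_pM; rewrite ?tau_ge0 ?normc_ge0 ?tau_le1// /blkF /zz; case: (u i).
      apply: (normc_wg b_prime K0 Th2 ThD1).
      by have /andP[-> /ltW ->] := @zpt_ge0_lt1 R b s b_prime (A i *m w).
    exact: (normc_wc K0 Th2).
  rewrite /omega normc_prod -big_split /=; apply: ler_prod => i _.
  rewrite mulr_ge0 ?tau_ge0 ?normc_ge0//= /blkE /c2 /a2 /z2; case: (u i).
    by rewrite mul1r subr0 mulrC ler_wpM2r ?tau_ge0// (blk_we b_prime prf).
  rewrite -[leRHS]mul1r; apply: ler_pM; rewrite ?tau_ge0 ?normc_ge0 ?tau_le1//.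
  exact: (normc_wc K0 Th2).
exists (fun t => (C2 / bR ^+ n) `^ (P - 1) * L t); split.
- exact: measurable_funM.
- by move=> t; rewrite mulr_ge0 ?powR_ge0.
- move=> t.
  have h := blkT_high b_prime prf netA (xs t) Sn; rewrite -/C2 -/(Tu u t) in h.
  have Tu0 : 0 <= Tu u t := normc_ge0 _.
  rewrite -(mulr_powRB1 Tu0 P0) [Tu u t * _]mulrC mulrCA; apply: ler_pM; rewrite ?powR_ge0 ?mulr_ge0 ?TL//.
  by apply: ge0_ler_powR; rewrite ?nnegrE ?subr_ge0 ?divr_ge0 ?exprn_ge0 ?(ltW b0).
- under eq_integral do rewrite EFinM.
  rewrite ge0_integralZl//; last 3 first.
  + exact/measurable_EFinP.
  + by move=> t _; rewrite lee_fin.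
  + by rewrite lee_fin powR_ge0.
  have iL : (\int[mu]_t (L t)%:E <= (2 * (blkM b K * bR * pi) ^+ d * expR (- kappa k))%:E)%E.
    have MbP : 0 <= blkM b K * bR * pi := mulr_ge0 (mulr_ge0 M0 (ltW b0)) (pi_ge0 R).
    have MbX i : 0 <= blkM b K * bR * pi / 2 ^+ k i.
      exact: divr_ge0 MbP (exprn_ge0 _ (ler0n R 2)).
    have PE : \prod_i (blkM b K * bR * pi / 2 ^+ k i) = (blkM b K * bR * pi) ^+ d * expR (- kappa k).
      rewrite big_split /= prodr_const card_ord; congr (_ * _).
      rewrite /kappa natr_sum mulr_suml -sumrN expR_sum; apply: eq_bigr => i _.
      by rewrite twoE -expRN.
    have M68 : 68 * K <= blkM b K := proj1 (blkM_ge b_prime prf).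
    have Mb : blkM b K <= blkM b K * bR by rewrite ler_peMr.
    under eq_integral do rewrite EFinD.
    rewrite ge0_integralD//; last 4 first.
    + by move=> t _; rewrite lee_fin avg_ge0.
    + exact/measurable_EFinP.
    + by move=> t _; rewrite lee_fin prodtau_ge0.
    + by apply/measurable_EFinP; exact: measurable_prodtau.
    rewrite integral_prodtau//.
    have -> : (\int[mu]_t (avg (fun w => L1 w t))%:E = (\prod_i (68 * K * (pi / 2 ^+ k i)))%:E)%E.
      rewrite (@ge0_integral_scaled_finsum R _ _ mu _ _ L1) ?invr_ge0//; last by move=> w; exact: measurable_prodtau.
      (* The integral does not depend on the centres, so every net point contributes the same. *)
      have EL1 w : (\int[mu]_t (L1 w t)%:E = (\prod_i (68 * K * (pi / 2 ^+ k i)))%:E)%E.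
        apply: integral_prodtau => i; first exact: le_trans K68.
        by rewrite exprn_gt0.
      rewrite (eq_bigr _ (fun w _ => EL1 w)).
      rewrite sumEFin -EFinM; congr EFin; apply: avg_cst; exact: card_cV_gt0.
    rewrite -EFinD lee_fin -[leRHS]mulrA -PE [leRHS]mulr_natl [leRHS]mulr2n; apply: lerD.
      apply: ler_prod => i _; rewrite !mulr_ge0 ?invr_ge0 ?exprn_ge0 ?pi_ge0//=.
      rewrite -[leRHS]mulrA ler_wpM2r ?divr_ge0 ?exprn_ge0 ?pi_ge0//.
      exact: le_trans M68 Mb.
    apply: ler_prod => i _; rewrite mulr_ge0 ?divr_ge0 ?pi_ge0 ?(ltW (a20 i))//= /c2 /a2.
    case: (u i); last first.
      rewrite -[leRHS]mulrA ler_wpM2r ?divr_ge0 ?exprn_ge0 ?pi_ge0//.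
      exact: le_trans M68 Mb.
    have h : (bR ^+ kp b (k i))^-1 <= bR / 2 ^+ k i.
      by rewrite ler_pdivlMr ?exprn_gt0// mulrC ler_pdivrMr// kp_ge.
    have reshape (m a c p : R) : m / a * (p / 1) <= m * c * p / 2 ^+ k i = (m * p * a^-1 <= m * p * (c / 2 ^+ k i)).
      by rewrite divr1; congr (_ <= _); ring.
    rewrite reshape; apply: ler_wpM2l h; exact: mulr_ge0 M0 (pi_ge0 R).
  apply: le_trans (lee_wpmul2l _ iL) _; first by rewrite lee_fin powR_ge0.
  rewrite -EFinM lee_fin bE -expRN powRM ?expR_ge0// powR_expR.
  have reshape (a e f c g : R) : 0 <= a * f -> e * c <= g -> a * e * (f * c) <= a * f * g.
    by move=> af0 ecg; rewrite mulrACA; exact: ler_wpM2l.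
  apply: reshape.
    apply: mulr_ge0; first exact: powR_ge0.
    apply: mulr_ge0 => //; apply: exprn_ge0; exact: mulr_ge0 (mulr_ge0 M0 (ltW b0)) (pi_ge0 R).
  rewrite -expRD ler_expR.
  have mk : n%:R * lb <= kappa k.
    rewrite (kappa_sel u); apply: le_trans (_ : (blkS b k u)%:R * lb <= _).
      by rewrite ler_wpM2r// ler_nat ltnW.
    by rewrite (le_trans (S_sel u k))// lerDl.
  by have := high_exponent mk; rewrite -/lb; lra.
Qed.

End block_integral.

(** * Summation over the scales *)

Section box_sums.
Context {R : realType} {d : nat}.
Local Notation I := {ffun 'I_d -> nat}.
Implicit Types (f : I -> R).

Definition box_emb L (k : {ffun 'I_d -> 'I_L}) : I := [ffun i => k i : nat].

Lemma box_emb_inj L : injective (@box_emb L).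
Proof.
move=> k k' /ffunP kk'; apply/ffunP => i; apply: val_inj.
by have := kk' i; rewrite !ffunE.
Qed.

(** Boxes form an increasing sequence of finite index sets, which turns the sum over all k into a
    limit fit for monotone convergence. *)
Definition box_sum f L : R := \sum_(k : {ffun 'I_d -> 'I_L}) f (box_emb k).

Lemma box_sum_ge f (s : seq I) L : (forall k, 0 <= f k) -> uniq s ->
  (forall k, k \in s -> forall i, (k i < L)%N) -> \sum_(k <- s) f k <= box_sum f L.
Proof.
move=> f0 us sL; rewrite /box_sum -big_enum /= -(big_map (@box_emb L) xpredT f).
set s' := map _ _.
have us' : uniq s' by rewrite map_inj_uniq ?enum_uniq//; exact: box_emb_inj.
have ss' : {subset s <= s'}.
  move=> k ks; apply/mapP; exists [ffun i => Ordinal (sL k ks i)].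
    by rewrite mem_enum.
  by apply/ffunP => i; rewrite !ffunE.
rewrite [leRHS](bigID (mem s)) /= -[X in _ <= X + _]big_filter.
have -> : \sum_(k <- [seq k <- s' | k \in s]) f k = \sum_(k <- s) f k.
  apply: perm_big; apply: uniq_perm; rewrite ?filter_uniq// => k.
  by rewrite mem_filter andb_idr//; exact: ss'.
by rewrite lerDl; apply: sumr_ge0.
Qed.

Lemma box_sum_mono f L L' : (forall k, 0 <= f k) -> (L <= L')%N -> box_sum f L <= box_sum f L'.
Proof.
move=> f0 LL'; rewrite {1}/box_sum -big_enum /= -(big_map (@box_emb L) xpredT f).
apply: box_sum_ge => //; first by rewrite map_inj_uniq ?enum_uniq//; exact: box_emb_inj.
move=> k /mapP[k' _ ->] i; rewrite ffunE.
exact: leq_trans (ltn_ord _) LL'.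
Qed.

Lemma esum_box_le f B : (forall k, 0 <= f k) -> (forall L, box_sum f L <= B) ->
  (\esum_(k in [set: I]) (f k)%:E <= B%:E)%E.
Proof.
move=> f0 fB; apply: ge_ereal_sup => _ [A [finA _] <-].
rewrite fsbig_finite//= sumEFin lee_fin.
pose L := (\max_(k <- finmap.enum_fset (fset_set A)) \max_i k i).+1.
apply: le_trans (fB L); apply: box_sum_ge => //; first exact: finmap.fset_uniq.
move=> k kA i; rewrite /L ltnS.
apply: (@leq_trans (\max_i k i)%N); first exact: (leq_bigmax i).
by apply: (leq_bigmax_seq (F := fun k : I => \max_i k i)%N).
Qed.

End box_sums.

Section finite_jensen.
Context {R : realType}.

(* The terms with y <= sigma (sum y) / (2 Rn) account for at most half of the sum. *)
Lemma weighted_power_sum (I : finType) (sig y : I -> R) (Rn s : R) :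
  1 <= s -> 0 < Rn -> (forall i, 0 < sig i) -> (forall i, 0 <= y i) ->
  \sum_i sig i <= Rn ->
  (\sum_i y i) `^ s <= 2 `^ s * Rn `^ (s - 1) * \sum_i sig i `^ (1 - s) * y i `^ s.
Proof.
move=> s1 Rn0 sig0 y0 sR; set S := \sum_i y i.
have s0 : 0 < s := lt_le_trans ltr01 s1.
have S0 : 0 <= S by apply: sumr_ge0.
have Q0 i : 0 <= sig i `^ (1 - s) * y i `^ s by rewrite mulr_ge0 ?powR_ge0.
have [->|Sn0] := eqVneq S 0.
  by rewrite powR0 ?gt_eqF// !mulr_ge0 ?powR_ge0 ?sumr_ge0.
have Sp : 0 < S by rewrite lt0r Sn0.
have [c c0 cE] : exists2 c, 0 < c & c = S / (2 * Rn) by exists (S / (2 * Rn)); rewrite ?divr_gt0 ?mulr_gt0.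
have yi i : y i <= c * sig i + c `^ (1 - s) * (sig i `^ (1 - s) * y i `^ s).
  have cs0 : 0 < c * sig i := mulr_gt0 c0 (sig0 i).
  have [h|h] := leP (y i) (c * sig i).
    by rewrite ler_wpDr// mulr_ge0 ?powR_ge0.
  rewrite ler_wpDl ?(ltW cs0)//.
  have yp : 0 < y i by apply: lt_trans h.
  rewrite mulrA -powRM ?(ltW c0) ?(ltW (sig0 i))//.
  rewrite -(mulr_powRB1 (ltW yp) s0) mulrCA ler_peMr ?(ltW yp)//.
  rewrite -opprB powRN mulrC ler_pdivlMr ?powR_gt0// mul1r.
  by apply: ge0_ler_powR; rewrite ?subr_ge0 ?nnegrE ?(ltW cs0) ?(ltW yp) ?(ltW h).
have HS : S <= c * Rn + c `^ (1 - s) * \sum_i sig i `^ (1 - s) * y i `^ s.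
  apply: le_trans (ler_sum _ (fun i _ => yi i)) _.
  rewrite big_split /= -!mulr_sumr lerD2r ler_wpM2l// ltW//.
have cR : c * Rn = S / 2 by rewrite cE; field; rewrite gt_eqF.
rewrite cR in HS; set Q := \sum_i _ in HS *.
have HS2 : S <= 2 * (c `^ (1 - s) * Q) by lra.
have E : S `^ s = S * S `^ (s - 1) by rewrite mulr_powRB1.
rewrite E; apply: le_trans (ler_wpM2r (powR_ge0 _ _) HS2) _.
rewrite cE powRM ?invr_ge0 ?mulr_ge0 ?(ltW Rn0)// -opprB powRN.
have -> : (2 * Rn)^-1 `^ (- (s - 1)) = 2 `^ (s - 1) * Rn `^ (s - 1).
  by rewrite -powR_inv1 ?mulr_ge0 ?(ltW Rn0)// -powRrM mulN1r opprK powRM ?(ltW Rn0).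
have Ss : S `^ (s - 1) != 0 by rewrite gt_eqF// powR_gt0.
rewrite (_ : 2 `^ s = 2 * 2 `^ (s - 1)); last by rewrite mulr_powRB1.
rewrite le_eqVlt; apply/orP; left; apply/eqP; field.
exact: Ss.
Qed.

End finite_jensen.

Lemma leq_exp2rW m n e : (m <= n)%N -> (m ^ e <= n ^ e)%N.
Proof. by case: e => // e mn; rewrite leq_exp2r. Qed.

Section counting.
Context {R : realType}.

(** The first coordinate is determined by the sum and the other coordinates; the coordinate lost
    here makes the exponent of n equal to d - 1. *)
Lemma leq_card_sum_eq d L j :
  (#|[pred k : {ffun 'I_d.+1 -> 'I_L} | \sum_i (k i : nat) == j]| <= j.+1 ^ d)%N.
Proof.
pose h (k : {ffun 'I_d.+1 -> 'I_L}) : {ffun 'I_d -> 'I_j.+1} :=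
  [ffun i => inord (k (lift ord0 i))].
set A := [pred _ | _].
have kj (k : {ffun 'I_d.+1 -> 'I_L}) i : k \in A -> (k i < j.+1)%N.
  by rewrite inE => /eqP <-; rewrite (bigD1 i)//= ltnS leq_addr.
have -> : (j.+1 ^ d = #|{ffun 'I_d -> 'I_j.+1}|)%N by rewrite card_ffun !card_ord.
apply: (@leq_card_in _ _ h) => k k' kA k'A /ffunP hk.
have e i : k (lift ord0 i) = k' (lift ord0 i).
  apply: val_inj; have := congr1 val (hk i); rewrite !ffunE /= !inordK//; exact: kj.
apply/ffunP => i; case: (unliftP ord0 i) => [i'|] ->; first exact: e.
apply: val_inj; move: kA k'A; rewrite !inE !big_ord_recl => /eqP <- /eqP.
have -> : (\sum_(i < d) k (lift ord0 i) = \sum_(i < d) k' (lift ord0 i))%N.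
  by apply: eq_bigr => i' _; rewrite e.
by move/eqP; rewrite eqn_add2r => /eqP.
Qed.

(** From the term of degree e of the exponential series at c (l + 1). *)
Lemma poly_exp_bound (c : R) e : 0 < c ->
  exists2 C : R, 0 < C & forall l : nat, l.+1%:R ^+ e <= C * expR (c * l%:R).
Proof.
move=> c0; exists (e`!%:R / c ^+ e * expR c).
  by rewrite mulr_gt0 ?expR_gt0 ?divr_gt0 ?exprn_gt0// ltr0n fact_gt0.
move=> l; have E : expR c * expR (c * l%:R) = expR (c * l.+1%:R).
  by rewrite -expRD; congr expR; rewrite -natr1; ring.
rewrite -[leRHS]mulrA E.
have cl : 0 <= c * l.+1%:R by rewrite mulr_ge0// ltW.
have H : (c * l.+1%:R) ^+ e / e`!%:R <= expR (c * l.+1%:R).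
  case: e => [|e]; first by rewrite expr0 fact0 divr1; apply: le_trans (expR_ge1Dx _); rewrite lerDl.
  by apply: le_trans (expR_ge1Dxn e cl); rewrite lerDr.
rewrite mulrAC ler_pdivlMr ?exprn_gt0// mulrC -exprMn.
by rewrite [leRHS]mulrC -ler_pdivrMr ?ltr0n ?fact_gt0.
Qed.

(** Separates the size of the level j into a factor depending on M alone and one depending on the
    distance to M. *)
Lemma leq_dist_mul j M : (j.+1 <= M.+1 * ((j - M) + (M - j)).+1)%N.
Proof. nia. Qed.

(** At distance l from M a level has at most (M + 1)^d (l + 1)^d indices; half of the exponential
    decay pays for (l + 1)^d, the other half is summed. *)
Lemma box_geometric_sum d (c : R) : 0 < c ->
  exists2 C : R, 0 < C & forall L M,
    \sum_(k : {ffun 'I_d.+1 -> 'I_L})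
      expR (- (c * ((\sum_i (k i : nat) - M) + (M - \sum_i (k i : nat)))%:R)) <= C * M.+1%:R ^+ d.
Proof.
move=> c0; have c20 : 0 < c / 2 by rewrite divr_gt0.
have [C C0 HC] := poly_exp_bound d c20.
pose eta : R := expR (- (c / 2)).
have eta1 : eta < 1 by rewrite expR_lt1 oppr_lt0.
have eta0 : 0 < eta := expR_gt0 _.
exists (C * (2 / (1 - eta))) => [|L M].
  by rewrite mulr_gt0// divr_gt0// subr_gt0.
pose dist j := ((j - M) + (M - j))%N.
pose S (k : {ffun 'I_d.+1 -> 'I_L}) := (\sum_i (k i : nat))%N.
pose B := (d.+1 * L).+1.
have SB k : (S k < B)%N.
  rewrite /B ltnS /S -[X in (_ <= X * _)%N]card_ord -sum_nat_const.
  by apply: leq_sum => i _; exact: ltnW.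
rewrite (partition_big (fun k => Ordinal (SB k)) xpredT)//=.
apply: (@le_trans _ _ (\sum_(j < B) C * M.+1%:R ^+ d * eta ^+ dist j)).
  apply: ler_sum => j _.
  rewrite (eq_bigr (fun=> expR (- (c * (dist j)%:R)))); last first.
    by move=> k /eqP <-.
  rewrite sumr_const -[leLHS]mulr_natl.
  have cardj : (#|[pred k | Ordinal (SB k) == j]| <= j.+1 ^ d)%N.
    apply: leq_trans (leq_card_sum_eq d L j); apply: subset_leq_card.
    by apply/fintype.subsetP => k; rewrite !inE => /eqP <-.
  apply: (@le_trans _ _ ((M.+1 * (dist j).+1)%:R ^+ d * expR (- (c * (dist j)%:R)))).
    rewrite ler_wpM2r ?expR_ge0// -natrX ler_nat; apply: leq_trans cardj _.
    by rewrite leq_exp2rW ?leq_dist_mul.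
  rewrite natrM exprMn -[leLHS]mulrA [leRHS](_ : _ = M.+1%:R ^+ d * (C * eta ^+ dist j)); last by ring.
  rewrite ler_wpM2l ?exprn_ge0//.
  apply: le_trans (ler_wpM2r (expR_ge0 _) (HC (dist j))) _.
  rewrite -[leLHS]mulrA -expRD /eta -expRM_natl ler_wpM2l ?(ltW C0)// ler_expR.
  by rewrite le_eqVlt; apply/orP; left; apply/eqP; field.
rewrite -mulr_sumr mulrAC ler_wpM2r ?exprn_ge0// ler_wpM2l ?(ltW C0)//.
exact: geom_dist_sum.
Qed.

Lemma rate_sum_bound (d b : nat) (e : R) : (0 < d)%N -> prime b -> 0 < e ->
  exists2 C : R, 0 < C & forall n L, (0 < n)%N ->
    box_sum (fun k : {ffun 'I_d -> nat} => expR (- (e * `|kappa k - n%:R * ln b%:R|))) L <= C * n%:R ^+ d.-1.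
Proof.
case: d => [//|d] _ b_prime e0 /=.
have l20 : 0 < ln 2 :> R by apply: ln_gt0; rewrite ltr1n.
have [C C0 HC] := box_geometric_sum d (mulr_gt0 e0 l20).
exists (expR (e * ln 2) * C * (b.+1%:R) ^+ d) => [|n L n0].
  by rewrite !mulr_gt0 ?expR_gt0 ?exprn_gt0.
(* M ln 2 <= n ln b <= (M + 1) ln 2: passing from n ln b to a multiple of ln 2 costs the factor
   exp(e ln 2). *)
pose M := trunc_log 2 (b ^ n).
have bn0 : (0 < b ^ n)%N by rewrite expn_gt0 prime_gt0.
have lnX (c m : nat) : (0 < c)%N -> ln ((c ^ m)%:R : R) = m%:R * ln c%:R.
  by move=> c0; rewrite natrX lnXn ?ltr0n// mulr_natl.
have M1 : M%:R * ln 2 <= n%:R * ln b%:R :> R.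
  rewrite -(lnX 2%N)// -(lnX b) ?prime_gt0// ler_ln ?posrE ?ltr0n ?expn_gt0 ?prime_gt0//.
  by rewrite ler_nat trunc_logP.
have M2 : n%:R * ln b%:R <= M.+1%:R * ln 2 :> R.
  rewrite -(lnX 2%N)// -(lnX b) ?prime_gt0// ler_ln ?posrE ?ltr0n ?expn_gt0 ?prime_gt0//.
  by rewrite ler_nat ltnW// trunc_log_ltn.
have M3 : (M.+1 <= b.+1 * n)%N.
  have : (2 ^ M < 2 ^ (b * n).+1)%N.
    apply: leq_ltn_trans (trunc_logP _ bn0) _ => //.
    rewrite expnS expnM; apply: (@leq_ltn_trans ((2 ^ b) ^ n)%N).
      by rewrite leq_exp2rW// ltnW// ltn_expl.
    by rewrite -[X in (X < _)%N]mul1n ltn_mul2r expn_gt0 expn_gt0.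
  by rewrite ltn_exp2l// ltnS mulSn; move: n0; lia.
rewrite /box_sum; apply: (@le_trans _ _ (\sum_(k : {ffun 'I_d.+1 -> 'I_L}) expR (e * ln 2) *
    expR (- (e * ln 2 * ((\sum_i (k i : nat) - M) + (M - \sum_i (k i : nat)))%:R)))).
  apply: ler_sum => k _; rewrite -expRD ler_expR.
  have -> : kappa (box_emb k) = (\sum_i (k i : nat))%:R * ln 2 :> R.
    by rewrite /kappa; congr (_%:R * _); apply: eq_bigr => i _; rewrite ffunE.
  set j := (\sum_i _)%N.
  suff H : ((j - M) + (M - j))%:R * ln 2 <= ln 2 + `|j%:R * ln 2 - n%:R * ln b%:R| :> R.
    have := ler_wpM2l (ltW e0) H; lra.
  have [jM|Mj] := leqP j M.
    rewrite (_ : (j - M = 0)%N) ?add0n ?natrB//; last by apply/eqP; rewrite subn_eq0.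
    have := ler_norm (- (j%:R * ln 2 - n%:R * ln b%:R : R)); rewrite normrN.
    by move: M1 M2 l20; rewrite -natr1 => *; lra.
  rewrite (_ : (M - j = 0)%N) ?addn0 ?natrB ?(ltnW Mj)//; last by apply/eqP; rewrite subn_eq0 ltnW.
  have := ler_norm (j%:R * ln 2 - n%:R * ln b%:R : R).
  by move: M1 M2 l20; rewrite -natr1 => *; lra.
rewrite -mulr_sumr -!mulrA ler_wpM2l ?expR_ge0//; apply: le_trans (HC L M) _.
rewrite ler_wpM2l ?(ltW C0)// -exprMn -natrM lerXn2r ?nnegrE// ler_nat//.
Qed.

End counting.

(** Both integrals are suprema over the simple functions below the integrand. It is applied with the
    sum over all scales as the smaller function. *)
Lemma ge0_le_integral_setT {R : realType} d (T : measurableType d)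
    (mu : {measure set T -> \bar R}) (f g : T -> \bar R) :
  (forall x, 0 <= f x)%E -> (forall x, f x <= g x)%E ->
  (\int[mu]_x f x <= \int[mu]_x g x)%E.
Proof.
move=> f0 fg; have g0 x : (0 <= g x)%E := le_trans (f0 x) (fg x).
rewrite !ge0_integralTE//; apply: ge_ereal_sup => _ [h hf <-].
apply: ereal_sup_ubound; exists h => // x.
exact: le_trans (hf x) (fg x).
Qed.

Lemma powR_split {R : realType} (G T p P : R) : 0 <= G -> 0 < T -> 0 < p -> p <= P ->
  G `^ p <= T `^ p + T `^ (p - P) * G `^ P.
Proof.
move=> G0 T0 p0 pP; have [GT|TG] := leP G T.
  rewrite ler_wpDr ?mulr_ge0 ?powR_ge0//.
  by apply: ge0_ler_powR; rewrite ?nnegrE ?(ltW p0) ?(ltW T0).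
rewrite ler_wpDl ?powR_ge0//; have Gp : 0 < G := lt_trans T0 TG.
have -> : G `^ p = G `^ (p - P) * G `^ P.
  by rewrite -powRD ?subrK// gt_eqF ?implybT.
rewrite ler_wpM2r ?powR_ge0// -opprB !powRN lef_pV2 ?posrE ?powR_gt0//.
by apply: ge0_ler_powR; rewrite ?subr_ge0 ?nnegrE ?(ltW T0) ?(ltW Gp) ?(ltW TG).
Qed.

Lemma powR_ratio {R : realType} (x D q P : R) : q != 0 ->
  (x `^ (D / q)) `^ P = (x `^ D) `^ (P / q).
Proof. by move=> q0; rewrite -!powRrM; congr (_ `^ _); field. Qed.

(** * From single blocks to the sum over all scales *)

Section sequence_bound.
Context {R : realType}.
Variables (b d : nat).
Hypotheses (b_prime : prime b) (d0 : (0 < d)%N).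
Variables (p q r del Cb CR : R).
Local Notation P := (Num.max p q).
Hypotheses (p1 : 1 <= p) (q1 : 1 <= q) (CR0 : 0 < CR) (Cb0 : 0 <= Cb).
Local Notation T := (measurableTypeR R).
Local Notation mu := (@lebesgue_tuple R d).
Local Notation I := {ffun 'I_d -> nat}.
Variable n : nat.
Hypothesis n0 : (0 < n)%N.
Local Notation m := (n%:R * ln b%:R : R).
Hypothesis rate_sum : forall L,
  box_sum (fun k : I => expR (- (del * q * `|kappa k - m|))) L <= CR * n%:R ^+ d.-1.

Let omega (t : d.-tuple T) : R := \prod_i tau (tnth t i).
Variables (g : I -> d.-tuple T -> R) (H : I -> d.-tuple T -> R).
Hypotheses (g0 : forall k t, 0 <= g k t) (mH : forall k, measurable_fun setT (H k))
  (H0 : forall k t, 0 <= H k t) (gH : forall k t, omega t * g k t `^ P <= H k t)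
  (iH : forall k, (\int[mu]_t (H k t)%:E <= (Cb * block_rate b P r del n k)%:E)%E).

(** The target rate N^(r-1) n^((d-1)/q) in exponential form, also used as the splitting level. *)
Definition seq_scale : R := expR ((r - 1) * m) * n%:R `^ ((d%:R - 1) / q).

Definition seq_const : R := pi ^+ d + 2 `^ (P / q) * CR `^ (P / q) * Cb.

Let s := P / q.
Let Rn := CR * n%:R ^+ d.-1.
Let W := 2 `^ s * Rn `^ (s - 1).
Let sig (k : I) := expR (- (del * q * `|kappa k - m|)).
(** The weight that Jensen's inequality puts on the P-th powers. Times [block_rate] it is N^((r-1)
    P) [sig k] (see [weight_rate]), and [sig] sums to the order n^(d-1). *)
Let w (k : I) := sig k `^ (1 - s) * expR (r * P * kappa k).
Let X L t := box_sum (fun k => w k * H k t) L.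
Let Xl t := limn (fun L => (X L t)%:E).
Let Tn := seq_scale.

Let p0 : 0 < p := lt_le_trans ltr01 p1.
Let q0 : 0 < q := lt_le_trans ltr01 q1.
Let pP : p <= P. Proof. by rewrite le_max lexx. Qed.
Let qP : q <= P. Proof. by rewrite le_max lexx orbT. Qed.
Let P0 : 0 < P := lt_le_trans p0 pP.
Let s1 : 1 <= s. Proof. by rewrite /s ler_pdivlMr// mul1r. Qed.
Let qs : q * s = P. Proof. by rewrite /s mulrC divfK// gt_eqF. Qed.
Let n0' : 0 < n%:R :> R. Proof. by rewrite ltr0n. Qed.
Let Rn0 : 0 < Rn. Proof. by rewrite /Rn mulr_gt0 ?exprn_gt0. Qed.
Let Tn0 : 0 < Tn. Proof. by rewrite /Tn mulr_gt0 ?expR_gt0 ?powR_gt0. Qed.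
Let W0 : 0 < W. Proof. by rewrite /W mulr_gt0 ?powR_gt0. Qed.
Let w0 k : 0 <= w k. Proof. by rewrite /w mulr_ge0 ?powR_ge0 ?expR_ge0. Qed.
Let om0 t : 0 < omega t. Proof. by apply: prodr_gt0 => i _; exact: tau_gt0. Qed.
Let om1 t : omega t <= 1.
Proof.
apply: (@le_trans _ _ (\prod_(i < d) 1)); last by rewrite big1.
by apply: ler_prod => i _; rewrite tau_ge0 tau_le1.
Qed.

Let wH0 k t : 0 <= w k * H k t. Proof. by rewrite mulr_ge0. Qed.

Let X0 L t : 0 <= X L t. Proof. exact: sumr_ge0. Qed.

Let Xnd t : {homo (fun L => (X L t)%:E) : L L' / (L <= L')%N >-> (L <= L')%E}.
Proof. by move=> L L' LL'; rewrite lee_fin box_sum_mono. Qed.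

Let X_le L t : ((X L t)%:E <= Xl t)%E.
Proof.
rewrite /Xl (cvg_lim _ (ereal_nondecreasing_cvgn (@Xnd t)))//.
by apply: ereal_sup_ubound; exists L.
Qed.

Let mX L : measurable_fun setT (X L).
Proof.
by apply: measurable_sum => k; apply: measurable_funM.
Qed.

Let mHe k : measurable_fun setT (fun t => (H k t)%:E).
Proof. exact/measurable_EFinP. Qed.

Let H0e k t : (0 <= (H k t)%:E)%E. Proof. by rewrite lee_fin. Qed.

Let weight_rate k : w k * block_rate b P r del n k = expR ((r - 1) * P * m) * sig k.
Proof.
rewrite /w /sig powR_expR /block_rate -!expRD; congr expR.
have E : s * q = P by rewrite /s divfK// gt_eqF.
rewrite (_ : (1 - s) * - (del * q * `|kappa k - m|) =
   - (del * q * `|kappa k - m|) + del * (s * q) * `|kappa k - m|); last by ring.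
by rewrite E; ring.
Qed.

Let iX L : (\int[mu]_t (X L t)%:E <= (Cb * expR ((r - 1) * P * m) * Rn)%:E)%E.
Proof.
rewrite /X /box_sum (@ge0_integral_finsum R _ _ mu _
  (fun (k : {ffun 'I_d -> 'I_L}) t => w (box_emb k) * H (box_emb k) t))//; last first.
  by move=> k; apply: measurable_funM.
apply: (@le_trans _ _ (\sum_(k : {ffun 'I_d -> 'I_L}) (w (box_emb k) * (Cb * block_rate b P r del n (box_emb k)))%:E)%E).
  apply: lee_sum => k _; under eq_integral do rewrite EFinM.
  rewrite (ge0_integralZl_EFin _ measurableT (fun t _ => H0e _ t) (mHe _) (w0 _)).
  apply: le_trans (lee_wpmul2l _ (iH (box_emb k))) _; first by rewrite lee_fin.
  by rewrite -EFinM.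
rewrite sumEFin lee_fin.
rewrite (eq_bigr (fun k => Cb * expR ((r - 1) * P * m) * sig (box_emb k))); last first.
  move=> k _; rewrite -[RHS]mulrA -(weight_rate (box_emb k)); exact: mulrCA.
rewrite -mulr_sumr; apply: ler_wpM2l (rate_sum L).
by apply: mulr_ge0 => //; exact: expR_ge0.
Qed.

Let iXl : (\int[mu]_t Xl t <= (Cb * expR ((r - 1) * P * m) * Rn)%:E)%E.
Proof.
rewrite /Xl (@monotone_convergence _ _ _ mu setT measurableT (fun L t => (X L t)%:E)).
- apply: lime_le; last by apply: nearW => L; exact: iX.
  apply: ereal_nondecreasing_is_cvgn => L L' LL'; apply: ge0_le_integral => //.
  + by move=> t _; rewrite lee_fin.
  + exact/measurable_EFinP.
  + exact/measurable_EFinP.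
  + by move=> t _; exact: Xnd.
- by move=> L; exact/measurable_EFinP.
- by move=> L t _; rewrite lee_fin.
- by move=> t _; exact: Xnd.
Qed.

Let mXl : measurable_fun setT Xl.
Proof.
apply: (@emeasurable_fun_cvg _ _ _ setT (fun L t => (X L t)%:E)).
- by move=> L; exact/measurable_EFinP.
- by move=> t _; rewrite /Xl; apply: ereal_nondecreasing_is_cvgn; exact: Xnd.
Qed.

(** The k-th term 2^(r q |k|) |h_k|^q of the sequence norm, g being |h_k| / omega. *)
Definition seq_term k t : R := expR (r * q * kappa k) * (omega t * g k t) `^ q.

Let term0 k t : 0 <= seq_term k t. Proof. by rewrite mulr_ge0 ?expR_ge0 ?powR_ge0. Qed.

(** [weighted_power_sum] for the numbers 2^(r q |k|) g^q with exponent s = P / q, followed by the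
    s-th root. *)
Let term_box t x : Xl t = x%:E -> forall L,
  box_sum (fun k => seq_term k t) L <= (omega t * (W * x / omega t) `^ P^-1) `^ q.
Proof.
move=> Xx L; have x0 : 0 <= x.
  by rewrite -lee_fin -Xx; apply: le_trans (X_le L t); rewrite lee_fin.
pose Y k := expR (r * q * kappa k) * g k t `^ q.
have Y0 k : 0 <= Y k by rewrite mulr_ge0 ?expR_ge0 ?powR_ge0.
have Ys k : Y k `^ s = expR (r * P * kappa k) * g k t `^ P.
  rewrite /Y powRM ?expR_ge0 ?powR_ge0// powR_expR -powRrM qs.
  by rewrite -qs; congr (expR _ * _); ring.
have J := @weighted_power_sum R {ffun 'I_d -> 'I_L} (fun k => sig (box_emb k)) (fun k => Y (box_emb k)) Rn s
  s1 Rn0 (fun k => expR_gt0 _) (fun k => Y0 _) (rate_sum L).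
rewrite -/W in J.
have B1 : omega t * box_sum Y L `^ s <= W * x.
  apply: le_trans (ler_wpM2l (ltW (om0 t)) J) _; rewrite mulrCA ler_wpM2l ?(ltW W0)//.
  apply: (@le_trans _ _ (X L t)); last by rewrite -lee_fin -Xx.
  rewrite mulr_sumr; apply: ler_sum => k _.
  rewrite Ys mulrA -/(w (box_emb k)) mulrCA ler_wpM2l//.
have B2 : box_sum Y L <= (W * x / omega t) `^ s^-1.
  have S0 : 0 <= box_sum Y L by exact: sumr_ge0.
  rewrite -[leLHS]powRr1// -(divff (_ : s != 0)) ?gt_eqF ?(lt_le_trans ltr01)// powRrM.
  apply: ge0_ler_powR.
  - by rewrite invr_ge0 (le_trans ler01).
  - by rewrite nnegrE powR_ge0.
  - by rewrite nnegrE; exact: divr_ge0 (mulr_ge0 (ltW W0) x0) (ltW (om0 t)).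
  - by rewrite ler_pdivlMr// mulrC.
rewrite powRM ?(ltW (om0 t)) ?powR_ge0// -powRrM.
have -> : box_sum (fun k => seq_term k t) L = omega t `^ q * box_sum Y L.
  rewrite /box_sum mulr_sumr; apply: eq_bigr => k _.
  by rewrite /seq_term /Y powRM ?(ltW (om0 t))// mulrCA.
rewrite ler_wpM2l ?powR_ge0//; apply: le_trans B2 _.
by rewrite /s invf_div [P^-1 * q]mulrC.
Qed.

Let pointwise t :
  (((\esum_(k in [set: I]) (seq_term k t)%:E) `^ q^-1) `^ p <=
   (omega t * Tn `^ p)%:E + (Tn `^ (p - P) * W)%:E * Xl t)%E.
Proof.
have c0 : 0 < Tn `^ (p - P) * W by rewrite mulr_gt0 ?powR_gt0.
have X0' : (0 <= Xl t)%E by apply: le_trans (X_le 0 t); rewrite lee_fin.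
case Xx : (Xl t) X0' => [x| |] // X0'; last first.
  by rewrite mulry gtr0_sg// mul1e addey// leey.
pose G := (W * x / omega t) `^ P^-1.
have x0 : 0 <= x by rewrite -lee_fin.
have G0 : 0 <= G by exact: powR_ge0.
have Q0 : 0 <= W * x / omega t.
  by apply: divr_ge0; [apply: mulr_ge0 => //; exact: ltW|exact: ltW].
have GP : G `^ P = W * x / omega t.
  by rewrite /G -powRrM mulVf ?gt_eqF// powRr1.
have Z0 : (0 <= \esum_(k in [set: I]) (seq_term k t)%:E)%E.
  by apply: esum_ge0 => k _; rewrite lee_fin.
have ZG : (\esum_(k in [set: I]) (seq_term k t)%:E <= ((omega t * G) `^ q)%:E)%E.
  by apply: esum_box_le => [k|L]; [exact: term0|exact: (term_box Xx)].
have ZG1 : ((\esum_(k in [set: I]) (seq_term k t)%:E) `^ q^-1 <= (omega t * G)%:E)%E.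
  have -> : (omega t * G)%:E = (((omega t * G) `^ q)%:E `^ q^-1)%E.
    rewrite poweR_EFin -powRrM divff ?gt_eqF// powRr1//.
    by apply: mulr_ge0 => //; exact: ltW.
  apply: gt0_ler_poweR; rewrite ?invr_ge0 ?(ltW q0) ?in_itv/= ?leey ?andbT ?lee_fin ?powR_ge0//.
have ZG2 : (((\esum_(k in [set: I]) (seq_term k t)%:E) `^ q^-1) `^ p <= ((omega t * G) `^ p)%:E)%E.
  rewrite -poweR_EFin; apply: gt0_ler_poweR; rewrite ?(ltW p0) ?in_itv/= ?leey ?andbT ?poweR_ge0 ?lee_fin//.
  by apply: mulr_ge0 => //; exact: ltW.
apply: le_trans ZG2 _; rewrite -EFinM -EFinD lee_fin.
rewrite powRM ?(ltW (om0 t))//.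
(* omega^p <= omega because p >= 1 and omega <= 1; the finite measure omega dx stays in front of
   T^p. *)
apply: (@le_trans _ _ (omega t * (Tn `^ p + Tn `^ (p - P) * G `^ P))).
  apply: ler_pM; rewrite ?powR_ge0 ?powR_le_id ?(ltW (om0 t)) ?om1//.
  exact: powR_split.
have E (a c e : R) : 0 < a -> a * (c * (W * x / a)) = c * W * x.
  by move=> a0; field; rewrite gt_eqF.
by rewrite mulrDr lerD2l GP E.
Qed.

(** The first part of the pointwise bound integrates to pi^d T^p. In the second, W times the bound
    for the integral of [Xl] is a constant multiple of T^P, and T^(p-P) turns it into T^p. *)
Lemma integral_sequence :
  (\int[mu]_t ((\esum_(k in [set: I]) (seq_term k t)%:E) `^ q^-1) `^ p <=
   (seq_const * seq_scale `^ p)%:E)%E.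
Proof.
have c0 : 0 < Tn `^ (p - P) * W by rewrite mulr_gt0 ?powR_gt0.
have Xl0 t : (0 <= Xl t)%E by apply: le_trans (X_le 0 t); rewrite lee_fin.
have mom : measurable_fun setT omega.
  apply: (measurable_coord_prod (f := fun=> @tau R)) => i.
  by apply: continuous_measurable_fun; exact: continuous_tau.
apply: le_trans (ge0_le_integral_setT mu (fun t => poweR_ge0 _ _) pointwise) _.
rewrite ge0_integralD//; last 4 first.
- by move=> t _; rewrite lee_fin mulr_ge0 ?powR_ge0 ?(ltW (om0 t)).
- by apply/measurable_EFinP; exact: measurable_funM.
- by move=> t _; rewrite mule_ge0// lee_fin ltW.
- exact: emeasurable_funM.
rewrite (ge0_integralZl_EFin _ measurableT (fun t _ => Xl0 t) mXl (ltW c0)).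
under eq_integral do rewrite EFinM.
under eq_integral do rewrite muleC.
rewrite ge0_integralZl_EFin ?powR_ge0//; last 2 first.
- by move=> t _; rewrite lee_fin ltW.
- exact/measurable_EFinP.
rewrite muleC.
rewrite (ge0_integral_coord_prod (f := fun=> @tau R)); last 2 first.
- by move=> i; apply: continuous_measurable_fun; exact: continuous_tau.
- by move=> i x; exact: tau_ge0.
under eq_bigr do rewrite integral_tau.
rewrite prodEFin prodr_const card_ord -EFinM.
apply: le_trans (leeD (lexx _) (lee_wpmul2l _ iXl)) _; first by rewrite lee_fin ltW.
rewrite -EFinM -EFinD lee_fin /seq_const [leRHS]mulrDl -/Tn.
apply: lerD; first by [].
have sP : s * q = P by rewrite /s divfK// gt_eqF.
have TP : Tn `^ P = expR ((r - 1) * P * m) * (n%:R ^+ d.-1) `^ s.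
  rewrite /Tn /seq_scale powRM ?expR_ge0 ?powR_ge0// powR_expR; congr (_ * _).
    by congr expR; ring.
  rewrite (_ : d%:R - 1 = d.-1%:R); last by rewrite -subn1 natrB.
  by rewrite powR_ratio ?gt_eqF// powR_mulrn ?ler0n.
have TpP : Tn `^ (p - P) * Tn `^ P = Tn `^ p.
  by rewrite -powRD ?subrK// gt_eqF ?implybT.
have WR : W * Rn = 2 `^ s * CR `^ s * (n%:R ^+ d.-1) `^ s.
  rewrite /W -mulrA [Rn `^ _ * _]mulrC mulr_powRB1 ?(ltW Rn0) ?(lt_le_trans ltr01)//.
  by rewrite /Rn powRM ?exprn_ge0 ?(ltW CR0)// mulrA.
rewrite -TpP TP le_eqVlt; apply/orP; left; apply/eqP.
rewrite [LHS](_ : _ = Tn `^ (p - P) * (W * Rn) * (Cb * expR ((r - 1) * P * m))); last by ring.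
by rewrite WR -/s; ring.
Qed.

End sequence_bound.

(** * Bound of the sequence norm *)

Section dominated_block.
Context {R : realType}.
Variables (b d v : nat).
Hypothesis b_prime : prime b.
Local Notation bR := (GRing.natmul (GRing.one R) b).
Variables (Th : R -> R[i]) (phi0 : R -> R[i]) (K : R).
Hypothesis prf : kernel_profile bR K (ker0 phi0) Th.
Variables (P r del : R).
Hypotheses (P1 : 1 <= P) (r0 : 0 <= r) (del2 : del <= 2^-1)
  (Prd : P * (r + del) <= 1).
Local Notation T := (measurableTypeR R).

Definition low_const : R :=
  ((netC b d v (expR (- (ln bR / 4))) + d%:R) * blkM b K ^+ d) `^ P *
  ((68 * K) `^ P * pi) ^+ d * expR ((P / 2 + 1) * (d%:R * ln bR)).

Definition high_const : R :=
  (2 * blkM b K ^+ d * bR ^+ v) `^ (P - 1) * (2 * (blkM b K * bR * pi) ^+ d).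

(** There are 2^d terms u: [sum_powR_le] costs (2^d)^P, and summing their majorants 2^d. Adding both
    constants covers either regime. *)
Definition block_const : R :=
  #|{ffun 'I_d -> bool}|%:R `^ P * (#|{ffun 'I_d -> bool}|%:R * (low_const + high_const)).

Let low0 : 0 <= low_const.
Proof.
apply: mulr_ge0 (expR_ge0 _); apply: mulr_ge0 (powR_ge0 _ _) _.
by apply: exprn_ge0; apply: mulr_ge0 (powR_ge0 _ _) (pi_ge0 _).
Qed.

Let high0 : 0 <= high_const.
Proof.
apply: mulr_ge0 (powR_ge0 _ _) _; apply: mulr_ge0 => //; apply: exprn_ge0.
apply: mulr_ge0 (pi_ge0 _); apply: mulr_ge0; last exact: ler0n.
exact: le_trans ler01 (blkM_ge1 b_prime prf).
Qed.

Lemma block_const_ge0 : 0 <= block_const.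
Proof.
apply: mulr_ge0 (powR_ge0 _ _) _; apply: mulr_ge0 (ler0n _ _) _.
exact: addr_ge0.
Qed.

Variables (s n : nat) (A : 'I_d -> 'M['F_b]_(s, n)).
Hypothesis netA : order_digital_net 2 v A.
Variable k : {ffun 'I_d -> nat}.

Let rate0 : 0 <= block_rate b P r del n k. Proof. exact: expR_ge0. Qed.

Lemma normc_discr_block_tau (t : d.-tuple T) :
  normc (discr_block phi0 (digital_net A) k (rV_of_tuple t)) / \prod_i tau (tnth t i) <=
  \sum_u normc (blkT Th (ker0 phi0) A k (fun i => tnth t i) u).
Proof.
pose F (x : 'I_d -> R) : R[i] :=
  (b ^ n)%:R^-1 * (\sum_(nu < b ^ n) \prod_i jump (ker0 phi0) (k i) (x i) (digital_net A nu 0 i))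
  - \prod_i ramp (ker0 phi0) (k i) (x i).
have -> : discr_block phi0 (digital_net A) k (rV_of_tuple t) = F (fun i => tnth t i).
  have <- : (fun i => rV_of_tuple t 0 i) = (fun i => tnth t i) by apply/funext => i; rewrite mxE.
  by [].
apply: le_trans (normc_sum _ _ _); rewrite -(blkT_sum b_prime prf A k) -/(F (fun i => tnth t i)).
move: (F _) => h.
have -> : (\prod_i tau (tnth t i))^-1 = \prod_i wgt (tnth t i).
  by rewrite -prodfV; apply: eq_bigr => i _; rewrite /tau invrK.
have -> : \prod_i (wgt (tnth t i))%:C = (\prod_i wgt (tnth t i))%:C :> R[i].
  exact/esym/rmorph_prod.
rewrite Normc.normcM normc_real ger0_norm 1?mulrC//.
by apply: prodr_ge0 => i _; exact: le_trans ler01 (wgt_ge1 _).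
Qed.

Lemma dominated_block : dominated_integral (fun t => (\prod_i tau (tnth t i)) *
    (normc (discr_block phi0 (digital_net A) k (rV_of_tuple t)) / \prod_i tau (tnth t i)) `^ P)
  (block_const * block_rate b P r del n k).
Proof.
have /choice[H HP] : forall u, exists H : d.-tuple T -> R, [/\ measurable_fun setT H,
    forall t, 0 <= H t,
    forall t, \prod_i tau (tnth t i) * normc (blkT Th (ker0 phi0) A k (fun i => tnth t i) u) `^ P <= H t &
    (\int[lebesgue_tuple d]_t (H t)%:E <= ((low_const + high_const) * block_rate b P r del n k)%:E)%E].
  move=> u; have [Sn|Sn] := leqP (blkS b k u) n.
    have [H [mH H0 leH iH]] := low_integral b_prime prf P1 r0 del2 Prd netA Sn.
    exists H; split => //; apply: le_trans iH _; rewrite lee_fin.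
    by apply: ler_wpM2r => //; rewrite lerDl.
  have [H [mH H0 leH iH]] := high_integral b_prime prf P1 Prd netA Sn.
  exists H; split => //; apply: le_trans iH _; rewrite lee_fin.
  by apply: ler_wpM2r => //; rewrite lerDr.
have c0 : 0 <= #|{ffun 'I_d -> bool}|%:R `^ P :> R := powR_ge0 _ _.
have H0 u t : 0 <= H u t by have [_ h _ _] := HP u.
have mH u : measurable_fun setT (H u) by have [h _ _ _] := HP u.
have om0 (t : d.-tuple T) : 0 <= \prod_i tau (tnth t i).
  by apply: prodr_ge0 => i _; exact: tau_ge0.
exists (fun t => #|{ffun 'I_d -> bool}|%:R `^ P * \sum_u H u t); split.
- by apply: measurable_funM => //; exact: measurable_sum.
- by move=> t; apply: mulr_ge0 => //; apply: sumr_ge0.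
- move=> t.
  have b0 u : 0 <= normc (blkT Th (ker0 phi0) A k (fun i => tnth t i) u) by exact: normc_ge0.
  apply: (@le_trans _ _ (\prod_i tau (tnth t i) *
      (#|{ffun 'I_d -> bool}|%:R `^ P * \sum_u normc (blkT Th (ker0 phi0) A k (fun i => tnth t i) u) `^ P))).
    apply: ler_wpM2l => //; apply: le_trans (sum_powR_le (lt_le_trans ltr01 P1) b0).
    apply: ge0_ler_powR (normc_discr_block_tau t).
    + exact: le_trans ler01 P1.
    + by rewrite nnegrE divr_ge0 ?normc_ge0.
    + by rewrite nnegrE sumr_ge0.
  rewrite mulrCA; apply: ler_wpM2l => //; rewrite mulr_sumr; apply: ler_sum => u _.
  by have [_ _ h _] := HP u.
- rewrite ge0_integral_scaled_finsum// /block_const -mulrA [leRHS]EFinM.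
  apply: lee_wpmul2l; first by rewrite lee_fin.
  apply: (@le_trans _ _ (\sum_(u : {ffun 'I_d -> bool}) ((low_const + high_const) * block_rate b P r del n k)%:E)%E).
    by apply: lee_sum => u _; have [_ _ _ h] := HP u.
  by rewrite sumEFin lee_fin sumr_const -mulrA [leRHS]mulr_natl.
Qed.

End dominated_block.

Section sequence_norm.
Context {R : realType} (phi0 : R -> R[i]).
Hypothesis hphi0 : lp_cutoff phi0.
Variables (b d v : nat).
Hypotheses (b_prime : prime b) (d0 : (0 < d)%N).
Variables (p q r : R).
Hypotheses (p1 : 1 <= p) (q1 : 1 <= q) (r0 : 0 <= r) (rP : r < 1 / Num.max p q).
Local Notation T := (measurableTypeR R).
Local Notation bR := (GRing.natmul (GRing.one R) b).

(** Increments up to b are required: [kp] rounds 2^k down to a power of b, so changing an unresolved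
    digit may move the point by as much as b 2^-k. *)
Lemma kernel_profile_exists : exists Th K, kernel_profile bR K (ker0 phi0) Th.
Proof.
have [Th [C [C0 dTh kerC Th2 ThD]]] := profile_exists hphi0.
have [c1 c2] : 0 <= (2 * (1 + bR ^+ 2)) ^+ 2 /\ 0 <= (2 * (1 + (2 * bR) ^+ 2)) ^+ 2 by rewrite !sqr_ge0.
set k1 := (2 * (1 + bR ^+ 2)) ^+ 2 in c1 *; set k2 := (2 * (1 + (2 * bR) ^+ 2)) ^+ 2 in c2 *.
exists Th, (1 + C * (1 + k1 + k2)).
have [h0 h1 h2] : [/\ C <= 1 + C * (1 + k1 + k2), C * k1 <= 1 + C * (1 + k1 + k2) &
    C * k2 <= 1 + C * (1 + k1 + k2)].
  by have := mulr_ge0 C0 c1; have := mulr_ge0 C0 c2; split; lra.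
have t2 (u : R) m : 0 <= tau u ^+ m by rewrite exprn_ge0 ?tau_ge0.
split => //.
- by have := mulr_ge0 C0 c1; have := mulr_ge0 C0 c2; lra.
- exact: ker0_continuous.
- by move=> u; apply: le_trans (Th2 u) _; apply: ler_wpM2r.
- move=> u h hB; have [H _] := ThD bR u h h hB hB; apply: le_trans H _.
  by apply: ler_wpM2r => //; apply: ler_wpM2r.
- move=> u h h' hB hB'; have [_ H] := ThD bR u h h' hB hB'; apply: le_trans H _.
  by apply: ler_wpM2r => //; apply: ler_wpM2r => //; exact: mulr_ge0.
- by move=> u; apply: le_trans (kerC u) _; apply: ler_wpM2r.
Qed.

Lemma digital_net_cube s n (A : 'I_d -> 'M['F_b]_(s, n)) nu i :
  0 <= (digital_net A nu 0 i : R) < 1.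
Proof. by rewrite digital_netE; exact: zpt_ge0_lt1. Qed.

Lemma TL_sequence_norm_discr_block : exists2 C : R, 0 < C &
  forall (n s : nat) (A : 'I_d -> 'M['F_b]_(s, n)), (0 < n)%N -> order_digital_net 2 v A ->
  (TL_sequence_norm p q r (discr_block phi0 (digital_net A)) <=
   (C * b%:R `^ (n%:R * (r - 1)) * n%:R `^ ((d%:R - 1) / q))%:E)%E.
Proof.
have [Th [K prf]] := kernel_profile_exists.
set P := Num.max p q.
have P1 : 1 <= P by rewrite le_max p1.
have P0 : 0 < P := lt_le_trans ltr01 P1.
have q0 : 0 < q := lt_le_trans ltr01 q1.
have p0 : 0 < p := lt_le_trans ltr01 p1.
(* Positive because r < 1/P; the second entry ensures P (r + del) <= 1, the first keeps del within
   the spare half power of Y. *)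
pose del := Num.min 2^-1 (1 / P - r).
have del0 : 0 < del by rewrite lt_min invr_gt0 ltr0n subr_gt0.
have del2 : del <= 2^-1 by rewrite ge_min lexx.
have Prd : P * (r + del) <= 1.
  rewrite -ler_pdivlMl// mulr1 -[P^-1]mul1r -lerBrDl.
  by rewrite ge_min lexx orbT.
have [CR CR0 hCR] := @rate_sum_bound R d b (del * q) d0 b_prime (mulr_gt0 del0 q0).
pose Cb := block_const b d v K P.
have Cb0 : 0 <= Cb := block_const_ge0 _ _ b_prime prf _.
pose C := seq_const d p q Cb CR.
have C0 : 0 < C.
  rewrite /C /seq_const ltr_pwDl ?exprn_gt0 ?pi_gt0//.
  by apply: mulr_ge0 => //; apply: mulr_ge0; exact: powR_ge0.
exists (C `^ p^-1); first exact: powR_gt0.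
move=> n s A n0 netA.
pose om (t : d.-tuple T) : R := \prod_i tau (tnth t i).
have om0 t : 0 < om t by apply: prodr_gt0 => i _; exact: tau_gt0.
pose g k t := normc (discr_block phi0 (digital_net A) k (rV_of_tuple t)) / om t.
have g0 k t : 0 <= g k t by apply: divr_ge0 (normc_ge0 _) (ltW (om0 t)).
have /choice[H HP] := fun k => dominated_block b_prime prf P1 r0 del2 Prd netA k.
have seqE t (k : {ffun 'I_d -> nat}) : (2 `^ (r * (\sum_i k i)%:R * q) *
    normc (discr_block phi0 (digital_net A) k (rV_of_tuple t)) `^ q) = seq_term q r g k t.
  have gE : om t * g k t = normc (discr_block phi0 (digital_net A) k (rV_of_tuple t)).
    by rewrite /g mulrC divfK// gt_eqF.
  rewrite /seq_term -/(om t) gE; congr (_ * _).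
  by rewrite /powR pnatr_eq0 /= /kappa; congr expR; ring.
have := @integral_sequence R b d d0 p q r del Cb CR p1 q1 CR0 Cb0 n n0 (fun L => hCR n L n0)
  g H g0 (fun k => let: And4 h _ _ _ := HP k in h) (fun k => let: And4 _ h _ _ := HP k in h)
  (fun k => let: And4 _ _ h _ := HP k in h) (fun k => let: And4 _ _ _ h := HP k in h).
set I := (\int[_]_t _)%E => hI.
have I0 : (0 <= I)%E by apply: integral_ge0 => t _; exact: poweR_ge0.
have -> : TL_sequence_norm p q r (discr_block phi0 (digital_net A)) = (I `^ p^-1)%E.
  rewrite /TL_sequence_norm unlock /=; congr (_ `^ _)%E; apply: eq_integral => t _.
  rewrite gee0_abs ?poweR_ge0//; congr ((_ `^ _) `^ _)%E.
  by apply: eq_esum => k _; rewrite seqE.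
have S0 : 0 <= seq_scale b d q r n :> R by rewrite mulr_ge0 ?expR_ge0 ?powR_ge0.
apply: (@le_trans _ _ ((C * seq_scale b d q r n `^ p)%:E `^ p^-1)%E).
  apply: gt0_ler_poweR => //; first by rewrite invr_ge0 ltW.
  - by rewrite in_itv/= I0 leey.
  - by rewrite in_itv/= leey andbT lee_fin mulr_ge0 ?(ltW C0) ?powR_ge0.
rewrite poweR_EFin lee_fin powRM ?(ltW C0) ?powR_ge0// -powRrM divff ?gt_eqF// powRr1//.
rewrite -[leRHS]mulrA; apply: ler_wpM2l (powR_ge0 _ _) _ _ _.
have -> : b%:R `^ (n%:R * (r - 1)) = expR ((r - 1) * (n%:R * ln b%:R)) :> R.
  by rewrite /powR pnatr_eq0 gtn_eqF ?prime_gt0//; congr expR; ring.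
by [].
Qed.

End sequence_norm.

Theorem corollary1p5 (R : realType) (phi0 : R -> R[i]) (hphi0 : lp_cutoff phi0)
    (d b v : nat) (hd : (1 <= d)%N) (hb : prime b)
    (p q r : R) (hp : 1 <= p) (hq : 1 <= q)
    (hr0 : 0 <= r) (hr1 : r < 1 / Num.max p q) :
  exists2 C : R, 0 < C &
    forall (n s : nat) (A : 'I_d -> 'M['F_b]_(s, n)),
      (0 < n)%N -> order_digital_net 2 v A ->
      (TL_cube_norm phi0 p q r (cube_distr (discrepancy (digital_net A)))
        <= (C * b%:R `^ (n%:R * (r - 1)) * n%:R `^ ((d%:R - 1) / q))%:E)%E.
Proof.
have [C C0 hC] := TL_sequence_norm_discr_block hphi0 v hb hd hp hq hr0 hr1.
have [Th [K prf]] := kernel_profile_exists hphi0 b.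
exists C => // n s A n0 netA; have {}hC := hC n s A n0 netA.
have N0 : (0 < b ^ n)%N by rewrite expn_gt0 prime_gt0.
have K0 : 0 <= K := le_trans ler01 (profile_ge1 prf).
have b1 : 1 <= b%:R :> R by rewrite ler1n prime_gt0.
have P01 nu i : 0 <= (digital_net A nu 0 i : R) < 1 := digital_net_cube hb A nu i.
set D := cube_distr _.
have TLn : (TL_norm phi0 p q r D <= TL_sequence_norm p q r (discr_block phi0 (digital_net A)))%E.
  apply: ereal_inf_lbound; exists (discr_block phi0 (digital_net A)) => // k; split.
    exact: (discr_block_continuous hphi0 K0 b1 (profile_derive prf)
      (profile_diff prf) (profile_kernel prf) P01).
  move=> f Sf; have [h1 h2] := discr_block_cint hphi0 K0 (profile_kernel prf) N0 P01 k Sf.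
  by split; [apply/cintegrableT|rewrite cintegralT].
apply: le_trans (le_trans TLn hC); apply: ereal_inf_lbound; exists D => //; split => //.
split; first exact: tempered_cube_distr.
by apply: le_lt_trans (le_trans TLn hC) _; rewrite ltry.
Qed.
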